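(* Let $A\in\mathfrak{gl}_n(\mathbb C)$ and let $(G_A,J_A)$ be the simply-connected almost-abelian complex Lie group determined by $A$. Then $(G_A,J_A)$ admits at most one left-invariant $\mathrm{HCF}_+$ soliton up to homotheties (i.e. up to scaling and pullback by biholomorphic Lie group automorphisms). Moreover, $(G_A,J_A)$ admits a left-invariant $\mathrm{HCF}_+$ soliton if and only if $A$ is semi-simple (diagonalizable over $\mathbb C$) or nilpotent.
   Context: For $A\in\mathfrak{gl}_n(\mathbb C)$, let $\mu_A$ be the complex Lie bracket on $\mathbb C^{n+1}$ with basis $Z_0,Z_1,\dots,Z_n$ defined by $\mu_A(Z_0,Z_i)=AZ_i$ for $i\ge1$ (viewing $A$ as acting on $\mathrm{span}\{Z_1,\dots,Z_n\}\cong\mathbb C^n$) and $\mu_A(Z_i,Z_j)=0$ for $i,j\ge1$; $(G_A,J_A)$ is the simply-connected complex Lie group with Lie algebra $(\mathbb C^{n+1},\mu_A)$. Every simply-connected almost-abelian complex Lie group (one whose Lie algebra has a complex codimension-one abelian ideal) is of this form. For a left-invariant Hermitian metric $g$ on a complex Lie group with Lie algebra $\mathfrak g$, bracket $\mu$, the torsion-twisted Chern–Ricci tensor is given, for any left-invariant holomorphic frame $Z_1,\dots,Z_m$ of $\mathfrak g^{1,0}$, by $\Theta(g)(Z_i,\bar Z_j)=\tfrac12 g^{k\bar l}g^{r\bar s}\,g(Z_i,\mu(\bar Z_l,\bar Z_s))\,g(\mu(Z_k,Z_r),\bar Z_j)$ (summation convention). A left-invariant $\mathrm{HCF}_+$ soliton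 is a left-invariant Hermitian metric with $\Theta(g)=\lambda g+\mathcal L_Zg$ for some $\lambda\in\mathbb R$ and holomorphic vector field $Z$. *)

(* Defs.v *)
From HB Require Import structures.
From mathcomp Require Import all_boot all_algebra.
From mathcomp Require Import reals complex.
From Stdlib Require Import ClassicalEpsilon.
Set Implicit Arguments. Unset Strict Implicit. Unset Printing Implicit Defensive.
Import GRing.Theory Num.Theory.
Local Open Scope ring_scope.

Definition cmx {R : realType} {m k} (M : 'M[complex R]_(m, k)) : 'M[complex R]_(m, k) :=
  map_mx (@conjc R) M.

Definition rC {R : realType} (t : R) : complex R := real_complex R t.

Definition vnorm {R : realType} {m} (v : 'cV[complex R]_m) : complex R :=
  \sum_i `|v i 0|.
Definition mnorm {R : realType} {m k} (M : 'M[complex R]_(m, k)) : complex R :=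
  \sum_i \sum_j `|M i j|.

Definition is_expm {R : realType} {n} (M E : 'M[complex R]_n) : Prop :=
  forall eps : R, 0 < eps -> exists N0 : nat, forall N : nat, (N0 <= N)%N ->
    mnorm ((\sum_(k < N) (k`!%:R)^-1 *: M ^+ k) - E) <= rC eps.

Definition expm {R : realType} {n} (M : 'M[complex R]_n) : 'M[complex R]_n :=
  match excluded_middle_informative (exists E, is_expm M E) with
  | left h => proj1_sig (constructive_indefinite_description _ h)
  | right _ => 0
  end.

(* The group G_A: underlying complex manifold C^{n+1} (column vectors
   p = (z, w) with z = p_0, w = (p_1..p_n)), group law
   (z,w)(z',w') = (z+z', w + exp(zA) w'), i.e.  p q = p + dL_p q,
   where dL_p = diag(1, exp(zA)) is the (constant) differential of left
   translation by p. *)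
Definition dL {R : realType} {n} (A : 'M[complex R]_n) (p : 'cV[complex R]_n.+1)
  : 'M[complex R]_n.+1 :=
  \matrix_(i, j) match unlift ord0 i, unlift ord0 j with
                 | None, None => 1
                 | Some i', Some j' => expm (p ord0 0 *: A) i' j'
                 | _, _ => 0
                 end.

Definition gmul {R : realType} {n} (A : 'M[complex R]_n) (p q : 'cV[complex R]_n.+1)
  : 'cV[complex R]_n.+1 := p + dL A p *m q.

(* the bracket mu_A on the basis Z_0..Z_n of C^{n+1}:
   mu(Z_k, Z_r) = mu_A k r  (as coordinate column vectors);
   mu(Z_0, Z_i) = A Z_i, mu(Z_i, Z_0) = - A Z_i, mu(Z_i, Z_j) = 0. *)
Definition colA {R : realType} {n} (A : 'M[complex R]_n) (i : 'I_n) : 'cV[complex R]_n.+1 :=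
  \col_m match unlift ord0 m with None => 0 | Some m' => A m' i end.

Definition mu_A {R : realType} {n} (A : 'M[complex R]_n) (k r : 'I_n.+1) : 'cV[complex R]_n.+1 :=
  match unlift ord0 k, unlift ord0 r with
  | None, Some i => colA A i
  | Some i, None => - colA A i
  | _, _ => 0
  end.

(* Hermitian form attached to the matrix H = (g(Z_i, \bar Z_j))_{ij}:
   h(X, Y) = g(X, \bar Y) = X^T H \bar Y *)
Definition hform {R : realType} {m} (H : 'M[complex R]_m) (X Y : 'cV[complex R]_m) : complex R :=
  (X^T *m H *m cmx Y) 0 0.

Definition evec {R : realType} {m} (i : 'I_m) : 'cV[complex R]_m := delta_mx i 0.

(* positive definite Hermitian matrix = left-invariant Hermitian metric
   (given by its values g_{i \bar j} on the left-invariant frame) *)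
Definition herm_pd {R : realType} {m} (H : 'M[complex R]_m) : Prop :=
  H^T = cmx H /\ forall v : 'cV[complex R]_m, v != 0 -> 0 < hform H v v.

(* torsion-twisted Chern-Ricci tensor, for a bracket with structure
   "constants" c k r = mu(Z_k, Z_r):
   Theta_{i \bar j} = 1/2 g^{k \bar l} g^{r \bar s} g(Z_i, mu(\bar Z_l,\bar Z_s))
                      g(mu(Z_k, Z_r), \bar Z_j),
   where g^{k \bar l} is the inverse, g^{k \bar l} g_{j \bar l} = delta_{kj}. *)
Definition ginv {R : realType} {m} (H : 'M[complex R]_m) (k l : 'I_m) : complex R :=
  invmx H l k.

Definition Theta {R : realType} {m} (c : 'I_m -> 'I_m -> 'cV[complex R]_m)
  (H : 'M[complex R]_m) : 'M[complex R]_m :=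
  \matrix_(i, j) (2^-1 * \sum_k \sum_l \sum_r \sum_s
      (ginv H k l * ginv H r s * hform H (evec i) (c l s) * hform H (c k r) (evec j))).

(* the left-invariant tensor field on G_A with value H0 at the identity,
   in the coordinates of C^{n+1}: H(p) = dL_p^{-T} H0 \bar{dL_p^{-1}} *)
Definition Hfield {R : realType} {n} (A : 'M[complex R]_n) (H0 : 'M[complex R]_n.+1)
  (p : 'cV[complex R]_n.+1) : 'M[complex R]_n.+1 :=
  (invmx (dL A p))^T *m H0 *m cmx (invmx (dL A p)).

Definition holo_with {R : realType} {m} (F : 'cV[complex R]_m -> 'cV[complex R]_m)
  (DF : 'cV[complex R]_m -> 'M[complex R]_m) : Prop :=
  forall p (eps : R), 0 < eps -> exists delta : R, 0 < delta /\
    forall h, vnorm h < rC delta ->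
      vnorm (F (p + h) - F p - DF p *m h) <= rC eps * vnorm h.

Definition dirderiv {R : realType} {m k l} (f : 'cV[complex R]_m -> 'M[complex R]_(k, l))
  (p v : 'cV[complex R]_m) (D : 'M[complex R]_(k, l)) : Prop :=
  forall eps : R, 0 < eps -> exists delta : R, 0 < delta /\
    forall t : R, 0 < `|t| < delta ->
      mnorm ((rC t)^-1 *: (f (p + rC t *: v) - f p) - D) <= rC eps.

(* left-invariant HCF_+ soliton on (G_A, J_A):
   Theta(g) = lambda g + L_Z g for a holomorphic vector field Z on G_A;
   with h(X,Y) = X^T H(p) \bar Y, the Lie derivative along (the real
   vector field underlying) Z is  (L_Z H)(p) = D_{Z(p)} H + DZ^T H + H \bar{DZ}. *)
Definition hcf_soliton {R : realType} {n} (A : 'M[complex R]_n) (H0 : 'M[complex R]_n.+1) : Prop :=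
  herm_pd H0 /\
  exists (lam : R) (Z : 'cV[complex R]_n.+1 -> 'cV[complex R]_n.+1)
         (DZ : 'cV[complex R]_n.+1 -> 'M[complex R]_n.+1)
         (Hd : 'cV[complex R]_n.+1 -> 'M[complex R]_n.+1),
    holo_with Z DZ /\
    (forall p, dirderiv (Hfield A H0) p (Z p) (Hd p)) /\
    forall p, Hfield A (Theta (mu_A A) H0) p =
      rC lam *: Hfield A H0 p
      + (Hd p + (DZ p)^T *m Hfield A H0 p + Hfield A H0 p *m cmx (DZ p)).

Definition homothetic {R : realType} {n} (A : 'M[complex R]_n) (H1 H2 : 'M[complex R]_n.+1) : Prop :=
  exists (c : R) (phi psi : 'cV[complex R]_n.+1 -> 'cV[complex R]_n.+1)
         (Dphi Dpsi : 'cV[complex R]_n.+1 -> 'M[complex R]_n.+1),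
    0 < c /\ holo_with phi Dphi /\ holo_with psi Dpsi /\
    cancel phi psi /\ cancel psi phi /\
    (forall p q, phi (gmul A p q) = gmul A (phi p) (phi q)) /\
    forall p, Hfield A H2 p =
      rC c *: ((Dphi p)^T *m Hfield A H1 (phi p) *m cmx (Dphi p)).

Definition nilpotent_mx {F : pzRingType} {n} (A : 'M[F]_n) : Prop :=
  exists k : nat, A ^+ k = 0.

(* Main.v *)
From HB Require Import structures.
From mathcomp Require Import all_boot all_order all_algebra.
From mathcomp Require fingroup perm.
From mathcomp Require Import ring.
Set Implicit Arguments. Unset Strict Implicit. Unset Printing Implicit Defensive.
Import Order.TTheory GRing.Theory Num.Theory.
Local Open Scope ring_scope.

(** Left-invariant metrics are normalised in two steps.  The automorphisms
    [(z, w) |-> (z, w + Phi z)] make [Z_0] orthogonal to the abelian ideal, and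
    a Gram-Schmidt basis [Q] of the ideal replaces [A] by [B = Q A Q^-1].
    Comparing holomorphic and antiholomorphic parts of the soliton equation
    forces the field [Z] to act by a matrix [D] with [D + D^* = B B^* / s - lam]
    and [[D, B]] a multiple of [B].  A trace computation then leaves two cases:
    [B] is normal, or [B] is nilpotent and [B B^* B - B B B^* = g B] with
    [g > 0], a relation whose solutions
    are direct sums of weighted shifts.  Both kinds of matrices are determined up to
    unitary equivalence (and scaling) by their similarity class, which gives
    uniqueness; conversely diagonal matrices and weighted shifts solve the
    equation. *)

(** Two obstacles shape the proof. The field [Z] is merely complex differentiable: it need not be
    linear, nor generate automorphisms. In the left-invariant frame the soliton equation says that
    [K^T H + H conj(K)] is constant while [K] varies with the point. Such an equation ties
    holomorphic entries to conjugates of other entries, and each tie forces some derivative to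
    vanish; the analysis behind this is reduced to mean values along real segments. The second
    obstacle is algebraic: the equation controls the commutator of [D] with [B] but says nothing
    about that of [D^*]. A trace identity shows that the eigenvalue [d] of the commutator has
    nonnegative real part. Real part zero means that [B] is normal. A positive one makes [B]
    nilpotent, and then a triangularisation by common eigenvectors carries the relation over to
    [D^*]; adding the two relations eliminates [D] and leaves a relation in [B] alone. *)

Lemma mxDE (V : nmodType) m n (A B : 'M[V]_(m, n)) i j : (A + B) i j = A i j + B i j.
Proof. by rewrite mxE. Qed.

Lemma mxNE (V : zmodType) m n (A : 'M[V]_(m, n)) i j : (- A) i j = - A i j.
Proof. by rewrite mxE. Qed.

Lemma mxZE (V : pzRingType) m n a (A : 'M[V]_(m, n)) i j : (a *: A) i j = a * A i j.
Proof. by rewrite mxE. Qed.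

Lemma mx0E (V : nmodType) m n i j : (0 : 'M[V]_(m, n)) i j = 0.
Proof. by rewrite mxE. Qed.

(* Decides linear identities between matrices, all products being atoms. *)
Ltac mxlin := apply/matrixP => ? ?; rewrite ?(mxDE, mxNE, mxZE, mx0E); ring.

(** * Conjugate transposes, unitary completion, common eigenvectors *)

Section Adjoint.
Local Open Scope sesquilinear_scope.
Variable C : numClosedFieldType.

Lemma adjD m n (A B : 'M[C]_(m, n)) : (A + B)^t* = A^t* + B^t*.
Proof. by rewrite raddfD /= map_mxD. Qed.

Lemma adjN m n (A : 'M[C]_(m, n)) : (- A)^t* = - A^t*.
Proof. by rewrite raddfN /= map_mxN. Qed.

Lemma adjB m n (A B : 'M[C]_(m, n)) : (A - B)^t* = A^t* - B^t*.
Proof. by rewrite adjD adjN. Qed.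

Lemma adjM m n p (A : 'M[C]_(m, n)) (B : 'M[C]_(n, p)) :
  (A *m B)^t* = B^t* *m A^t*.
Proof. by rewrite trmx_mul map_mxM. Qed.

Lemma adjZ m n (a : C) (A : 'M[C]_(m, n)) : (a *: A)^t* = a^* *: A^t*.
Proof. by rewrite linearZ /= map_mxZ. Qed.

Lemma adj1 n : (1%:M : 'M[C]_n)^t* = 1%:M.
Proof. by rewrite trmx1 map_mx1. Qed.

Lemma adj0 m n : (0 : 'M[C]_(m, n))^t* = 0.
Proof. by rewrite trmx0 map_mx0. Qed.

Lemma adjX n (A : 'M[C]_n) k : (A ^+ k)^t* = A^t* ^+ k.
Proof.
elim: k => [|k IH]; first by rewrite !expr0 adj1.
by rewrite exprSr exprS -!mulmxE adjM IH.
Qed.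

Lemma mxtrace_adj n (A : 'M[C]_n) : \tr (A^t*) = (\tr A)^*.
Proof.
rewrite /mxtrace rmorph_sum; apply: eq_bigr => i _.
by rewrite !mxE.
Qed.

Lemma tr_mul_adj_ge0 m n (A : 'M[C]_(m, n)) : 0 <= \tr (A *m A^t*).
Proof.
rewrite /mxtrace; apply: sumr_ge0 => i _; rewrite mxE; apply: sumr_ge0 => j _.
by rewrite !mxE mul_conjC_ge0.
Qed.

Lemma tr_mul_adj_eq0 m n (A : 'M[C]_(m, n)) : \tr (A *m A^t*) = 0 -> A = 0.
Proof.
move=> /eqP; rewrite /mxtrace psumr_eq0; last first.
  by move=> i _; rewrite mxE; apply: sumr_ge0 => j _; rewrite !mxE mul_conjC_ge0.
move=> /allP h; apply/matrixP => i j; rewrite mxE.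
have := h i (mem_index_enum _) => /implyP /(_ isT).
rewrite mxE psumr_eq0; last by move=> k _; rewrite !mxE mul_conjC_ge0.
move=> /allP /(_ j (mem_index_enum _)) /implyP /(_ isT).
by rewrite !mxE mul_conjC_eq0 => /eqP.
Qed.

Lemma mul_adj_eq0 m n (A : 'M[C]_(m, n)) : A *m A^t* = 0 -> A = 0.
Proof. by move=> h; apply: tr_mul_adj_eq0; rewrite h mxtrace0. Qed.

Lemma row_mul_adj_ge0 n (a : 'rV[C]_n) : 0 <= (a *m a^t*) 0 0.
Proof. by rewrite -trace_mx11; apply: tr_mul_adj_ge0. Qed.

Lemma row_mul_adj_eq0 n (a : 'rV[C]_n) : (a *m a^t*) 0 0 = 0 -> a = 0.
Proof. by rewrite -trace_mx11; apply: tr_mul_adj_eq0. Qed.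

Lemma unitary_first_col n (e : 'cV[C]_n.+1) : e != 0 ->
  exists2 S : 'M[C]_n.+1, S \is unitarymx & exists2 c, c != 0 & col 0 S = c *: e.
Proof.
move=> e0.
(* Gram-Schmidt returns a unitary matrix even from a rank-deficient input, so [e^T] can be padded
   with zero rows. *)
pose A0 : 'M[C]_n.+1 := \matrix_(i, j) ((i == 0)%:R * e j 0).
pose Q := schmidt A0.
have Qu : Q \is unitarymx by apply: schmidt_unitarymx.
exists Q^T; first by rewrite trmx_unitary.
have r0 : row 0 A0 = e^T.
  by apply/rowP => j; rewrite !mxE eqxx mul1r.
have := row_schmidt_sub A0 0; rewrite r0.
rewrite (bigD1 (0 : 'I_n.+1)) //= big1; last first.
  by move=> i /andP[]; rewrite leqn0 => /eqP hi /eqP; case; apply/val_inj.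
rewrite addsmx0 genmxE => /sub_rVP [c hc].
have c0 : c != 0.
  apply: contra e0 => /eqP c0; rewrite -[e]trmxK hc c0 scale0r trmx0 //.
exists c^-1; first by rewrite invr_eq0.
rewrite -tr_row -/Q -[e]trmxK hc linearZ /= scalerA mulVf ?scale1r //.
Qed.

Lemma nilpotent_kernel n (A : 'M[C]_n.+1) k : A ^+ k = 0 -> A \notin unitmx.
Proof.
move=> Ak; apply/negP => uA.
have : A ^+ k \is a GRing.unit by apply: unitrX.
by rewrite Ak unitr0.
Qed.

(** The relation makes the kernel of [A] stable under [M], and [M] has an eigenvector there. *)
Lemma nilpotent_eigenvector n (A M : 'M[C]_n.+1) k d : A ^+ k = 0 ->
  M *m A - A *m M = d *: A ->
  exists2 e : 'cV[C]_n.+1, e != 0 & A *m e = 0 /\ exists m, M *m e = m *: e.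
Proof.
move=> Ak MA.
pose V := row_base (kermx A^T).
have rk : (0 < \rank (kermx A^T))%N.
  rewrite lt0n mxrank_eq0 kermx_eq0 row_free_unit unitmx_tr.
  exact: nilpotent_kernel Ak.
have VA : V *m A^T = 0.
  by apply/sub_kermxP; rewrite eq_row_base.
have : (V *m M^T <= V)%MS.
  rewrite (submx_trans _ (_ : kermx A^T <= V)%MS) //; last by rewrite eq_row_base.
  apply/sub_kermxP; rewrite -mulmxA -trmx_mul.
  have -> : A *m M = M *m A - d *: A by rewrite -MA opprB addrC subrK.
  by rewrite linearB linearZ /= mulmxBr trmx_mul mulmxA VA mul0mx -scalemxAr VA scaler0 subrr.
move=> /submxP [N hN].
have [m /eigenvalueP [y hy y0]] := eigenvalue_closed N rk.
exists (y *m V)^T.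
  rewrite -trmx0 (inj_eq (@trmx_inj _ _ _)).
  by rewrite mulmx_free_eq0 // row_base_free.
split; first by rewrite -{1}[A]trmxK -trmx_mul -mulmxA VA mulmx0 trmx0.
exists m; rewrite -{1}[M]trmxK -trmx_mul -mulmxA hN mulmxA hy -scalemxAl linearZ //.
Qed.

End Adjoint.

(** * Consequences of [M + M^* = A A^*] and [[M, A] = d A] *)

Section Algebraic.
Local Open Scope sesquilinear_scope.
Variable C : numClosedFieldType.

(** Inductive step for [commutator_adj_nilpotent]: the hypotheses are the block equations for the
    matrices with rows [(0, a), (0, A)] and [(m, r), (0, M)]. The point is that the corner [r]
    vanishes, so that [a] becomes a left eigenvector of the normal matrix [M], hence of [M^t*] for
    the conjugate eigenvalue. *)
Lemma commutator_adj_step n (m d : C) (a r : 'rV[C]_n) (A M : 'M[C]_n) :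
  m + m^* = (a *m a^t*) 0 0 -> r = a *m A^t* -> M + M^t* = A *m A^t* ->
  M *m A - A *m M = d *: A -> M^t* *m A - A *m M^t* = d^* *: A ->
  m *: a + r *m A - a *m M = d *: a ->
  r = 0 /\ m^* *: a - a *m M^t* = d^* *: a.
Proof.
move=> hm hr hF hd hd' ha.
(* By [hd] and [hd'], [M^t*] commutes with [A A^t*], which is [M + M^t*]. *)
have nM : M *m M^t* = M^t* *m M.
  have e1 : M^t* *m (A *m A^t*) - (A *m A^t*) *m M^t* = 0.
    have -> : M^t* *m (A *m A^t*) = A *m M^t* *m A^t* + d^* *: (A *m A^t*).
      by rewrite mulmxA -(subrK (A *m M^t*) (M^t* *m A)) hd' mulmxDl -scalemxAl addrC.
    have := congr1 (fun X => X^t*) hd; rewrite adjB !adjM adjZ => h.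
    have -> : A *m A^t* *m M^t* = A *m (A^t* *m M^t*) by rewrite mulmxA.
    rewrite -(subrK (M^t* *m A^t*) (A^t* *m M^t*)) h mulmxDr -scalemxAr mulmxA.
    by mxlin.
  move: e1; rewrite -hF mulmxDl mulmxDr.
  by move=> h; apply: subr0_eq; rewrite -[RHS]oppr0 -h; mxlin.
have hA : A^t* *m M = M *m A^t* + d *: A^t*.
  have := congr1 (fun X => X^t*) hd'; rewrite adjB !adjM adjZ !trmxCK conjCK => h.
  by rewrite -h addrC subrK.
have rm : r *m (m%:M + M^t*) = 0.
  have : (m *: a + r *m A - a *m M) *m A^t* = d *: r by rewrite ha -scalemxAl -hr.
  rewrite mulmxBl mulmxDl -scalemxAl -hr -[r *m A *m _]mulmxA -hF -[a *m M *m _]mulmxA.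
  have -> : M *m A^t* = A^t* *m M - d *: A^t* by rewrite hA addrK.
  rewrite mulmxBr mulmxA -hr -scalemxAr -hr opprB mulmxDr => h.
  rewrite mulmxDr mul_mx_scalar.
  apply: (addIr (d *: r)); rewrite add0r -{}[RHS]h.
  set X := r *m M; set Y := r *m M^t*.
  by mxlin.
have r0 : r = 0.
  have [a0|a0] := eqVneq a 0; first by rewrite hr a0 mul0mx.
  have : (r *m (m%:M + M^t*)) *m r^t* + ((r *m (m%:M + M^t*)) *m r^t*)^t* = 0.
    by rewrite rm mul0mx adj0 addr0.
  rewrite !adjM !adjD !trmxCK mulmxA -mulmxDl -mulmxDr.
  have -> : (m%:M + M^t* + ((m%:M : 'M[C]_n)^t* + M)) = (m + m^*)%:M + A *m A^t*.
    by rewrite tr_scalar_mx map_scalar_mx -hF [(m + _)%:M]raddfD /=; mxlin.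
  rewrite mulmxDr mulmxDl mul_mx_scalar -scalemxAl mulmxA.
  rewrite -mulmxA -adjM hm => /matrixP /(_ 0 0); rewrite mxE mxE [RHS]mxE => h.
  have pa : 0 < (a *m a^t*) 0 0.
    rewrite lt_def row_mul_adj_ge0 andbT; apply: contra a0 => /eqP /row_mul_adj_eq0 -> //.
  move/eqP: h; rewrite paddr_eq0 ?mulr_ge0 ?row_mul_adj_ge0 ?(ltW pa) //.
  by case/andP; rewrite mulf_eq0 gt_eqF //= => /eqP /row_mul_adj_eq0.
split=> //.
pose c := m - d.
have hc : a *m (M - c%:M) = 0.
  move: ha; rewrite r0 mul0mx addr0 => h.
  by rewrite mulmxBr mul_mx_scalar /c scalerBl -h; mxlin.
have : (a *m (M - c%:M)^t*) *m (a *m (M - c%:M)^t*)^t* = 0.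
  rewrite adjM trmxCK -mulmxA [_^t* *m _]mulmxA.
  have -> : (M - c%:M)^t* *m (M - c%:M) = (M - c%:M) *m (M - c%:M)^t*.
    rewrite adjB tr_scalar_mx map_scalar_mx /= !mulmxBl !mulmxBr nM.
    by rewrite !mul_mx_scalar !mul_scalar_mx !scale_scalar_mx [c * _]mulrC; mxlin.
  by rewrite !mulmxA hc !mul0mx.
move=> /mul_adj_eq0; rewrite adjB tr_scalar_mx map_scalar_mx /= mulmxBr mul_mx_scalar.
by move=> /subr0_eq ->; rewrite /c rmorphB /=; mxlin.
Qed.

(** Induction on the size. A common eigenvector of [A] and [M], killed by [A], is completed to a
    unitary basis, so that passing to blocks respects adjoints; [commutator_adj_step] then treats
    the corner. *)
Lemma commutator_adj_nilpotent n (A M : 'M[C]_n) k d : A ^+ k = 0 ->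
  M + M^t* = A *m A^t* -> M *m A - A *m M = d *: A ->
  M^t* *m A - A *m M^t* = d^* *: A.
Proof.
elim: n A M => [|n IH] A M Ak hF hd; first by apply/matrixP => -[].
have [e e0 [Ae [m Me]]] := nilpotent_eigenvector Ak hd.
have [S Su [c c0 Sc]] := unitary_first_col e0.
have SS : S *m S^t* = 1%:M by apply/unitarymxP.
have SS' : S^t* *m S = 1%:M by apply/eqP; rewrite mulmx1C.
pose A1 : 'M_(1 + n) := S^t* *m A *m S; pose M1 : 'M_(1 + n) := S^t* *m M *m S.
have eA : A = S *m A1 *m S^t* by rewrite /A1 !mulmxA SS mul1mx -mulmxA SS mulmx1.
have eM : M = S *m M1 *m S^t* by rewrite /M1 !mulmxA SS mul1mx -mulmxA SS mulmx1.
have hF1 : M1 + M1^t* = A1 *m A1^t*.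
  rewrite /M1 /A1 !adjM trmxCK !mulmxA -[_ *m S *m S^t*]mulmxA SS mulmx1.
  by rewrite -[S^t* *m A *m A^t*]mulmxA -hF mulmxDr mulmxDl.
have hd1 : M1 *m A1 - A1 *m M1 = d *: A1.
  rewrite /M1 /A1 !mulmxA -!(mulmxA _ S (S^t* )) SS !mulmx1 -mulmxBl.
  by rewrite -!(mulmxA (S^t* )) -mulmxBr hd -scalemxAr -scalemxAl !mulmxA.
have Ak1 : A1 ^+ k = 0.
  suff -> : A1 ^+ k = S^t* *m A ^+ k *m S by rewrite Ak mulmx0 mul0mx.
  elim: (k) => [|k' IHk]; first by rewrite !expr0 mulmx1 SS'.
  by rewrite !exprSr IHk -!mulmxE /A1 !mulmxA -!(mulmxA _ S (S^t* )) SS mulmx1.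
suff h : M1^t* *m A1 - A1 *m M1^t* = d^* *: A1.
  clearbody A1 M1; rewrite eA eM !adjM trmxCK !mulmxA -!(mulmxA _ (S^t* ) S) SS' !mulmx1 -mulmxBl.
  by rewrite -!(mulmxA S) -mulmxBr h -scalemxAr -scalemxAl !mulmxA.
have col0 : forall X : 'M[C]_n.+1, col 0 (S^t* *m X *m S) = c *: (S^t* *m (X *m e)).
  by move=> X; rewrite colE -mulmxA -colE Sc -scalemxAr mulmxA.
have colA : col 0 A1 = 0 by rewrite col0 Ae mulmx0 scaler0.
have colM : col 0 M1 = m *: delta_mx 0 0.
  rewrite col0 Me -scalemxAr scalerA mulrC -scalerA; congr (_ *: _).
  by rewrite scalemxAr -Sc colE mulmxA SS' mul1mx.
clearbody A1 M1.
have l0 : (0 : 'I_n.+1) = lshift n (0 : 'I_1) by apply/val_inj.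
have zA i : A1 i (lshift n 0) = 0.
  by have /matrixP/(_ i 0) := colA; rewrite !mxE l0.
have zM i : M1 i (lshift n 0) = m * (i == lshift n 0)%:R.
  by have /matrixP/(_ i 0) := colM; rewrite !mxE eqxx andbT l0.
have bA : A1 = block_mx 0 (ursubmx A1) 0 (drsubmx A1).
  rewrite -{1}[A1]submxK; congr block_mx; apply/matrixP => i j;
  by rewrite !mxE [j]ord1 zA.
have bM : M1 = block_mx m%:M (ursubmx M1) 0 (drsubmx M1).
  rewrite -{1}[M1]submxK; congr block_mx; apply/matrixP => i j;
  by rewrite !mxE [j]ord1 zM ?[i]ord1 ?eqxx ?mulr1 ?mulr0.
move: hF1 hd1 Ak1; rewrite bA bM.
set a := ursubmx A1; set A' := drsubmx A1; set r := ursubmx M1; set M' := drsubmx M1.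
have adjblock : forall (x : 'M[C]_1) (y : 'rV[C]_n) (z : 'M[C]_n),
    (block_mx x y 0 z : 'M_(1 + n))^t* = block_mx (x^t* ) 0 (y^t* ) (z^t* ).
  by move=> x y z; rewrite tr_block_mx map_block_mx trmx0 map_mx0.
rewrite !adjblock adj0 !mulmx_block !(mul0mx, mulmx0, addr0, add0r).
rewrite add_block_mx !(addr0, add0r) opp_block_mx !add_block_mx scale_block_mx.
rewrite !(subr0, addr0, add0r, scaler0, subrr).
move=> /eq_block_mx [h1 h2 h3 h4] /eq_block_mx [g1 g2 g3 g4] Ak1.
have A'k : A' ^+ k = 0.
  have [x [y hxy]] : exists x y, block_mx 0 a 0 A' ^+ k = block_mx x y 0 (A' ^+ k) :> 'M_(1 + n).
    elim: (k) => [|j [x [y IHj]]]; first by exists 1%:M, 0; rewrite !expr0 -scalar_mx_block.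
    exists 0, (a *m A' ^+ j).
    by rewrite !exprS IHj -!mulmxE mulmx_block !(mul0mx, mulmx0, add0r, addr0).
  by move: hxy; rewrite Ak1 -[0 in LHS](block_mx0 _ 1 n 1 n) => /eq_block_mx [].
have h1' : m + m^* = (a *m a^t* ) 0 0.
  by rewrite -h1 tr_scalar_mx map_scalar_mx !mxE eqxx !mulr1n.
have g2' : m *: a + r *m A' - a *m M' = d *: a by rewrite -g2 mul_scalar_mx.
have [r0 q] := commutator_adj_step h1' h2 h4 g4 (IH _ _ A'k h4 g4) g2'.
rewrite r0 adj0 !(mulmx0, mul0mx, add0r) opp_block_mx add_block_mx scale_block_mx.
rewrite !(subr0, subrr) !scaler0 tr_scalar_mx map_scalar_mx mul_scalar_mx q.
by rewrite (IH _ _ A'k h4 g4).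
Qed.

(** Pairing [X] with [M] and with [M^t*] gives [d] and [d^*] times the trace of [A A^t*]; their sum
    is the pairing of [X] with [A A^t*]. Pairing with [A^t* A] gives the opposite value, because
    both products have the same trace of squares. *)
Lemma commutator_trace n (A M : 'M[C]_n) d :
  M + M^t* = A *m A^t* -> M *m A - A *m M = d *: A ->
  let X := A *m A^t* - A^t* *m A in
  \tr (X *m X^t*) = 2 * (d + d^*) * \tr (A *m A^t*).
Proof.
move=> hF hd X; set F := A *m A^t*; pose G := A^t* *m A.
have Fh : F^t* = F by rewrite /F adjM trmxCK.
have Gh : G^t* = G by rewrite /G adjM trmxCK.
have Xh : X^t* = X by rewrite /X adjB -/F -/G Fh Gh.
have tFG : \tr F = \tr G by rewrite mxtrace_mulC.
have tM : \tr (M *m X) = d * \tr F.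
  rewrite -[RHS]mxtraceZ /F scalemxAl -hd mulmxBr mulmxBl !linearB /= !mulmxA; congr (_ - _).
  by rewrite mxtrace_mulC mulmxA.
have tM' : \tr (M^t* *m X) = d^* * \tr F.
  have := congr1 Num.conj tM; rewrite rmorphM /= -!mxtrace_adj adjM Fh Xh => <-.
  by rewrite mxtrace_mulC.
have tFX : \tr (F *m X) = (d + d^*) * \tr F.
  have -> : F *m X = M *m X + M^t* *m X by rewrite -mulmxDl hF.
  by rewrite linearD /= tM tM' mulrDl.
have tGX : \tr (G *m X) = - \tr (F *m X).
  rewrite /X -/F -/G !mulmxBr !linearB /= opprB [\tr (F *m G)]mxtrace_mulC; congr (_ - _).
  by rewrite {1}/G -mulmxA mxtrace_mulC /F -!mulmxA.
by rewrite Xh {1}/X mulmxBl linearB /= -/F -/G tGX opprK tFX; ring.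
Qed.

Lemma commutator_expr n (A M : 'M[C]_n) d k : M *m A - A *m M = d *: A ->
  M *m A ^+ k - A ^+ k *m M = (k%:R * d) *: A ^+ k.
Proof.
move=> hd; elim: k => [|k IH]; first by rewrite expr0 mulmx1 mul1mx subrr mul0r scale0r.
rewrite exprSr -mulmxE.
have -> : M *m (A ^+ k *m A) - A ^+ k *m A *m M =
   (M *m A ^+ k - A ^+ k *m M) *m A + A ^+ k *m (M *m A - A *m M).
  by rewrite mulmxBl mulmxBr !mulmxA; mxlin.
by rewrite IH hd -scalemxAl -scalemxAr -scalerDl -[k.+1]addn1 natrD mulrDl mul1r.
Qed.

(** The powers of [A] satisfy the eigenvector equation of the commutator with [M] for the pairwise
    distinct values [k d]. More than [n * n] nonzero powers would exceed the degree of its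
    characteristic polynomial. *)
Lemma commutator_nilpotent n (A M : 'M[C]_n) d : d != 0 ->
  M *m A - A *m M = d *: A -> exists k, A ^+ k = 0.
Proof.
move=> d0 hd.
have hk k := commutator_expr k hd.
pose g := lin_mulmx M - lin_mulmxr M : 'M[C]_(n * n).
pose rs := [seq k%:R * d | k <- iota 0 (n * n).+1].
case: (boolP [exists k : 'I_(n * n).+1, A ^+ k == 0]) => [/existsP [k /eqP Ak]|].
  by exists k.
rewrite negb_exists => /forallP nz.
have : (size rs < size (char_poly g))%N.
  apply: max_poly_roots; first by rewrite monic_neq0 // char_poly_monic.
    apply/allP => z /mapP [k]; rewrite mem_iota add0n => /andP [_ kn] ->.
    rewrite -eigenvalue_root_char; apply/eigenvalueP; exists (mxvec (A ^+ k)).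
      by rewrite mulmxBr !mul_vec_lin /= -linearB /= hk linearZ.
    rewrite mxvec_eq0; exact: (nz (Ordinal kn)).
  rewrite map_inj_uniq ?iota_uniq // => i j /(mulIf d0) /eqP.
  by rewrite eqr_nat => /eqP.
by rewrite size_char_poly size_map size_iota ltnn.
Qed.

(** The trace identity gives [d + d^* >= 0]. Equality forces the commutator of [A] and [A^t*] to
    vanish; otherwise [d] is nonzero, [A] is nilpotent, and adding the relations for [M] and [M^t*]
    yields [g = d + d^*]. *)
Lemma normal_or_oscillator n (A M : 'M[C]_n) d :
  M + M^t* = A *m A^t* -> M *m A - A *m M = d *: A ->
  A *m A^t* = A^t* *m A \/
  exists g, [/\ 0 < g, exists k, A ^+ k = 0 & A *m A^t* *m A - A *m A *m A^t* = g *: A].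
Proof.
move=> hF hd.
have := commutator_trace hF hd; set X := A *m A^t* - _; cbv zeta => hX.
have [A0|A0] := eqVneq A 0; first by left; rewrite A0 mul0mx mulmx0.
have tp : 0 < \tr (A *m A^t*).
  rewrite lt_def tr_mul_adj_ge0 andbT; apply: contra A0 => /eqP /tr_mul_adj_eq0 ->//.
have : 0 <= 2 * (d + d^*) * \tr (A *m A^t*) by rewrite -hX tr_mul_adj_ge0.
rewrite pmulr_lge0 // pmulr_rge0 // le_eqVlt => /orP [/eqP h|h].
  by left; apply: subr0_eq; apply: tr_mul_adj_eq0; rewrite hX -h mulr0 mul0r.
right; exists (d + d^*).
have d0 : d != 0.
  by apply: contraL h => /eqP ->; rewrite conjC0 addr0 ltxx.
have [k Ak] := commutator_nilpotent d0 hd.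
split=> //; first by exists k.
have := commutator_adj_nilpotent Ak hF hd => hd'.
rewrite -[A *m A *m _]mulmxA -hF mulmxDr mulmxDl scalerDl -hd -hd'; mxlin.
Qed.

End Algebraic.

(** * Positive definite factorisation, normal matrices, splittings by idempotents *)

Section Unitary.
Import fingroup perm.
Local Open Scope sesquilinear_scope.
Variable C : numClosedFieldType.

Definition posdef n (p : 'M[C]_n) : Prop :=
  p^t* = p /\ forall v : 'cV[C]_n, v != 0 -> 0 < (v^t* *m p *m v) 0 0.

Lemma posdef_factor n (p : 'M[C]_n) : posdef p ->
  exists2 P, P \in unitmx & p = P *m P^t*.
Proof.
move=> [ph pp].
have np : p \is normalmx by apply/normalmxP; rewrite ph.
have /orthomx_spectralP := np; cbv zeta.
set S := spectralmx p; set d := spectral_diag p => e.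
have Su : S \is unitarymx by apply: spectral_unitarymx.
have SS : S *m S^t* = 1%:M by apply/unitarymxP.
have SS' : S^t* *m S = 1%:M by apply/eqP; rewrite mulmx1C.
rewrite invmx_unitary // in e.
have dp i : 0 < d 0 i.
  pose v := S^t* *m delta_mx i 0 : 'cV_n.
  have v0 : v != 0.
    apply/eqP => v0.
    have : S *m v = delta_mx i 0 by rewrite /v mulmxA SS mul1mx.
    by rewrite v0 mulmx0 => /matrixP /(_ i 0); rewrite !mxE !eqxx /= => /esym /eqP; rewrite oner_eq0.
  have := pp v v0; rewrite e /v adjM trmxCK !mulmxA -!(mulmxA _ S) SS !mulmx1.
  rewrite trmx_delta map_delta_mx -rowE.
  rewrite -colE !mxE /= eqxx mulr1n //.
pose D := diag_mx (map_mx sqrtC d).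
have Du : D \in unitmx.
  rewrite unitmxE det_diag unitfE; apply/prodf_neq0 => i _.
  by rewrite mxE sqrtC_eq0 gt_eqF.
exists (S^t* *m D); first by rewrite unitmx_mul Du andbT unitarymx_unit // trmxC_unitary.
rewrite adjM trmxCK mulmxA -[_ *m D *m _]mulmxA e; congr (_ *m _ *m _).
rewrite /D tr_diag_mx map_diag_mx mulmx_diag; congr diag_mx; apply/rowP => i.
by rewrite !mxE /= geC0_conj ?sqrtC_ge0 ?(ltW (dp i)) // -expr2 sqrtCK.
Qed.

Lemma posdef_mul_adj n (P : 'M[C]_n) : P \in unitmx -> posdef (P *m P^t*).
Proof.
move=> uP; split; first by rewrite adjM trmxCK.
move=> v v0; have -> : v^t* *m (P *m P^t*) *m v = (v^t* *m P) *m (v^t* *m P)^t*.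
  by rewrite adjM trmxCK !mulmxA.
rewrite lt_def row_mul_adj_ge0 andbT; apply: contra v0 => /eqP /row_mul_adj_eq0 h.
have : v^t* *m P *m invmx P = 0 by rewrite h mul0mx.
by rewrite mulmxK // => /(congr1 (fun X => X^t*)); rewrite trmxCK adj0 => ->.
Qed.

(** After unitary diagonalisation the eigenvalues are matched by a permutation read off from a
    nonzero term in the determinant of the intertwiner, which avoids counting multiplicities. *)
Lemma normal_unitary_equiv n (A1 A2 B : 'M[C]_n) :
  A1 *m A1^t* = A1^t* *m A1 -> A2 *m A2^t* = A2^t* *m A2 ->
  B \in unitmx -> B *m A1 = A2 *m B ->
  exists2 U, U *m U^t* = 1%:M & U *m A1 = A2 *m U.
Proof.
move=> /normalmxP /orthomx_spectralP e1 /normalmxP /orthomx_spectralP e2 uB hB.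
move: e1 e2; cbv zeta.
set S1 := spectralmx A1; set S2 := spectralmx A2.
set d1 := spectral_diag A1; set d2 := spectral_diag A2 => e1 e2.
have u1 : S1 \is unitarymx by apply: spectral_unitarymx.
have u2 : S2 \is unitarymx by apply: spectral_unitarymx.
have us1 : S1 \in unitmx by apply: unitarymx_unit.
have us2 : S2 \in unitmx by apply: unitarymx_unit.
pose B' := S2 *m B *m invmx S1.
have uB' : B' \in unitmx by rewrite !unitmx_mul uB us2 unitmx_inv.
have hB' : B' *m diag_mx d1 = diag_mx d2 *m B'.
  have -> : diag_mx d1 = S1 *m A1 *m invmx S1 by rewrite e1 !mulmxA mulmxV // mul1mx mulmxK.
  have -> : diag_mx d2 = S2 *m A2 *m invmx S2 by rewrite e2 !mulmxA mulmxV // mul1mx mulmxK.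
  rewrite /B' !mulmxA mulmxKV //; congr (_ *m _).
  by rewrite -!mulmxA mulKmx // hB !mulmxA.
have [s hs] : exists s : 'S_n, forall i, B' i (s i) != 0.
  move: uB'; rewrite unitmxE unitfE => dB.
  case: (boolP [exists s : 'S_n, [forall i, B' i (s i) != 0]]) => [/existsP [s /forallP hs]|].
    by exists s.
  rewrite negb_exists => /forallP ns; case/negP: dB; apply/eqP.
  rewrite /determinant big1 // => s _.
  have := ns s; rewrite negb_forall => /existsP [i]; rewrite negbK => /eqP hi.
  by rewrite (bigD1 i) //= hi mul0r mulr0.
clearbody B'.
(* A nonzero entry of an intertwiner of diagonal matrices forces the two corresponding eigenvalues
   to be equal. *)
have ds i : d1 0 (s i) = d2 0 i.
  have /matrixP /(_ i (s i)) := hB'.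
  rewrite mul_mx_diag mul_diag_mx !mxE mulrC => /mulIf; apply; exact: hs.
pose W : 'M[C]_n := perm_mx s.
have hW : W *m diag_mx d1 = diag_mx d2 *m W.
  apply/matrixP => i j; rewrite mul_mx_diag mul_diag_mx !mxE.
  by have [<-|_] := eqVneq (s i) j; rewrite ?mul0r ?mulr0 // ds mulrC.
have WW : W *m W^t* = 1%:M.
  by rewrite /W tr_perm_mx map_perm_mx -perm_mxM mulgV perm_mx1.
exists (S2^t* *m W *m S1).
  rewrite !adjM trmxCK !mulmxA -!(mulmxA _ S1 (S1^t*)) (unitarymxP u1) mulmx1.
  rewrite -!(mulmxA _ W (W^t*)) WW mulmx1.
  by apply/eqP; rewrite mulmx1C // (unitarymxP u2).
rewrite e1 e2 !invmx_unitary // !mulmxA -!(mulmxA _ S1 (S1^t*)) (unitarymxP u1) mulmx1.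
rewrite -!(mulmxA _ S2 (S2^t*)) (unitarymxP u2) mulmx1.
by rewrite -[_ *m W *m _]mulmxA hW mulmxA.
Qed.

(** The columns of [K] form an orthonormal basis of the range, so compression by [K] is compatible
    with adjoints. *)
Lemma hermitian_idempotent_factor n r (Q : 'M[C]_n) :
  Q^t* = Q -> Q *m Q = Q -> \rank Q = r ->
  exists2 K : 'M[C]_(n, r), K^t* *m K = 1%:M & K *m K^t* = Q.
Proof.
move=> Qh QQ <-; pose E := schmidt (row_base Q).
have Eu : E \is unitarymx by apply: schmidt_unitarymx; apply: rank_leq_row.
have EE : E *m E^t* = 1%:M by apply/unitarymxP.
have eq : (E :=: Q)%MS.
  apply: eqmx_trans (eqmx_schmidt_free _) (eq_row_base Q); exact: row_base_free.
have /submxP [X hX] : (E <= Q)%MS by rewrite eq.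
have /submxP [Y hY] : (Q <= E)%MS by rewrite eq.
exists (E^t*); rewrite trmxCK //.
have EQ : E *m Q = E by rewrite hX -mulmxA QQ.
have QE : Q *m E^t* = E^t* by have := congr1 (fun X => X^t*) EQ; rewrite adjM Qh.
transitivity (Y *m E *m (E^t* *m E)); first by rewrite -hY mulmxA QE.
by rewrite -mulmxA [E *m (_ *m _)]mulmxA EE mul1mx -hY.
Qed.

(** Serves to transfer equality of ranks of powers to a complementary summand. *)
Lemma mxrank_direct_sum n m k (Y : 'M[C]_(n, m)) (X : 'M[C]_(m, n))
    (K : 'M[C]_(n, k)) (L : 'M[C]_(k, n)) (N : 'M[C]_m) (O : 'M[C]_k) :
  X *m Y = 1%:M -> L *m K = 1%:M -> X *m K = 0 -> L *m Y = 0 ->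
  \rank (Y *m N *m X + K *m O *m L)%R = (\rank N + \rank O)%N.
Proof.
move=> XY LK XK LY; rewrite -rank_diag_block_mx; apply/eqP; rewrite eqn_leq.
set B := block_mx _ _ _ _.
have -> : Y *m N *m X + K *m O *m L = row_mx Y K *m B *m col_mx X L.
  by rewrite mul_row_block !mulmx0 addr0 add0r mul_row_col.
rewrite (leq_trans (mxrankM_maxl _ _)) ?mxrankM_maxr //=.
have {1}-> : B = col_mx X L *m (row_mx Y K *m B *m col_mx X L) *m row_mx Y K.
  have e : col_mx X L *m row_mx Y K = 1%:M.
    by rewrite mul_col_row XY LK XK LY -scalar_mx_block.
  by rewrite !mulmxA e mul1mx -mulmxA e mulmx1.
by rewrite (leq_trans (mxrankM_maxl _ _)) ?mxrankM_maxr.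
Qed.

Lemma mxrank_compl_idempotent n m (Y : 'M[C]_(n, m)) (X : 'M[C]_(m, n)) :
  X *m Y = 1%:M -> \rank (1%:M - Y *m X)%R = (n - m)%N.
Proof.
move=> XY.
have rp : \rank (Y *m X) = m.
  apply/eqP; rewrite eqn_leq (leq_trans (mxrankM_maxl _ _)) ?rank_leq_col //=.
  have : (\rank (X *m (Y *m X) *m Y) <= \rank (Y *m X))%N.
    by rewrite (leq_trans (mxrankM_maxl _ _)) ?mxrankM_maxr.
  by rewrite mulmxA XY mul1mx XY mxrank1.
rewrite -{2}rp -mxrank_ker; apply: eqmx_rank; apply/andP; split.
  by apply/sub_kermxP; rewrite mulmxBl mul1mx -mulmxA [X *m _]mulmxA XY mul1mx subrr.
apply/submxP; exists (kermx (Y *m X)).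
by rewrite mulmxBr mulmx1 mulmx_ker subr0.
Qed.

End Unitary.

(** * Classification of nilpotent solutions of the ladder relation *)

Section Oscillator.
Local Open Scope sesquilinear_scope.
Variable C : numClosedFieldType.

Definition mxcols n k (f : nat -> 'cV[C]_n) : 'M[C]_(n, k) := \matrix_(a, b) f b a 0.

(** Nilpotent Jordan block: the basis vector [e_b] goes to [e_(b+1)] and the last one to zero. *)
Definition shiftmx k : 'M[C]_k := \matrix_(a, b) (a == b.+1 :> nat)%:R.

Lemma mul_mxcols m n k (X : 'M[C]_(m, n)) (f : nat -> 'cV[C]_n) :
  X *m mxcols k f = mxcols k (fun b => X *m f b).
Proof.
by apply/matrixP => a b; rewrite !mxE; apply: eq_bigr => c _; rewrite mxE.
Qed.

Lemma mxcols_shift n k (f : nat -> 'cV[C]_n) : f k = 0 ->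
  mxcols k f *m shiftmx k = mxcols k (fun b => f b.+1).
Proof.
move=> fk; apply/matrixP => a b; rewrite !mxE.
have [hb|hb] := ltnP b.+1 k.
  rewrite (bigD1 (Ordinal hb)) //= !mxE eqxx mulr1 big1 ?addr0 // => c hc.
  by rewrite !mxE -(inj_eq val_inj) /= in hc *; rewrite (negPf hc) mulr0.
have -> : b.+1 = k by apply/eqP; rewrite eqn_leq ltn_ord hb.
rewrite fk mxE big1 // => c _; rewrite !mxE.
have -> : (c == b.+1 :> nat) = false by apply/negbTE; rewrite neq_ltn (leq_trans (ltn_ord c)).
by rewrite mulr0.
Qed.

(** With [N = O O^t*] this reads [[N, O] = O]: [O] raises eigenvalues of [N] by one and [O^t*]
    lowers them. *)
Definition oscillator n (O : 'M[C]_n) : Prop :=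
  O *m O^t* *m O - O *m O *m O^t* = O.

Lemma nilpotent_index n (A : 'M[C]_n) j : (0 < n)%N -> A ^+ j = 0 ->
  exists k, A ^+ k.+1 = 0 /\ A ^+ k != 0.
Proof.
move=> n0; elim: j => [|j IH] h.
  move: h; rewrite expr0 => /matrixP /(_ (Ordinal n0) (Ordinal n0)) /eqP.
  by rewrite !mxE eqxx oner_eq0.
by have [/IH//|h'] := eqVneq (A ^+ j) 0; exists j.
Qed.

(** Since [O ^+ k *m O = 0], the ladder relation gives [N O^k = k O^k], so any nonzero column of
    [O ^+ k], normalised, is a top vector. *)
Lemma oscillator_top n (O : 'M[C]_n) k : oscillator O -> O ^+ k.+1 = 0 -> O ^+ k != 0 ->
  exists y : 'cV[C]_n,
    [/\ (y^t* *m y) = 1%:M, O *m y = 0 & O *m O^t* *m y = k%:R *: y].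
Proof.
move=> oO Ok1 Ok.
have [j hj] : exists j, col j (O ^+ k) != 0.
  case: (boolP [exists j, col j (O ^+ k) != 0]) => [/existsP //|].
  rewrite negb_exists => /forallP h; case/negP: Ok; apply/eqP/matrixP => a b.
  have := h b; rewrite negbK => /eqP /matrixP /(_ a 0); rewrite !mxE //.
pose z := col j (O ^+ k); pose t := (z^t* *m z) 0 0.
have tE : z^t* *m z = t%:M by rewrite /t -mx11_scalar.
have t0 : 0 < t.
  have : (z^t* *m (z^t*)^t*) = t%:M by rewrite trmxCK.
  move=> /matrixP /(_ 0 0); rewrite [in X in _ = X]mxE mulr1n => <-.
  rewrite lt_def row_mul_adj_ge0 andbT; apply: contra hj => /eqP /row_mul_adj_eq0.
  by move=> /(congr1 (fun X => X^t*)); rewrite trmxCK adj0 => h; rewrite -/z h.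
have hF : O *m O^t* *m O - O *m (O *m O^t*) = 1 *: O by rewrite mulmxA scale1r.
have := commutator_expr k hF; rewrite mulr1 => hk.
exists ((sqrtC t)^-1 *: z); split.
- rewrite adjZ -scalemxAl -scalemxAr tE scalerA.
  rewrite -scalemx1 scalerA geC0_conj ?invr_ge0 ?sqrtC_ge0 ?(ltW t0) //.
  by rewrite -invfM -expr2 sqrtCK mulVf ?scale1r // gt_eqF.
- by rewrite -scalemxAr /z colE mulmxA mulmxE -exprS Ok1 mul0mx scaler0.
rewrite -scalemxAr scalerA mulrC -scalerA; congr (_ *: _).
rewrite /z colE mulmxA.
have -> : O *m O^t* *m O ^+ k = k%:R *: O ^+ k.
  have z0 : O ^+ k *m O = 0 by rewrite mulmxE -exprSr.
  by rewrite -hk [O ^+ k *m _]mulmxA z0 mul0mx subr0.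
by rewrite -scalemxAl.
Qed.

Fixpoint gram (k a b : nat) {struct a} : C :=
  match a, b with
  | 0, 0 => 1
  | a'.+1, b'.+1 => (k%:R - b'%:R) * gram k a' b'
  | _, _ => 0
  end.

Lemma gram_offdiag k a b : a != b -> gram k a b = 0.
Proof. by elim: a b => [|a IH] [|b] //= h; rewrite IH ?mulr0. Qed.

Lemma gram_diag_neq0 k a : (a <= k)%N -> gram k a a != 0.
Proof.
elim: a => [|a IH] /= h; first exact: oner_neq0.
rewrite mulf_neq0 ?IH ?(ltnW h) // subr_eq0 eqr_nat.
by rewrite gtn_eqF.
Qed.

Definition grammx k : 'M[C]_k.+1 := \matrix_(a, b) gram k a b.

Lemma grammx_unit k : grammx k \in unitmx.
Proof.
have -> : grammx k = diag_mx (\row_a gram k a a).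
  apply/matrixP => a b; rewrite !mxE; have [->|h] := eqVneq a b; first by rewrite mulr1n.
  by rewrite gram_offdiag.
rewrite unitmxE det_diag unitfE; apply/prodf_neq0 => i _.
by rewrite mxE gram_diag_neq0 // -ltnS.
Qed.

(** Matrix of [O] on such a string: [O f_(a+1) = (k - a) f_a]. *)
Definition lowermx k : 'M[C]_k.+1 :=
  \matrix_(a, b) ((b == a.+1 :> nat)%:R * (k%:R - a%:R)).

(** The span of the string is stable under both [O] and [O^t*], so its orthogonal complement is
    reducing. *)
Lemma oscillator_chain n (O : 'M[C]_n) k : oscillator O -> O ^+ k.+1 = 0 -> O ^+ k != 0 ->
  exists Y : 'M[C]_(n, k.+1),
    [/\ Y^t* *m Y = grammx k, O^t* *m Y = Y *m shiftmx k.+1 & O *m Y = Y *m lowermx k].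
Proof.
move=> oO Ok1 Ok; have [y [yy Oy Fy]] := oscillator_top oO Ok1 Ok.
pose f l : 'cV[C]_n := (O^t*) ^+ l *m y.
have fS l : f l.+1 = O^t* *m f l by rewrite /f exprS -mulmxE mulmxA.
(* Each application of [O^t*] lowers the eigenvalue of [O O^t*] by one, starting from [k] at the
   top. *)
have Ff l : O *m O^t* *m f l = (k%:R - l%:R) *: f l.
  elim: l => [|l IH]; first by rewrite /f expr0 mul1mx subr0.
  have h : O *m O^t* *m O^t* = O^t* *m (O *m O^t*) - O^t*.
    have := congr1 (fun X => X^t*) oO; rewrite adjB !adjM trmxCK !mulmxA => h.
    by rewrite -[X in _ - X]h; mxlin.
  rewrite {1}fS mulmxA h mulmxBl -mulmxA IH -scalemxAr -fS -natr1.
  by rewrite -{2}[f l.+1]scale1r -scalerBl; congr (_ *: _); ring.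
have Of l : O *m f l.+1 = (k%:R - l%:R) *: f l by rewrite fS mulmxA Ff.
have f0 : f 0 = y by rewrite /f expr0 mul1mx.
have gr a b : (y^t* *m O ^+ a *m f b) = (gram k a b)%:M.
  elim: a b => [|a IH] [|b].
  - by rewrite expr0 mulmx1 f0 yy.
  - by rewrite expr0 mulmx1 fS mulmxA -adjM Oy adj0 mul0mx /= raddf0.
  - by rewrite exprSr -mulmxE mulmxA -mulmxA f0 Oy mulmx0 /= raddf0.
  rewrite exprSr -mulmxE mulmxA -mulmxA Of -scalemxAr IH /=.
  by rewrite scale_scalar_mx.
have fa a : y^t* *m O ^+ a = (f a)^t* by rewrite /f adjM -adjX trmxCK.
have fk : f k.+1 = 0 by rewrite /f -adjX Ok1 adj0 mul0mx.
clearbody f; exists (mxcols k.+1 f); split.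
- apply/matrixP => a b; rewrite mul_mxcols mxE.
  have <- : (y^t* *m O ^+ a *m f b) 0 0 = (grammx k) a b by rewrite gr !mxE mulr1n.
  by rewrite fa !mxE; apply: eq_bigr => c _; rewrite !mxE.
- rewrite mul_mxcols mxcols_shift //.
  by apply/matrixP => a b; rewrite [LHS]mxE [RHS]mxE fS.
apply/matrixP => a b; rewrite mul_mxcols [LHS]mxE [RHS]mxE.
case: b => -[|b] hb /=.
  rewrite f0 Oy mxE big1 // => c _; rewrite !mxE /= mul0r mulr0 //.
rewrite Of (bigD1 (Ordinal (ltnW hb))) //= !mxE /= eqxx mul1r mulrC big1 ?addr0 // => c hc.
rewrite !mxE /= eqSS eq_sym.
by rewrite -(inj_eq val_inj) /= in hc; rewrite (negPf hc) mul0r mulr0.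
Qed.

(** Strong induction on the size: the ranks of powers give both matrices the same nilpotency index,
    a longest string is removed from each, and the ranks of powers of the remainders still agree. *)
Lemma oscillator_unitary_equiv n (O1 O2 : 'M[C]_n) j :
  oscillator O1 -> oscillator O2 -> O1 ^+ j = 0 ->
  (forall k, \rank (O1 ^+ k) = \rank (O2 ^+ k)) ->
  exists2 U, U *m U^t* = 1%:M & U *m O1 = O2 *m U.
Proof.
elim/ltn_ind: n O1 O2 => n IH O1 O2 o1 o2 nil rk.
have [n0|n0] := posnP n.
  by exists 1%:M; [rewrite adj1 mulmx1 | apply/matrixP => -[? ?]; subst n].
have [k [Ok1 Ok]] := nilpotent_index n0 nil.
have Pk1 : O2 ^+ k.+1 = 0 by apply/eqP; rewrite -mxrank_eq0 -rk mxrank_eq0; apply/eqP.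
have Pk : O2 ^+ k != 0 by rewrite -mxrank_eq0 -rk mxrank_eq0.
have G1 := grammx_unit k; set G := grammx k in G1.
(* Orthogonal splitting of one oscillator into its longest string, spanned by [Y], and a smaller
   oscillator [O'] on the range of [K]. *)
have split : forall O : 'M[C]_n, oscillator O -> O ^+ k.+1 = 0 -> O ^+ k != 0 ->
  exists Y : 'M[C]_(n, k.+1), exists K : 'M[C]_(n, n - k.+1), exists O' : 'M[C]_(n - k.+1),
    [/\ Y^t* *m Y = G, K^t* *m K = 1%:M, Y^t* *m K = 0 &
        Y *m invmx G *m Y^t* + K *m K^t* = 1%:M] /\
    [/\ O *m Y = Y *m lowermx k,
        invmx G *m Y^t* *m O = lowermx k *m (invmx G *m Y^t*),
        O *m K = K *m O', K^t* *m O = O' *m K^t* & oscillator O'].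
  move=> O oO h1 h2; have [Y [YY OsY OY]] := oscillator_chain oO h1 h2.
  pose X := invmx G *m Y^t*.
  have XY : X *m Y = 1%:M by rewrite /X -mulmxA YY mulVmx.
  have Gh : G^t* = G by rewrite /G -YY adjM trmxCK.
  have Gih : (invmx G)^t* = invmx G.
    have : (invmx G)^t* *m G = 1%:M by rewrite -{2}Gh -adjM mulmxV // adj1.
    by move=> h; rewrite -[LHS]mulmx1 -(mulmxV G1) mulmxA h mul1mx.
  (* The action of [O^t*] on [Y] yields [X O = C X] for some [C]; evaluating on [Y] identifies [C]
     with [lowermx k]. *)
  have XO : X *m O = lowermx k *m X.
    have h : X *m O = invmx G *m (shiftmx k.+1)^t* *m G *m X.
      rewrite /X -mulmxA; have := congr1 (fun Z => Z^t*) OsY.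
      by rewrite !adjM trmxCK => ->; rewrite !mulmxA mulmxK.
    rewrite h; congr (_ *m _).
    transitivity (X *m O *m Y); first by rewrite h -[RHS]mulmxA XY mulmx1.
    by rewrite -mulmxA OY mulmxA XY mul1mx.
  pose p := Y *m X; pose Q := 1%:M - p.
  have ph : p^t* = p by rewrite /p /X !adjM trmxCK Gih mulmxA.
  have Qh : Q^t* = Q by rewrite /Q adjB adj1 ph.
  have pp : p *m p = p by rewrite /p -mulmxA [X *m (_ *m _)]mulmxA XY mul1mx.
  have QQ : Q *m Q = Q by rewrite /Q mulmxBl mul1mx mulmxBr mulmx1 pp subrr subr0.
  have pO : p *m O = O *m p by rewrite /p -mulmxA XO !mulmxA OY.
  have QO : Q *m O = O *m Q by rewrite /Q mulmxBl mulmxBr mul1mx mulmx1 pO.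
  have rQ : \rank Q = (n - k.+1)%N by apply: mxrank_compl_idempotent.
  have [K KK KQ] := hermitian_idempotent_factor Qh QQ rQ.
  exists Y, K, (K^t* *m O *m K).
  have QK : Q *m K = K by rewrite -KQ -mulmxA KK mulmx1.
  have KtQ : K^t* *m Q = K^t* by rewrite -KQ mulmxA KK mul1mx.
  have OK : O *m K = K *m (K^t* *m O *m K).
    by rewrite !mulmxA KQ QO -mulmxA QK.
  have KO : K^t* *m O = K^t* *m O *m K *m K^t*.
    by rewrite -mulmxA KQ -mulmxA -QO mulmxA KtQ.
  have YK : Y^t* *m K = 0.
    have : X *m K = 0.
      by rewrite -QK mulmxA /Q mulmxBr mulmx1 /p mulmxA XY mul1mx subrr mul0mx.
    by rewrite /X -mulmxA => h; rewrite -[LHS]mul1mx -(mulmxV G1) -mulmxA h mulmx0.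
  split; split=> //; first by rewrite KQ /Q /p /X mulmxA addrC subrK.
  rewrite /oscillator !adjM trmxCK; set O' := K^t* *m O *m K in OK *.
  set S' := K^t* *m (O^t* *m K).
  have Os' : O^t* *m K = K *m S'.
    have := congr1 (fun Z => Z^t*) KO; rewrite !adjM trmxCK => {1}->.
    by rewrite !mulmxA.
  have -> : O' *m S' *m O' = K^t* *m (O *m O^t* *m O) *m K.
    rewrite {1}/O' -[_ *m K *m S']mulmxA -Os' mulmxA -[_ *m K *m O']mulmxA -OK.
    by rewrite !mulmxA.
  have -> : O' *m O' *m S' = K^t* *m (O *m O *m O^t*) *m K.
    rewrite {1}/O' -[_ *m K *m O']mulmxA -OK mulmxA -[_ *m K *m S']mulmxA -Os'.
    by rewrite !mulmxA.
  by rewrite -mulmxBl -mulmxBr oO.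
have [Y1 [K1 [P1 [[YY1 KK1 YK1 s1] [OY1 XO1 OK1 KO1 oP1]]]]] := split O1 o1 Ok1 Ok.
have [Y2 [K2 [P2 [[YY2 KK2 YK2 s2] [OY2 XO2 OK2 KO2 oP2]]]]] := split O2 o2 Pk1 Pk.
have rkP : forall (O : 'M[C]_n) (Y : 'M[C]_(n, k.+1))
      (K : 'M[C]_(n, n - k.+1)) (P : 'M[C]_(n - k.+1)),
    Y^t* *m Y = G -> K^t* *m K = 1%:M -> Y^t* *m K = 0 ->
    Y *m invmx G *m Y^t* + K *m K^t* = 1%:M ->
    O *m Y = Y *m lowermx k -> O *m K = K *m P ->
    forall i, \rank (O ^+ i) = (\rank (lowermx k ^+ i) + \rank (P ^+ i))%N.
  move=> O Y K P YY KK YK s OY OK i.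
  have OYi : O ^+ i *m Y = Y *m lowermx k ^+ i.
    elim: i => [|i IHi]; first by rewrite !expr0 mul1mx mulmx1.
    by rewrite !exprS -!mulmxE -mulmxA IHi mulmxA OY -mulmxA.
  have OKi : O ^+ i *m K = K *m P ^+ i.
    elim: i {OYi} => [|i IHi]; first by rewrite !expr0 mul1mx mulmx1.
    by rewrite !exprS -!mulmxE -mulmxA IHi mulmxA OK -mulmxA.
  rewrite -(@mxrank_direct_sum _ _ _ _ Y (invmx G *m Y^t*) K (K^t*)) //.
  - by rewrite -OYi -OKi -!mulmxA -mulmxDr mulmxA s mulmx1.
  - by rewrite -mulmxA YY mulVmx.
  - by rewrite -mulmxA YK mulmx0.
  by have := congr1 (fun Z => Z^t*) YK; rewrite adjM trmxCK adj0.
have rkP12 i : \rank (P1 ^+ i) = \rank (P2 ^+ i).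
  apply/eqP; rewrite -(eqn_add2l (\rank (lowermx k ^+ i))).
  by rewrite -(rkP O1 Y1 K1 P1) // -(rkP O2 Y2 K2 P2) // rk.
have P1j : P1 ^+ j = 0.
  apply/eqP; rewrite -mxrank_eq0 -(eqn_add2l (\rank (lowermx k ^+ j))).
  rewrite -(rkP O1 Y1 K1 P1) // nil mxrank0.
  have := rkP O1 Y1 K1 P1 YY1 KK1 YK1 s1 OY1 OK1 j; rewrite nil mxrank0.
  by move/esym/eqP; rewrite addn_eq0 => /andP [/eqP -> _].
have lt : (n - k.+1 < n)%N by rewrite ltn_subrL.
have [U' UU hU] := IH _ lt P1 P2 oP1 oP2 P1j rkP12.
have Gh : G^t* = G by rewrite -YY1 adjM trmxCK.
have Gih : (invmx G)^t* = invmx G.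
  have : (invmx G)^t* *m G = 1%:M by rewrite -{2}Gh -adjM mulmxV // adj1.
  by move=> h; rewrite -[LHS]mulmx1 -(mulmxV G1) mulmxA h mul1mx.
have KY1 : K1^t* *m Y1 = 0.
  by have := congr1 (fun Z => Z^t*) YK1; rewrite adjM trmxCK adj0.
(* The columns of the strings are orthogonal but not of unit length; [invmx G] corrects for that. *)
exists (Y2 *m invmx G *m Y1^t* + K2 *m U' *m K1^t*).
  rewrite adjD !adjM !trmxCK Gih mulmxDl !mulmxDr !mulmxA.
  rewrite -!(mulmxA _ (K1^t*) Y1) -!(mulmxA _ (Y1^t*) K1) -!(mulmxA _ (K1^t*) K1).
  rewrite -!(mulmxA _ (Y1^t*) Y1) KY1 YK1 KK1 YY1 !mulmx0 !mul0mx addr0 add0r mulmx1.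
  by rewrite mulmxKV // -!(mulmxA _ U') UU mulmx1 s2.
rewrite mulmxDl mulmxDr; congr (_ + _).
  by rewrite -[Y2 *m _ *m _]mulmxA -mulmxA XO1 !mulmxA OY2.
by rewrite -mulmxA KO1 !mulmxA OK2 -[K2 *m U' *m P1]mulmxA hU !mulmxA.
Qed.

End Oscillator.

(** * Explicit metrics for nilpotent and diagonalizable matrices *)

Section Existence.
Local Open Scope sesquilinear_scope.
Variable C : numClosedFieldType.

Definition mxrows n k (f : nat -> 'rV[C]_n) : 'M[C]_(k, n) := \matrix_(a, b) f a 0 b.

Lemma mxrows_mul n m k (X : 'M[C]_(n, m)) (f : nat -> 'rV[C]_n) :
  mxrows k f *m X = mxrows k (fun a => f a *m X).
Proof.
by apply/matrixP => a b; rewrite !mxE; apply: eq_bigr => c _; rewrite mxE.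
Qed.

(** A longest Jordan block is a direct summand: [Y] spans a chain, and [X] is a dual chain, also
    compatible with [A], which provides an invariant complement. *)
Lemma nilpotent_chain n (A : 'M[C]_n) k : A ^+ k.+1 = 0 -> A ^+ k != 0 ->
  exists Y : 'M[C]_(n, k.+1), exists X : 'M[C]_(k.+1, n),
    [/\ X *m Y = 1%:M, A *m Y = Y *m shiftmx C k.+1 & X *m A = shiftmx C k.+1 *m X].
Proof.
move=> Ak1 Ak.
have [i [j hij]] : exists i j, (A ^+ k) i j != 0.
  case: (boolP [exists i, [exists j, (A ^+ k) i j != 0]]) => [/existsP [i /existsP [j h]]|].
    by exists i, j.
  rewrite negb_exists => /forallP h; case/negP: Ak; apply/eqP/matrixP => i j.
  by have := h i; rewrite negb_exists => /forallP /(_ j); rewrite negbK mxE => /eqP.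
pose c := ((A ^+ k) i j)^-1.
pose f b : 'cV[C]_n := A ^+ b *m delta_mx j 0.
(* The dual chain is built backwards from the row [i] of a nonzero entry of [A ^+ k], and scaled by
   [c] so that the pairing with the chain has ones on its diagonal. *)
pose g a : 'rV[C]_n := c *: (delta_mx 0 i *m A ^+ (k - a)).
pose Y0 := mxcols k.+1 f; pose X := mxrows k.+1 g.
have Ahi b : (k < b)%N -> A ^+ b = 0.
  by move=> kb; rewrite -(subnKC kb) exprD Ak1 mul0r.
have AY : A *m Y0 = Y0 *m shiftmx C k.+1.
  rewrite mul_mxcols mxcols_shift; last by rewrite /f Ak1 mul0mx.
  apply/matrixP => a b; rewrite [LHS]mxE [RHS]mxE /f.
  by rewrite exprS -mulmxE mulmxA.
have XA : X *m A = shiftmx C k.+1 *m X.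
  rewrite mxrows_mul; apply/matrixP => a b; rewrite [LHS]mxE [RHS]mxE.
  have gA : g a *m A = c *: (delta_mx 0 i *m A ^+ (k - a).+1).
    by rewrite /g exprSr -mulmxE -scalemxAl mulmxA.
  rewrite gA; case: a {gA} => -[|a] ha /=.
    rewrite subn0 Ak1 mulmx0 scaler0 mxE big1 // => d _.
    by rewrite mxE /= mul0r.
  rewrite (bigD1 (Ordinal (ltnW ha))) //= big1 ?addr0; last first.
    move=> d hd; rewrite mxE /= eqSS eq_sym.
    by rewrite -(inj_eq val_inj) /= in hd; rewrite (negPf hd) mul0r.
  rewrite [shiftmx _ _ _ _]mxE /= eqxx mul1r [RHS]mxE /g; congr ((c *: (_ *m A ^+ _)) _ _).
  by rewrite subnSK.
pose T := X *m Y0.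
have TE a b : T a b = c * (A ^+ (k - a + b)) i j.
  have -> : T a b = (g a *m f b) 0 0.
    rewrite /T mul_mxcols [LHS]mxE [LHS]mxE [RHS]mxE.
    by apply: eq_bigr => d _; congr (_ * _); rewrite mxE.
  rewrite /g /f -scalemxAl mxZE mulmxA -[X in (X *m delta_mx j 0) 0 0]mulmxA mulmxE -exprD.
  by rewrite -rowE -colE !mxE.
(* The pairing depends on [b - a] and vanishes for [a < b]: it is unitriangular. *)
have Tu : T \in unitmx.
  rewrite unitmxE det_trig; last first.
    apply/is_trig_mxP => a b ab; rewrite TE Ahi ?mxE ?mulr0 //.
    by rewrite addnC addnBA ?ltn_subRL ?(addnC _ k) ?ltn_add2l // -ltnS.
  rewrite unitfE; apply/prodf_neq0 => a _.
  have ak : (a <= k)%N by rewrite -ltnS.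
  by rewrite TE subnK // mulVf // oner_neq0.
have JT : shiftmx C k.+1 *m T = T *m shiftmx C k.+1.
  by rewrite /T mulmxA -XA -mulmxA AY mulmxA.
exists (Y0 *m invmx T), X; split=> //; first by rewrite mulmxA mulmxV.
rewrite mulmxA AY -!mulmxA; congr (_ *m _).
by rewrite -[shiftmx _ _ in LHS](mulKmx Tu) -JT -mulmxA mulmxK.
Qed.

(** The weights [p_i = 1 / i!] solve [i p_i = p_(i-1)], which is the equation for a diagonal [p] on
    a single Jordan block. *)
Definition factdiag k : 'M[C]_k := diag_mx (\row_(i < k) (i`!%:R)^-1).
(** Grading of the Jordan block. Steps of one half make the sum of this matrix and its adjoint have
    diagonal entries [i]. *)
Definition levelmx k : 'M[C]_k := diag_mx (\row_(i < k) (i%:R / 2)).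

Lemma levelmx_comm k : levelmx k *m shiftmx C k - shiftmx C k *m levelmx k = 2^-1 *: shiftmx C k.
Proof.
apply/matrixP => a b; rewrite mxDE mxNE mxZE mul_mx_diag mul_diag_mx !mxE.
case: eqVneq => [->|_]; last by rewrite !(mulr0, mul0r, subrr).
by rewrite -[b.+1]addn1 natrD; field.
Qed.

Lemma factdiag_level k :
  levelmx k *m factdiag k + factdiag k *m (levelmx k)^t* =
  shiftmx C k *m factdiag k *m (shiftmx C k)^t*.
Proof.
have -> : (levelmx k)^t* = levelmx k.
  rewrite /levelmx tr_diag_mx map_diag_mx; congr diag_mx; apply/rowP => i.
  by rewrite !mxE rmorphM fmorphV /= !conjC_nat.
rewrite !mulmx_diag; apply/matrixP => a b; rewrite mxDE !mxE.
rewrite -mulrnDl.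
transitivity (((a == b) && (0 < a)%N)%:R * (a.-1`!%:R)^-1 : C).
  have [_|_] := eqVneq a b; last by rewrite mulr0n mul0r.
  rewrite mulr1n /=; case: (val a) => [|m] /=; first by rewrite !(mul0r, mulr0, addr0).
  rewrite mul1r factS natrM.
  have h1 : 1 + m%:R != 0 :> C by rewrite nat1r pnatr_eq0.
  have h2 : m`!%:R != 0 :> C by rewrite pnatr_eq0 -lt0n fact_gt0.
  by rewrite -nat1r; field; rewrite h1 h2.
rewrite mul_mx_diag.
case: a b => -[|a] ha [b hb].
  rewrite andbF mul0r big1 // => d _; rewrite !mxE /= mul0r //; by rewrite mul0r.
have ha' := ltnW ha.
rewrite (bigD1 (Ordinal ha')) //= big1 ?addr0; last first.
  move=> d hd; rewrite !mxE /= eqSS eq_sym.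
  by rewrite -(inj_eq val_inj) /= in hd; rewrite (negPf hd) !mul0r.
rewrite !mxE /= eqxx mul1r andbT -(inj_eq val_inj) /= conjC_nat mulrC; congr (_ * _%:R).
by rewrite eq_sym.
Qed.

Lemma posdef_factdiag k : posdef (factdiag k).
Proof.
split.
  rewrite /factdiag tr_diag_mx map_diag_mx; congr diag_mx; apply/rowP => i.
  by rewrite !mxE fmorphV /= conjC_nat.
have -> : factdiag k = diag_mx (\row_(i < k) (sqrtC (i`!%:R))^-1) *m
   (diag_mx (\row_(i < k) (sqrtC (i`!%:R))^-1))^t*.
  rewrite tr_diag_mx map_diag_mx mulmx_diag; congr diag_mx; apply/rowP => i.
  rewrite !mxE /= geC0_conj ?invr_ge0 ?sqrtC_ge0 ?ler0n //.
  by rewrite -invfM -expr2 sqrtCK.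
set D := diag_mx _; suff /posdef_mul_adj [] : D \in unitmx by [].
rewrite unitmxE det_diag unitfE; apply/prodf_neq0 => i _.
by rewrite mxE invr_eq0 sqrtC_eq0 pnatr_eq0 -lt0n fact_gt0.
Qed.

Lemma idempotent_factor n r (Q : 'M[C]_n) : Q *m Q = Q -> \rank Q = r ->
  exists K : 'M[C]_(n, r), exists2 L, K *m L = Q & L *m K = 1%:M.
Proof.
move=> QQ <-; exists (col_base Q), (row_base Q); first exact: mulmx_base.
have /row_fullP [B hB] := col_base_full Q.
have /row_freeP [B' hB'] := row_base_free Q.
suff aux s (K : 'M[C]_(n, s)) L D D' : D *m K = 1%:M -> L *m D' = 1%:M -> K *m L = Q ->
    L *m K = 1%:M by apply: aux hB hB' (mulmx_base Q).
move=> DK LD KL; transitivity (D *m (Q *m Q) *m D').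
  by rewrite -KL !mulmxA DK mul1mx -!mulmxA LD mulmx1.
by rewrite QQ -KL !mulmxA DK mul1mx.
Qed.

(** Here [p] and [q] transform like inverse metrics, hence the congruence by [Y] and [K] on the
    left; the resolution of the identity prevents a nonzero vector from being killed by both [Y^t*]
    and [K^t*]. *)
Lemma posdef_direct_sum n m k (Y : 'M[C]_(n, m)) (X : 'M[C]_(m, n))
    (K : 'M[C]_(n, k)) (L : 'M[C]_(k, n)) p q :
  Y *m X + K *m L = 1%:M -> posdef p -> posdef q ->
  posdef (Y *m p *m Y^t* + K *m q *m K^t*).
Proof.
move=> s [ph pp] [qh qq]; split; first by rewrite adjD !adjM !trmxCK ph qh !mulmxA.
move=> v v0.
have e : v^t* *m (Y *m p *m Y^t* + K *m q *m K^t*) *m v =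
   (Y^t* *m v)^t* *m p *m (Y^t* *m v) + (K^t* *m v)^t* *m q *m (K^t* *m v).
  by rewrite !adjM !trmxCK mulmxDr mulmxDl !mulmxA.
rewrite e mxDE.
have ge0 r (P : 'M[C]_r) (w : 'cV[C]_r) : posdef P -> 0 <= (w^t* *m P *m w) 0 0.
  move=> [_ hP]; have [->|w0] := eqVneq w 0; first by rewrite mulmx0 mxE.
  exact: ltW (hP w w0).
have [y0|y0] := eqVneq (Y^t* *m v) 0; last by rewrite ltr_pwDl ?pp // ge0.
rewrite ltr_wpDl ?ge0 // qq //; apply: contra v0 => /eqP k0.
have : v^t* *m (Y *m X + K *m L) = 0.
  have -> : v^t* = (v^t*)^t*^t* by rewrite trmxCK.
  have y1 := congr1 (fun Z => Z^t*) y0; have k1 := congr1 (fun Z => Z^t*) k0.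
  move: y1 k1; rewrite !adjM !trmxCK !adj0 => y1 k1.
  by rewrite mulmxDr !mulmxA y1 k1 !mul0mx addr0.
by rewrite s mulmx1 => /(congr1 (fun Z => Z^t*)); rewrite trmxCK adj0 => ->.
Qed.

(** Jordan blocks are split off one at a time. They can be summed because the commutator constant
    [2^-1] does not depend on the size of the block. Up to conjugation [p] is the inverse metric on
    the ideal. *)
Lemma nilpotent_soliton_data n (A : 'M[C]_n) j : A ^+ j = 0 ->
  exists p M, [/\ posdef p, M *m A - A *m M = 2^-1 *: A &
                 M *m p + p *m M^t* = A *m p *m A^t*].
Proof.
elim/ltn_ind: n A => n IH A nil.
have [n0|n0] := posnP n.
  exists 1%:M, 0; split; last 2 first; try by apply/matrixP => -[? ?]; subst n.
  by rewrite -[X in posdef X]mulmx1 -{2}adj1; apply: posdef_mul_adj; apply: unitmx1.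
have [k [Ak1 Ak]] := nilpotent_index n0 nil.
have [Y [X [XY AY XA]]] := nilpotent_chain Ak1 Ak.
set J := shiftmx C k.+1 in AY XA.
pose Q := 1%:M - Y *m X.
have QY : Q *m Y = 0 by rewrite /Q mulmxBl mul1mx -mulmxA XY mulmx1 subrr.
have XQ : X *m Q = 0 by rewrite /Q mulmxBr mulmx1 mulmxA XY mul1mx subrr.
have QQ : Q *m Q = Q by rewrite {1}/Q mulmxBl mul1mx -mulmxA XQ mulmx0 subr0.
have QA : Q *m A = A *m Q.
  by rewrite /Q mulmxBl mulmxBr mul1mx mulmx1 -mulmxA XA !mulmxA AY.
have rQ : \rank Q = (n - k.+1)%N by apply: mxrank_compl_idempotent.
have lt : (n - k.+1 < n)%N by rewrite ltn_subrL.
have [K [L KL LK]] := idempotent_factor QQ rQ.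
have s1 : Y *m X + K *m L = 1%:M by rewrite KL /Q addrC subrK.
have XK : X *m K = 0 by rewrite -[LHS]mulmx1 -LK mulmxA -[X *m K *m L]mulmxA KL XQ mul0mx.
have LY : L *m Y = 0 by rewrite -[LHS]mul1mx -LK -mulmxA [K *m _]mulmxA KL QY mulmx0.
pose A' := L *m A *m K.
have AK : A *m K = K *m A'.
  by rewrite /A' !mulmxA KL QA -[A *m Q *m K]mulmxA -KL -[K *m L *m K]mulmxA LK mulmx1.
have LA : L *m A = A' *m L.
  by rewrite /A' -!mulmxA KL -QA -KL !mulmxA LK mul1mx.
have nil' : A' ^+ j = 0.
  have h : K *m A' ^+ j = 0.
    have <- : A ^+ j *m K = K *m A' ^+ j; last by rewrite nil mul0mx.
    elim: (j) => [|i IHi]; first by rewrite !expr0 mul1mx mulmx1.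
    by rewrite !exprS -!mulmxE -mulmxA IHi mulmxA AK -mulmxA.
  by rewrite -[LHS]mul1mx -LK -mulmxA h mulmx0.
have [p' [M' [pp' cM' eM']]] := IH _ lt A' nil'.
set F := factdiag k.+1; set D := levelmx k.+1.
have AE : A = Y *m J *m X + K *m A' *m L.
  by rewrite -AY -AK -!mulmxA -mulmxDr s1 mulmx1.
have YXmul r (P1 P2 : 'M[C]_k.+1) (Q1 Q2 : 'M[C]_r) (U : 'M[C]_(n, r)) V : X *m U = 0 ->
    V *m Y = 0 -> V *m U = 1%:M ->
   (Y *m P1 *m X + U *m Q1 *m V) *m (Y *m P2 *m X + U *m Q2 *m V) =
   Y *m (P1 *m P2) *m X + U *m (Q1 *m Q2) *m V.
  move=> XU VY VU; rewrite mulmxDl !mulmxDr !mulmxA.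
  rewrite -!(mulmxA _ X Y) -!(mulmxA _ X U) -!(mulmxA _ V Y) -!(mulmxA _ V U).
  by rewrite XY XU VY VU !mulmx0 !mul0mx !mulmx1 addr0 add0r.
have pmul r (P1 P2 : 'M[C]_k.+1) (Q1 Q2 : 'M[C]_r) (U : 'M[C]_(n, r)) V : X *m U = 0 ->
    V *m Y = 0 -> V *m U = 1%:M ->
   (Y *m P1 *m X + U *m Q1 *m V) *m (Y *m P2 *m Y^t* + U *m Q2 *m U^t*) =
   Y *m (P1 *m P2) *m Y^t* + U *m (Q1 *m Q2) *m U^t*.
  move=> XU VY VU; rewrite mulmxDl !mulmxDr !mulmxA.
  rewrite -!(mulmxA _ X Y) -!(mulmxA _ X U) -!(mulmxA _ V Y) -!(mulmxA _ V U).
  by rewrite XY XU VY VU !mulmx0 !mul0mx !mulmx1 addr0 add0r.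
exists (Y *m F *m Y^t* + K *m p' *m K^t*), (Y *m D *m X + K *m M' *m L).
have pd := posdef_direct_sum s1 (posdef_factdiag k.+1) pp'.
split=> //.
  have -> : 2^-1 *: A = Y *m (D *m J - J *m D) *m X + K *m (M' *m A' - A' *m M') *m L.
    by rewrite levelmx_comm cM' -!scalemxAr -!scalemxAl -scalerDr -AE.
  by rewrite {1 2}AE !YXmul // !mulmxBr !mulmxBl; mxlin.
set p := Y *m F *m Y^t* + _ in pd *; set M := Y *m D *m X + _.
have eMp : M *m p = Y *m (D *m F) *m Y^t* + K *m (M' *m p') *m K^t* by apply: pmul.
have eAp : A *m p = Y *m (J *m F) *m Y^t* + K *m (A' *m p') *m K^t*.
  by rewrite {1}AE; apply: pmul.
have eApA : A *m p *m A^t* = Y *m (J *m F *m J^t*) *m Y^t* + K *m (A' *m p' *m A'^t*) *m K^t*.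
  have h : p *m A^t* = Y *m (F *m J^t*) *m Y^t* + K *m (p' *m A'^t*) *m K^t*.
    have := congr1 (fun Z => Z^t*) eAp; rewrite adjM pd.1 => ->.
    by rewrite adjD !adjM !trmxCK pp'.1 (posdef_factdiag _).1 !mulmxA.
  by rewrite -mulmxA h {1}AE pmul // !mulmxA.
have epM : p *m M^t* = Y *m (F *m D^t*) *m Y^t* + K *m (p' *m M'^t*) *m K^t*.
  have := congr1 (fun Z => Z^t*) eMp; rewrite adjM pd.1 => ->.
  by rewrite adjD !adjM !trmxCK pp'.1 (posdef_factdiag _).1 !mulmxA.
rewrite eApA eMp epM -eM' -factdiag_level !mulmxDr !mulmxDl; mxlin.
Qed.

(** An eigenbasis is declared orthonormal; [M] is then diagonal with entries [|d_i|^2 / 2] and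
    commutes with [A]. *)
Lemma diagonalizable_soliton_data n (A : 'M[C]_n) : diagonalizable A ->
  exists p M, [/\ posdef p, M *m A - A *m M = 0 *: A &
                 M *m p + p *m M^t* = A *m p *m A^t*].
Proof.
case=> P uP; rewrite /similar_to conjumx // => /diag_mxP [d hd].
pose Q := invmx P.
have AE : A = Q *m diag_mx d *m P by rewrite -hd /Q !mulmxA mulVmx // mul1mx mulmxKV.
pose D := diag_mx (\row_i (d 0 i * (d 0 i)^* / 2)).
exists (Q *m Q^t*), (Q *m D *m P); split.
- by apply: posdef_mul_adj; rewrite unitmx_inv.
- have -> : Q *m D *m P *m A = Q *m (D *m diag_mx d) *m P by rewrite AE !mulmxA mulmxK.
  have -> : A *m (Q *m D *m P) = Q *m (diag_mx d *m D) *m P by rewrite AE !mulmxA mulmxK.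
  rewrite scale0r; apply/eqP; rewrite subr_eq0 !mulmx_diag; apply/eqP.
  by congr (_ *m diag_mx _ *m _); apply/rowP => i; rewrite !mxE mulrC.
have PQ : P *m Q = 1%:M by rewrite mulmxV.
have QP : Q^t* *m P^t* = 1%:M by rewrite -adjM PQ adj1.
rewrite AE !adjM !mulmxA -!(mulmxA _ P Q) PQ !mulmx1 -!(mulmxA _ (Q^t*) (P^t*)) QP !mulmx1.
rewrite -mulmxDl -mulmxDr -[Q *m diag_mx d *m _]mulmxA; congr (_ *m _ *m _).
rewrite /D !tr_diag_mx !map_diag_mx mulmx_diag -raddfD; congr diag_mx.
apply/rowP => i; rewrite !mxE !rmorphM fmorphV /= conjCK conjC_nat.
by field.
Qed.

End Existence.

From mathcomp Require Import lra.
From mathcomp Require Import reals complex.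
From mathcomp Require sequences exp all_classical all_reals all_analysis.
From Stdlib Require ClassicalEpsilon.
Require Import Defs.

(** * Mean values, real-valued norms and matrix limits *)

Section Norms.
Import all_classical all_reals all_analysis numFieldNormedType.Exports.
Local Open Scope classical_set_scope.
Local Open Scope ring_scope.
Variable R : realType.
Local Notation C := (complex R).
Local Notation cRe := (@complex.Re R).
Local Notation cIm := (@complex.Im R).

Lemma mean_value (f df : R -> R) (a b : R) :
  (forall x eps : R, 0 < eps -> exists2 d : R, 0 < d & forall h : R, `|h| < d ->
     `|f (x + h) - f x - df x * h| <= eps * `|h|) ->
  a < b -> exists2 c, a < c < b & f b - f a = df c * (b - a).
Proof.
move=> hf ab.
have der (x : R) : is_derive x (1 : R) f (df x).
  have cv : h^-1 *: (f (h *: 1 + x) - f x) @[h --> 0^'] --> df x.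
    apply/cvgrPdist_le => eps e0; have [d d0 hd] := hf x eps e0.
    exists d => //= h; rewrite /= sub0r normrN => hh h0.
    rewrite scaler1 -normrN opprB [h + x]addrC.
    have -> : h^-1 *: (f (x + h) - f x) - df x = h^-1 * (f (x + h) - f x - df x * h).
      by rewrite -[_ *: _]/(_ * _); field.
    rewrite normrM normfV ler_pdivrMl ?normr_gt0 // [leRHS]mulrC; exact: hd.
  by split; [apply: cvgP cv | apply: cvg_lim cv].
have [c hc e] := MVT ab (fun x _ => der x) (derivable_within_continuous (fun x _ => @ex_derive _ _ _ _ _ _ _ (der x))).
by exists c => //; move: hc; rewrite in_itv.
Qed.

(** The norm on [complex R] takes complex values; this real version allows estimates in the ordered
    field [R]. *)
Definition cabs (x : C) : R := cRe `|x|.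

Lemma cabsE x : `|x| = rC (cabs x).
Proof. by rewrite /cabs /rC normc_def. Qed.

Lemma rC_inj : injective (@rC R).
Proof. exact: complexI. Qed.

Lemma rCD x y : rC (x + y) = rC x + rC y :> C. Proof. exact: rmorphD. Qed.
Lemma rCM x y : rC (x * y) = rC x * rC y :> C. Proof. exact: rmorphM. Qed.
Lemma rCN x : rC (- x) = - rC x :> C. Proof. exact: rmorphN. Qed.
Lemma rC0 : rC 0 = 0 :> C. Proof. exact: rmorph0. Qed.
Lemma rC1 : rC 1 = 1 :> C. Proof. exact: rmorph1. Qed.
Lemma rCV x : rC x^-1 = (rC x)^-1 :> C. Proof. exact: fmorphV. Qed.
Lemma rCX x n : rC (x ^+ n) = rC x ^+ n :> C. Proof. exact: rmorphXn. Qed.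
Lemma rC_nat n : rC n%:R = n%:R :> C. Proof. exact: rmorph_nat. Qed.
Lemma rC_sum (I : Type) (s : seq I) (P : pred I) (F : I -> R) :
  rC (\sum_(i <- s | P i) F i) = \sum_(i <- s | P i) rC (F i) :> C.
Proof. exact: rmorph_sum. Qed.
Lemma rC_eq0 x : (rC x == 0 :> C) = (x == 0). Proof. exact: fmorph_eq0. Qed.
Lemma le_rC x y : (rC x <= rC y :> C) = (x <= y). Proof. exact: lecR. Qed.
Lemma lt_rC x y : (rC x < rC y :> C) = (x < y). Proof. exact: ltcR. Qed.
Lemma conj_rC x : conjc (rC x) = rC x :> C. Proof. exact: conjc_real. Qed.

Lemma cabs_ge0 x : 0 <= cabs x.
Proof. by rewrite -le_rC rC0 -cabsE. Qed.

Lemma cabsM x y : cabs (x * y) = cabs x * cabs y.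
Proof. by apply: rC_inj; rewrite rCM -!cabsE normrM. Qed.

Lemma cabsD x y : cabs (x + y) <= cabs x + cabs y.
Proof. by rewrite -le_rC rCD -!cabsE ler_normD. Qed.

Lemma cabsN x : cabs (- x) = cabs x.
Proof. by apply: rC_inj; rewrite -!cabsE normrN. Qed.

Lemma cabs0 : cabs 0 = 0.
Proof. by apply: rC_inj; rewrite -!cabsE normr0 rC0. Qed.

Lemma cabs1 : cabs 1 = 1.
Proof. by apply: rC_inj; rewrite -!cabsE normr1 rC1. Qed.

Lemma cabs_eq0 x : (cabs x == 0) = (x == 0).
Proof. by rewrite -rC_eq0 -cabsE normr_eq0. Qed.

Lemma cabsV x : cabs x^-1 = (cabs x)^-1.
Proof. by apply: rC_inj; rewrite rCV -!cabsE normfV. Qed.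

Lemma cabsX x n : cabs (x ^+ n) = cabs x ^+ n.
Proof. by apply: rC_inj; rewrite rCX -!cabsE normrX. Qed.

Lemma cabs_nat n : cabs n%:R = n%:R.
Proof. by apply: rC_inj; rewrite -cabsE normr_nat rC_nat. Qed.

Lemma cabs_conj x : cabs (conjc x) = cabs x.
Proof. by apply: rC_inj; rewrite -!cabsE normcJ. Qed.

Lemma cabs_rC t : cabs (rC t) = `|t|.
Proof.
apply: rC_inj; rewrite -cabsE normc_def /= expr0n /= addr0 sqrtr_sqr //.
Qed.

Lemma cabs_sum (I : Type) (s : seq I) (P : pred I) (F : I -> C) :
  cabs (\sum_(i <- s | P i) F i) <= \sum_(i <- s | P i) cabs (F i).
Proof.
rewrite -le_rC rC_sum -cabsE.
by apply: le_trans (ler_norm_sum _ _ _) _; apply: ler_sum => i _; rewrite cabsE.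
Qed.

Lemma cabsE_sqrt x : cabs x = Num.sqrt (cRe x ^+ 2 + cIm x ^+ 2).
Proof. by rewrite /cabs normc_def. Qed.

Lemma normRe_le x : `|cRe x| <= cabs x.
Proof. by rewrite cabsE_sqrt -sqrtr_sqr ler_wsqrtr // lerDl sqr_ge0. Qed.

Lemma normIm_le x : `|cIm x| <= cabs x.
Proof. by rewrite cabsE_sqrt -sqrtr_sqr ler_wsqrtr // lerDr sqr_ge0. Qed.

Lemma cabs_le x : cabs x <= `|cRe x| + `|cIm x|.
Proof.
rewrite cabsE_sqrt -[leRHS]ger0_norm ?addr_ge0 // -sqrtr_sqr ler_wsqrtr //.
rewrite sqrrD !real_normK ?num_real // lerD2r lerDl.
by rewrite mulrn_wge0 // mulr_ge0.
Qed.

(** Real form of both [mnorm] and [vnorm]. It is submultiplicative, but [nr 1] is the size of the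
    matrix rather than one, hence the factors [nr 1] below. *)
Definition nr m k (M : 'M[C]_(m, k)) : R := \sum_i \sum_j cabs (M i j).

Lemma mnormE m k (M : 'M[C]_(m, k)) : mnorm M = rC (nr M).
Proof.
rewrite /mnorm /nr rC_sum; apply: eq_bigr => i _; rewrite rC_sum.
by apply: eq_bigr => j _; rewrite cabsE.
Qed.

Lemma vnormE m (v : 'cV[C]_m) : vnorm v = rC (nr v).
Proof.
rewrite /vnorm /nr rC_sum; apply: eq_bigr => i _.
by rewrite big_ord1 cabsE.
Qed.

Lemma nr_ge0 m k (M : 'M[C]_(m, k)) : 0 <= nr M.
Proof. by apply: sumr_ge0 => i _; apply: sumr_ge0 => j _; apply: cabs_ge0. Qed.

Lemma nr0 m k : nr (0 : 'M[C]_(m, k)) = 0.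
Proof. by rewrite /nr big1 // => i _; rewrite big1 // => j _; rewrite mxE cabs0. Qed.

Lemma nrN m k (M : 'M[C]_(m, k)) : nr (- M) = nr M.
Proof. by apply: eq_bigr => i _; apply: eq_bigr => j _; rewrite mxE cabsN. Qed.

Lemma nrD m k (M N : 'M[C]_(m, k)) : nr (M + N) <= nr M + nr N.
Proof.
rewrite /nr -big_split; apply: ler_sum => i _ /=.
by rewrite -big_split; apply: ler_sum => j _; rewrite mxE cabsD.
Qed.

Lemma nrB m k (M N : 'M[C]_(m, k)) : nr (M - N) <= nr M + nr N.
Proof. by apply: le_trans (nrD _ _) _; rewrite nrN. Qed.

Lemma nrZ m k a (M : 'M[C]_(m, k)) : nr (a *: M) = cabs a * nr M.
Proof.
rewrite /nr mulr_sumr; apply: eq_bigr => i _; rewrite mulr_sumr.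
by apply: eq_bigr => j _; rewrite mxE cabsM.
Qed.

Lemma nr_entry m k (M : 'M[C]_(m, k)) i j : cabs (M i j) <= nr M.
Proof.
rewrite /nr (bigD1 i) //= (bigD1 j) //= -addrA lerDl addr_ge0 //.
  by apply: sumr_ge0 => a _; apply: cabs_ge0.
by apply: sumr_ge0 => a _; apply: sumr_ge0 => b _; apply: cabs_ge0.
Qed.

Lemma nr_eq0 m k (M : 'M[C]_(m, k)) : nr M = 0 -> M = 0.
Proof.
move=> M0; apply/matrixP => i j; rewrite mxE; apply/eqP; rewrite -cabs_eq0.
by rewrite eq_le cabs_ge0 andbT -M0 nr_entry.
Qed.

Lemma nr_eq0_eps m k (M : 'M[C]_(m, k)) : (forall eps, 0 < eps -> nr M <= eps) -> M = 0.
Proof.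
move=> h; apply: nr_eq0; apply/eqP; rewrite eq_le nr_ge0 andbT.
by apply/ler_addgt0Pr => e e0; rewrite add0r h.
Qed.

Lemma nr_mul m k l (M : 'M[C]_(m, k)) (N : 'M[C]_(k, l)) : nr (M *m N) <= nr M * nr N.
Proof.
rewrite /nr mulr_suml; apply: ler_sum => i _.
apply: (@le_trans _ _ (\sum_j \sum_a cabs (M i a) * cabs (N a j))).
  apply: ler_sum => j _; rewrite mxE; apply: le_trans (cabs_sum _ _ _) _.
  by apply: ler_sum => a _; rewrite cabsM.
rewrite exchange_big mulr_suml /=; apply: ler_sum => a _.
rewrite -mulr_sumr; apply: ler_wpM2l; first exact: cabs_ge0.
rewrite (bigD1 a) //= lerDl; apply: sumr_ge0 => b _; apply: sumr_ge0 => c _.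
exact: cabs_ge0.
Qed.

Lemma nr_tr m k (M : 'M[C]_(m, k)) : nr M^T = nr M.
Proof.
by rewrite /nr exchange_big; apply: eq_bigr => i _; apply: eq_bigr => j _; rewrite mxE.
Qed.

Lemma nr_cmx m k (M : 'M[C]_(m, k)) : nr (cmx M) = nr M.
Proof. by apply: eq_bigr => i _; apply: eq_bigr => j _; rewrite mxE cabs_conj. Qed.

Lemma nr_expr n (M : 'M[C]_n) k : nr (M ^+ k) <= nr (1%:M : 'M[C]_n) * nr M ^+ k.
Proof.
elim: k => [|k IH]; first by rewrite !expr0 mulr1.
rewrite !exprSr mulrA; apply: le_trans (nr_mul _ _) _.
by apply: ler_wpM2r IH; apply: nr_ge0.
Qed.

Definition mcvg m k (u : nat -> 'M[C]_(m, k)) (l : 'M[C]_(m, k)) : Prop :=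
  forall eps : R, 0 < eps -> exists N0, forall N, (N0 <= N)%N -> nr (u N - l) <= eps.

Lemma mcvg_unique m k (u : nat -> 'M[C]_(m, k)) l l' : mcvg u l -> mcvg u l' -> l = l'.
Proof.
move=> h h'; apply/eqP; rewrite -subr_eq0; apply/eqP; apply: nr_eq0_eps => e e0.
have e2 : 0 < e / 2 by rewrite divr_gt0.
have [N hN] := h _ e2; have [N' hN'] := h' _ e2.
have := hN (maxn N N') (leq_maxl _ _); have := hN' (maxn N N') (leq_maxr _ _).
set v := u _ => h1 h2.
have -> : l - l' = (v - l') - (v - l) by mxlin.
apply: le_trans (nrB _ _) _; lra.
Qed.

Lemma mcvg_ext m k (u v : nat -> 'M[C]_(m, k)) l : u =1 v -> mcvg u l -> mcvg v l.
Proof. by move=> h hu e e0; have [N hN] := hu e e0; exists N => M /hN; rewrite h. Qed.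

Lemma mcvg_shift m k (u : nat -> 'M[C]_(m, k)) l :
  mcvg u l -> mcvg (fun N => u N.+1) l.
Proof. by move=> hu e e0; have [N hN] := hu e e0; exists N => M h; apply: hN; apply: leqW. Qed.

Lemma mcvgD m k (u v : nat -> 'M[C]_(m, k)) l l' :
  mcvg u l -> mcvg v l' -> mcvg (fun N => u N + v N) (l + l').
Proof.
move=> h h' e e0; have e2 : 0 < e / 2 by rewrite divr_gt0.
have [N hN] := h _ e2; have [N' hN'] := h' _ e2.
exists (maxn N N') => M; rewrite geq_max => /andP [/hN h1 /hN' h2].
have -> : u M + v M - (l + l') = (u M - l) + (v M - l') by rewrite opprD addrACA.
apply: le_trans (nrD _ _) _; lra.
Qed.

Lemma mcvg_mul m k p q (A : 'M[C]_(p, m)) (B : 'M[C]_(k, q)) (u : nat -> 'M[C]_(m, k)) l :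
  mcvg u l -> mcvg (fun N => A *m u N *m B) (A *m l *m B).
Proof.
move=> h e e0; pose c := nr A * nr B + 1.
have c0 : 0 < c by rewrite /c ltr_wpDl // mulr_ge0 ?nr_ge0.
have [N hN] := h (e / c) (divr_gt0 e0 c0); exists N => M /hN h1.
rewrite -mulmxBl -mulmxBr; apply: le_trans (nr_mul _ _) _.
apply: (@le_trans _ _ (nr A * nr (u M - l) * nr B)).
  by apply: ler_wpM2r (nr_mul _ _); apply: nr_ge0.
have hc : nr (u M - l) * c <= e by rewrite -ler_pdivlMr.
apply: le_trans hc; rewrite /c mulrDr mulr1 -[nr A * _ * _]mulrA mulrCA.
by rewrite lerDl nr_ge0.
Qed.

Lemma mcvgZ m k (u : nat -> 'M[C]_(m, k)) l a : mcvg u l -> mcvg (fun N => a *: u N) (a *: l).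
Proof.
move=> h; have := mcvg_mul (a%:M) (1%:M) h; rewrite mulmx1 mul_scalar_mx.
by apply: mcvg_ext => N; rewrite mulmx1 mul_scalar_mx.
Qed.

Lemma mcvgM m k l (u : nat -> 'M[C]_(m, k)) (v : nat -> 'M[C]_(k, l)) a b :
  mcvg u a -> mcvg v b -> mcvg (fun N => u N *m v N) (a *m b).
Proof.
move=> hu hv e e0; pose c := nr a + nr b + 1.
have c1 : 1 <= c by rewrite /c lerDr addr_ge0 // nr_ge0.
have c0 : 0 < c := lt_le_trans ltr01 c1.
pose d := Num.min 1 (e / (2 * c)).
have d0 : 0 < d by rewrite lt_min ltr01 divr_gt0 // mulr_gt0.
have [N hN] := hu d d0; have [N' hN'] := hv d d0.
exists (maxn N N') => M; rewrite geq_max => /andP [/hN h1 /hN' h2].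
have -> : u M *m v M - a *m b = (u M - a) *m (v M - b) + (u M - a) *m b + a *m (v M - b).
  by rewrite !mulmxBl !mulmxBr; mxlin.
have d1 : d <= 1 by rewrite ge_min lexx.
have d2 : d * (2 * c) <= e by rewrite -ler_pdivlMr ?mulr_gt0 // ge_min lexx orbT.
have t0 := nrD ((u M - a) *m (v M - b)) ((u M - a) *m b).
have t1 := nr_mul (u M - a) (v M - b); have t2 := nr_mul (u M - a) b.
have t3 := nr_mul a (v M - b); apply: le_trans (nrD _ _) _.
have k1 : nr (u M - a) * nr (v M - b) <= d * 1.
  by apply: ler_pM; rewrite ?nr_ge0 // (le_trans h2).
have k2 : nr (u M - a) * nr b <= d * nr b by apply: ler_wpM2r; rewrite ?nr_ge0.
have k3 : nr a * nr (v M - b) <= nr a * d by apply: ler_wpM2l; rewrite ?nr_ge0.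
have dc : d * 1 + d * nr b + nr a * d = d * c by rewrite /c; ring.
have dc2 : d * c <= d * (2 * c) by apply: ler_wpM2l; lra.
lra.
Qed.

End Norms.

(** * The matrix exponential *)

Section Exponential.
Import all_classical all_reals all_analysis numFieldNormedType.Exports.
Local Open Scope classical_set_scope.
Local Open Scope ring_scope.
Variable R : realType.
Local Notation C := (complex R).
Local Notation cRe := (@complex.Re R).
Local Notation cIm := (@complex.Im R).

Lemma sum_triangle (V : nmodType) (G : nat -> nat -> V) N :
  \sum_(0 <= k < N) \sum_(0 <= i < k.+1) G i (k - i)%N =
  \sum_(0 <= i < N) \sum_(0 <= j < N - i) G i j.
Proof.
elim: N => [|N IH]; first by rewrite !big_nil.
rewrite big_nat_recr //= IH [RHS]big_nat_recr //= subSn // subnn big_nat1.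
rewrite [X in _ + X]big_nat_recr //= subnn addrA; congr (_ + _).
rewrite -big_split; apply: eq_big_nat => i /andP [_ iN] /=.
by rewrite subSn 1?ltnW // big_nat_recr.
Qed.

Lemma binomial_exp_coeff (F : numFieldType) (x y : F) k :
  (x + y) ^+ k / k`!%:R =
  \sum_(0 <= i < k.+1) x ^+ i / i`!%:R * (y ^+ (k - i) / (k - i)`!%:R).
Proof.
rewrite addrC exprDn big_mkord mulr_suml; apply: eq_bigr => i _.
have ik : (i <= k)%N by rewrite -ltnS.
have := congr1 (fun n => n%:R : F) (bin_fact ik); rewrite !natrM => <-.
have nz n : n`!%:R != 0 :> F by rewrite pnatr_eq0 -lt0n fact_gt0.
have nzb : 'C(k, i)%:R != 0 :> F by rewrite pnatr_eq0 -lt0n bin_gt0.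
rewrite -mulr_natr; field.
by rewrite !nz nzb.
Qed.

(** Error term of the Cauchy product, supported on [i + j >= N]. The coefficients [T] lie in any
    module, so that the identity applies both to powers of a matrix and to the scalar majorant. *)
Lemma exp_coeff_mul (F : numFieldType) (V : lmodType F) (T : nat -> V) (x y : F) N :
  \sum_(0 <= i < N) \sum_(0 <= j < N) (x ^+ i / i`!%:R * (y ^+ j / j`!%:R)) *: T (i + j)%N
  - \sum_(0 <= k < N) ((x + y) ^+ k / k`!%:R) *: T k =
  \sum_(0 <= i < N) \sum_(N - i <= j < N) (x ^+ i / i`!%:R * (y ^+ j / j`!%:R)) *: T (i + j)%N.
Proof.
pose G i j := (x ^+ i / i`!%:R * (y ^+ j / j`!%:R)) *: T (i + j)%N.
have -> : \sum_(0 <= k < N) ((x + y) ^+ k / k`!%:R) *: T k =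
    \sum_(0 <= i < N) \sum_(0 <= j < N - i) G i j.
  rewrite -sum_triangle; apply: eq_bigr => k _.
  rewrite binomial_exp_coeff scaler_suml; apply: eq_big_nat => i /andP [_ ik].
  by rewrite /G subnKC.
apply/eqP; rewrite subr_eq -big_split /=; apply/eqP; apply: eq_bigr => i _.
by rewrite addrC -big_cat_nat // leq_subr.
Qed.

Lemma exp_series_le (a : R) N : 0 <= a -> \sum_(0 <= k < N) a ^+ k / k`!%:R <= expR a.
Proof.
move=> a0; apply: nondecreasing_cvgn_le; last exact: is_cvg_series_exp_coeff.
apply/nondecreasing_seqP => k; rewrite /series /= big_nat_recr //= lerDl.
by rewrite /exp_coeff /= divr_ge0 ?exprn_ge0 ?ler0n.
Qed.

Lemma dominated_series (u : nat -> R) (c a : R) :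
  0 <= a -> 0 <= c -> (forall k, `|u k| <= c * (a ^+ k / k`!%:R)) ->
  exists l : R, forall eps : R, 0 < eps -> exists N0, forall N, (N0 <= N)%N ->
    `|\sum_(k < N) u k - l| <= eps.
Proof.
move=> a0 c0 hu.
have cv : cvgn (series u).
  apply: normed_cvg; apply: (@series_le_cvg _ _ (fun k => c * (a ^+ k / k`!%:R))).
  - by move=> k; apply: normr_ge0.
  - by move=> k; rewrite mulr_ge0 // divr_ge0 ?exprn_ge0.
  - by move=> k; apply: hu.
  have -> : (fun k => c * (a ^+ k / k`!%:R)) = c *: exp_coeff a by apply/funext.
  exact: is_cvg_seriesZ (is_cvg_series_exp_coeff a).
exists (limn (series u)) => eps e0.
have /cvgrPdist_le /(_ eps e0) [N _ h] := cv.
by exists N => n /h; rewrite /series /= big_mkord distrC.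
Qed.

Definition psum n (M : 'M[C]_n) (N : nat) : 'M[C]_n := \sum_(k < N) (k`!%:R)^-1 *: M ^+ k.

Lemma is_expmP n (M E : 'M[C]_n) : is_expm M E <-> mcvg (psum M) E.
Proof.
split=> h eps e0; have [N hN] := h eps e0; exists N => k /hN.
  by rewrite mnormE le_rC.
by rewrite mnormE le_rC.
Qed.

Lemma nr_expm_term n (M : 'M[C]_n) k :
  nr ((k`!%:R)^-1 *: M ^+ k) <= nr (1%:M : 'M[C]_n) * (nr M ^+ k / k`!%:R).
Proof.
rewrite nrZ cabsV cabs_nat mulrA [leRHS]mulrC ler_wpM2l ?invr_ge0 ?ler0n //.
exact: nr_expr.
Qed.

Lemma mcvg_entry m k (u : nat -> 'M[C]_(m, k)) (l : 'M[C]_(m, k)) :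
  (forall i j (eps : R), 0 < eps -> exists N0, forall N, (N0 <= N)%N -> cabs (u N i j - l i j) <= eps) ->
  mcvg u l.
Proof.
move=> h eps e0; pose c : R := (m * k)%:R + 1.
have c0 : 0 < c by rewrite ltr_wpDl.
have /fin_all_exists [f hf] : forall ij : 'I_m * 'I_k, exists N0, forall N, (N0 <= N)%N ->
    cabs (u N ij.1 ij.2 - l ij.1 ij.2) <= eps / c.
  by move=> [i j]; apply: h; rewrite divr_gt0.
exists (\max_ij f ij) => N hN.
apply: (@le_trans _ _ (\sum_(i < m) \sum_(j < k) eps / c)).
  apply: ler_sum => i _; apply: ler_sum => j _; rewrite mxDE mxNE.
  by apply: (hf (i, j)); apply: leq_trans hN; apply: (leq_bigmax (i, j)).
rewrite !sumr_const !card_ord -mulrnA mulnC -mulr_natr mulrAC ler_pdivrMr //.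
by rewrite ler_wpM2l ?(ltW e0) // /c lerDl.
Qed.

(** Real and imaginary parts of each entry are dominated by a real exponential series. *)
Lemma expm_ex n (M : 'M[C]_n) : exists E, is_expm M E.
Proof.
have hk (p : C -> R) : (forall x, `|p x| <= cabs x) -> (forall x y, p (x + y) = p x + p y) ->
    p 0 = 0 ->
    forall ij : 'I_n * 'I_n, exists l : R, forall eps : R, 0 < eps -> exists N0, forall N, (N0 <= N)%N ->
    `|p (psum M N ij.1 ij.2) - l| <= eps.
  move=> hp pD p0 [i j].
  have [l hl] := @dominated_series (fun k => p (((k`!%:R)^-1 *: M ^+ k) i j))
     (nr (1%:M : 'M[C]_n)) (nr M) (nr_ge0 _) (nr_ge0 _)
     (fun k => le_trans (hp _) (le_trans (nr_entry _ i j) (nr_expm_term M k))).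
  exists l => eps e0; have [N0 hN] := hl eps e0; exists N0 => N /hN /=.
  suff -> : p (psum M N i j) = \sum_(k < N) p (((k`!%:R)^-1 *: M ^+ k) i j) by [].
  rewrite /psum summxE; elim/big_rec2: _ => // k a b _ <-.
  by rewrite pD.
have ReD x y : cRe (x + y) = cRe x + cRe y by case: x y => [? ?] [? ?].
have ImD x y : cIm (x + y) = cIm x + cIm y by case: x y => [? ?] [? ?].
have /fin_all_exists [f hf] := hk cRe (@normRe_le R) ReD erefl.
have /fin_all_exists [g hg] := hk cIm (@normIm_le R) ImD erefl.
exists (\matrix_(i, j) Complex (f (i, j)) (g (i, j))).
apply/is_expmP; apply: mcvg_entry => i j eps e0.
have e2 : 0 < eps / 2 by rewrite divr_gt0.
have [N1 h1] := hf (i, j) _ e2; have [N2 h2] := hg (i, j) _ e2.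
exists (maxn N1 N2) => N; rewrite geq_max mxE => /andP [/h1 k1 /h2 k2].
apply: le_trans (cabs_le _) _.
move: k1 k2 => /=; case: (psum M N i j) => x y /= k1 k2; lra.
Qed.

Lemma expmP n (M : 'M[C]_n) : mcvg (psum M) (expm M).
Proof.
apply/is_expmP; rewrite /expm; case: ClassicalEpsilon.excluded_middle_informative => h.
  exact: proj2_sig.
by case: h; apply: expm_ex.
Qed.

(* A sealed copy of [expm]: unification never unfolds it. *)
Lemma mexp_sig n : {f : 'M[C]_n -> 'M[C]_n | forall M, f M = expm M}.
Proof. by exists (@expm R n). Qed.

Definition mexp n (M : 'M[C]_n) : 'M[C]_n := sval (mexp_sig n) M.

Lemma mexpE n (M : 'M[C]_n) : expm M = mexp M.
Proof. by rewrite /mexp (svalP (mexp_sig n)). Qed.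

Lemma mexpP n (M : 'M[C]_n) : mcvg (psum M) (mexp M).
Proof. by rewrite -mexpE; apply: expmP. Qed.

Lemma mexp_eq n (M E : 'M[C]_n) : mcvg (psum M) E -> mexp M = E.
Proof. exact: mcvg_unique (mexpP M). Qed.

Lemma expm0 n : mexp (0 : 'M[C]_n) = 1%:M.
Proof.
(* At least one term is required: the empty partial sum is zero. *)
apply: mexp_eq => eps e0; exists 1%N => -[//|N] _.
rewrite /psum big_ord_recl /= expr0 fact0 invr1 scale1r big1 ?addr0 ?subrr ?nr0 ?ltW //.
by move=> i _; rewrite exprS mul0r scaler0.
Qed.

(** [B] may be rectangular. Blocks of an exponential are later read off by intertwining with an
    inclusion or a projection. *)
Lemma expm_intertwine m n (B : 'M[C]_(m, n)) (X : 'M[C]_n) (Y : 'M[C]_m) :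
  B *m X = Y *m B -> B *m mexp X = mexp Y *m B.
Proof.
move=> h; apply: (@mcvg_unique _ _ _ (fun N => B *m psum X N)).
  have := mcvg_mul B (1%:M) (mexpP X); rewrite mulmx1.
  by apply: mcvg_ext => N; rewrite mulmx1.
have := mcvg_mul (1%:M) B (mexpP Y); rewrite mul1mx; apply: mcvg_ext => N.
rewrite mul1mx /psum mulmx_sumr mulmx_suml; apply: eq_bigr => k _.
rewrite -scalemxAl -scalemxAr; congr (_ *: _).
elim: (val k) => [|j IH]; first by rewrite !expr0 mul1mx mulmx1.
by rewrite !exprSr -!mulmxE -mulmxA -h mulmxA IH mulmxA.
Qed.

Lemma expm_comm n (A : 'M[C]_n) z : A *m mexp (z *: A) = mexp (z *: A) *m A.
Proof. by apply: expm_intertwine; rewrite -scalemxAl -scalemxAr. Qed.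

Lemma expr_scalemx n (A : 'M[C]_n) z k : (z *: A) ^+ k = z ^+ k *: A ^+ k.
Proof.
elim: k => [|k IH]; first by rewrite !expr0 scale1r.
by rewrite !exprS IH -!mulmxE -scalemxAl -scalemxAr scalerA.
Qed.

Lemma psumZ n (A : 'M[C]_n) z N :
  psum (z *: A) N = \sum_(0 <= k < N) (z ^+ k / k`!%:R) *: A ^+ k.
Proof.
by rewrite big_mkord; apply: eq_bigr => k _; rewrite expr_scalemx scalerA mulrC.
Qed.

Lemma nr_sum m n (I : Type) (q : seq I) (F : I -> 'M[C]_(m, n)) :
  nr (\sum_(i <- q) F i) <= \sum_(i <- q) nr (F i).
Proof.
elim/big_rec2: _ => [|i a b _ h]; first by rewrite nr0.
by apply: le_trans (nrD _ _) _; rewrite lerD2l.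
Qed.

(** The Cauchy product error for matrices is bounded, term by term, by [nr 1] times the one for the
    real numbers [nr A * cabs x] and [nr A * cabs y], which tends to zero by the addition formula
    for [expR]. *)
Lemma expmD n (A : 'M[C]_n) x y :
  mexp ((x + y) *: A) = mexp (x *: A) *m mexp (y *: A).
Proof.
apply: mexp_eq => eps e0.
pose c := nr (1%:M : 'M[C]_n); pose s := nr A * cabs x; pose t := nr A * cabs y.
have c0 : 0 <= c by apply: nr_ge0.
pose e (r : R) N := \sum_(0 <= k < N) r ^+ k / k`!%:R.
have e2 : 0 < eps / 2 by rewrite divr_gt0.
have [N1 h1] := mcvgM (mexpP (x *: A)) (mexpP (y *: A)) e2.
have cv : (e s N * e t N - e (s + t) N) @[N --> \oo] --> (0 : R).
  rewrite -(subrr (expR (s + t))) {1}expRD.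
  by apply: cvgB; [apply: cvgM|]; apply: is_cvg_series_exp_coeff.
have e3 : 0 < eps / 2 / (c + 1) by rewrite divr_gt0 // ltr_wpDl.
have /cvgrPdist_le /(_ _ e3) [N2 _ h2] := cv.
exists (maxn N1 N2) => N; rewrite geq_max => /andP [/h1 k1 /h2 /= k2].
rewrite sub0r normrN in k2.
have k3 : nr (psum (x *: A) N *m psum (y *: A) N - psum ((x + y) *: A) N) <= eps / 2.
  apply: (@le_trans _ _ (c * `|e s N * e t N - e (s + t) N|)); last first.
    apply: (@le_trans _ _ ((c + 1) * (eps / 2 / (c + 1)))).
      by apply: ler_pM; rewrite ?normr_ge0 ?lerDl.
    by rewrite mulrC mulfVK // gt_eqF // ltr_wpDl.
  have -> : psum (x *: A) N *m psum (y *: A) N =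
     \sum_(0 <= i < N) \sum_(0 <= j < N) (x ^+ i / i`!%:R * (y ^+ j / j`!%:R)) *: A ^+ (i + j)%N.
    rewrite !psumZ mulmx_suml; apply: eq_bigr => i _; rewrite mulmx_sumr; apply: eq_bigr => j _.
    by rewrite -scalemxAl -scalemxAr scalerA exprD -mulmxE.
  rewrite psumZ exp_coeff_mul.
  have -> : e s N * e t N - e (s + t) N =
     \sum_(0 <= i < N) \sum_(N - i <= j < N) (s ^+ i / i`!%:R * (t ^+ j / j`!%:R)).
    have := @exp_coeff_mul R R^o (fun=> 1) s t N.
    under eq_bigr do under eq_bigr do rewrite -[_ *: _]/(_ * _) mulr1.
    under [X in _ - X]eq_bigr do rewrite -[_ *: _]/(_ * _) mulr1.
    under [RHS]eq_bigr do under eq_bigr do rewrite -[_ *: _]/(_ * _) mulr1.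
    move=> <-; rewrite /e mulr_suml; congr (_ - _); apply: eq_bigr => i _.
    by rewrite mulr_sumr.
  have pos : forall (r : R) k, 0 <= r -> 0 <= r ^+ k / k`!%:R.
    by move=> r k r0; rewrite divr_ge0 ?exprn_ge0.
  have s0 : 0 <= s by rewrite mulr_ge0 ?nr_ge0 ?cabs_ge0.
  have t0 : 0 <= t by rewrite mulr_ge0 ?nr_ge0 ?cabs_ge0.
  rewrite ger0_norm; last by do 2 (apply: sumr_ge0 => ? _); rewrite mulr_ge0 // pos.
  rewrite mulr_sumr; apply: le_trans (nr_sum _ _) _; apply: ler_sum => i _.
  rewrite mulr_sumr; apply: le_trans (nr_sum _ _) _; apply: ler_sum => j _.
  rewrite nrZ !cabsM !cabsV !cabs_nat !cabsX.
  have -> : c * (s ^+ i / i`!%:R * (t ^+ j / j`!%:R)) =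
     cabs x ^+ i / i`!%:R * (cabs y ^+ j / j`!%:R) * (c * nr A ^+ (i + j)).
    by rewrite /s /t !exprMn exprD; ring.
  by apply: ler_wpM2l; [rewrite mulr_ge0 // pos // cabs_ge0 | apply: nr_expr].
have -> : psum ((x + y) *: A) N - mexp (x *: A) *m mexp (y *: A) =
   (psum (x *: A) N *m psum (y *: A) N - mexp (x *: A) *m mexp (y *: A)) -
   (psum (x *: A) N *m psum (y *: A) N - psum ((x + y) *: A) N) by mxlin.
apply: le_trans (nrB _ _) _; lra.
Qed.

Lemma expmN n (A : 'M[C]_n) z : mexp (- z *: A) *m mexp (z *: A) = 1%:M.
Proof. by rewrite -expmD addNr scale0r expm0. Qed.

Lemma mcvg_dist_le m k (u : nat -> 'M[C]_(m, k)) l w b N1 :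
  mcvg u l -> (forall N, (N1 <= N)%N -> nr (u N - w) <= b) -> nr (l - w) <= b.
Proof.
move=> hu hb; apply/ler_addgt0Pr => e e0; have [N0 hN] := hu e e0.
have := hN (maxn N0 N1) (leq_maxl _ _); have := hb (maxn N0 N1) (leq_maxr _ _).
set v := u _ => h1 h2; have -> : l - w = (v - w) - (v - l) by mxlin.
apply: le_trans (nrB _ _) _; lra.
Qed.

(** Proved for partial sums with at least two terms and passed to the limit; it yields the
    derivative of the exponential at zero. *)
Lemma expm_second_order n (A : 'M[C]_n) h : cabs h <= 1 ->
  nr (mexp (h *: A) - 1%:M - h *: A) <= nr (1%:M : 'M[C]_n) * expR (nr A) * cabs h ^+ 2.
Proof.
move=> h1; rewrite -addrA -opprD.
apply: (@mcvg_dist_le _ _ _ _ _ _ 2 (mexpP (h *: A))) => -[//|[//|N]] _.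
set c := nr 1%:M.
have -> : psum (h *: A) N.+2 - (1%:M + h *: A) =
    \sum_(2 <= k < N.+2) (h ^+ k / k`!%:R) *: A ^+ k.
  have A0 : A ^+ 0 = 1%:M by rewrite expr0.
  rewrite psumZ big_ltn // big_ltn // A0 fact0 factS fact0 muln1 expr0 !expr1 !divr1 scale1r.
  by mxlin.
apply: le_trans (nr_sum _ _) _.
apply: (@le_trans _ _ (\sum_(2 <= k < N.+2) c * cabs h ^+ 2 * (nr A ^+ k / k`!%:R))).
  apply: ler_sum_nat => k /andP [k2 _].
  rewrite nrZ cabsM cabsX cabsV cabs_nat.
  have -> : c * cabs h ^+ 2 * (nr A ^+ k / k`!%:R) =
     cabs h ^+ 2 / k`!%:R * (c * nr A ^+ k) by ring.
  apply: ler_pM; rewrite ?nr_ge0 ?nr_expr //.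
    by rewrite divr_ge0 ?exprn_ge0 ?cabs_ge0.
  by rewrite ler_wpM2r ?invr_ge0 // ler_wiXn2l ?cabs_ge0.
rewrite -mulr_sumr mulrAC; apply: ler_wpM2r; first by rewrite exprn_ge0 ?cabs_ge0.
apply: ler_wpM2l; first exact: nr_ge0.
apply: le_trans (exp_series_le N.+2 (nr_ge0 A)).
rewrite [leRHS](@big_cat_nat _ _ _ 2) //= lerDr; apply: sumr_ge0 => k _.
by rewrite divr_ge0 ?exprn_ge0 ?nr_ge0.
Qed.

Lemma commutator_expm n (A D : 'M[C]_n) d z : D *m A - A *m D = d *: A ->
  D *m mexp (z *: A) - mexp (z *: A) *m D = (d * z) *: (A *m mexp (z *: A)).
Proof.
move=> hd.
have hX : D *m (z *: A) - (z *: A) *m D = d *: (z *: A).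
  by rewrite -scalemxAl -scalemxAr -scalerBr hd !scalerA mulrC.
have e : (d * z) *: (A *m mexp (z *: A)) = d *: ((z *: A) *m mexp (z *: A)).
  by rewrite -scalemxAl scalerA.
rewrite e; move: (z *: A) hX => X hX {e hd}.
(* The constant term commutes with [D] and the term of degree [k + 1] contributes a factor [k + 1],
   so [N + 1] terms here face [N] terms on the other side. *)
have c1 : mcvg (fun N => D *m psum X N.+1 + (-1) *: (psum X N.+1 *m D)) (D *m mexp X + (-1) *: (mexp X *m D)).
  apply: mcvgD.
    have := mcvg_shift (mcvg_mul D (1%:M) (mexpP X)); rewrite mulmx1.
    by apply: mcvg_ext => N; rewrite mulmx1.
  apply: mcvgZ.
  have := mcvg_shift (mcvg_mul (1%:M) D (mexpP X)); rewrite mul1mx.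
  by apply: mcvg_ext => N; rewrite mul1mx.
have c2 : mcvg (fun N => d *: (X *m psum X N)) (d *: (X *m mexp X)).
  apply: mcvgZ; have := mcvg_mul X (1%:M) (mexpP X); rewrite mulmx1.
  by apply: mcvg_ext => N; rewrite mulmx1.
rewrite -[X in _ + X]scaleN1r; apply: mcvg_unique c1 _.
apply: mcvg_ext c2 => N.
symmetry; rewrite scaleN1r /psum [D *m _]mulmx_sumr mulmx_suml -sumrB big_ord_recl /=.
rewrite expr0 -scalemxAl -scalemxAr mulmx1 mul1mx subrr add0r mulmx_sumr scaler_sumr.
apply: eq_bigr => k _; rewrite /bump /= add1n -scalemxAl -!scalemxAr -scalerBr.
rewrite (commutator_expr _ hX) exprS -mulmxE !scalerA; congr (_ *: _).
rewrite factS natrM.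
have h1 : k.+1%:R != 0 :> C by rewrite pnatr_eq0.
have h2 : k`!%:R != 0 :> C by rewrite pnatr_eq0 -lt0n fact_gt0.
by rewrite invfM mulrA [X in X * d]mulrAC mulVf // mul1r mulrC.
Qed.

End Exponential.

(** * Complex differentiable functions of one variable *)

Section OneVariable.
Variable R : realType.
Local Notation C := (complex R).
Local Notation cRe := (@complex.Re R).
Local Notation cIm := (@complex.Im R).
Local Notation ci := (Complex 0 1 : C).

Definition cder1 (f : C -> C) (z d : C) : Prop :=
  forall eps : R, 0 < eps -> exists2 delta : R, 0 < delta &
    forall h, cabs h < delta -> cabs (f (z + h) - f z - d * h) <= eps * cabs h.

Lemma ReB x y : cRe (x - y) = cRe x - cRe y.
Proof. by case: x y => [? ?] [? ?]. Qed.

Lemma ReD x y : cRe (x + y) = cRe x + cRe y.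
Proof. by case: x y => [? ?] [? ?]. Qed.

Lemma Re_mul_rC x t : cRe (x * rC t) = cRe x * t.
Proof. by case: x => a b /=; rewrite mulr0 subr0. Qed.

Lemma cabs_i : cabs ci = 1.
Proof. by rewrite cabsE_sqrt /= expr0n expr1n add0r sqrtr1. Qed.

Lemma Re_Ni_mul x : cRe (- ci * x) = cIm x.
Proof. by case: x => a b /=; ring. Qed.

Lemma complex_Re_eq (x y : C) : cRe x = cRe y -> cRe (- ci * x) = cRe (- ci * y) -> x = y.
Proof.
by rewrite !Re_Ni_mul; case: x y => [a b] [c d] /= -> ->.
Qed.

(** The mean value theorem needs a real-valued function; the free factor [q] selects any real
    functional of [f], and [e] any direction. *)
Lemma Re_MVT (f f' : C -> C) (q z0 e : C) (a b : R) : (forall z, cder1 f z (f' z)) -> a < b ->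
  exists2 c, a < c < b &
    cRe (q * f (z0 + rC b * e)) - cRe (q * f (z0 + rC a * e)) =
    cRe (q * (f' (z0 + rC c * e) * e)) * (b - a).
Proof.
move=> hf; apply: (@mean_value _ (fun t => cRe (q * f (z0 + rC t * e)))
   (fun t => cRe (q * (f' (z0 + rC t * e) * e)))) => x eps e0.
pose k := cabs q * cabs e + 1.
have k0 : 0 < k by rewrite ltr_wpDl // mulr_ge0 ?cabs_ge0.
have [d d0 hd] := hf (z0 + rC x * e) (eps / k) (divr_gt0 e0 k0).
have ke0 : 0 < cabs e + 1 by rewrite ltr_wpDl ?cabs_ge0.
exists (d / (cabs e + 1)); first by rewrite divr_gt0.
move=> h hh; have he : cabs (rC h * e) < d.
  rewrite cabsM cabs_rC; rewrite ltr_pdivlMr // mulrDr mulr1 in hh.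
  by apply: le_lt_trans hh; rewrite lerDl.
have := hd _ he; set y := f _ - _ - _ => hy.
have -> : cRe (q * f (z0 + rC (x + h) * e)) - cRe (q * f (z0 + rC x * e)) -
   cRe (q * (f' (z0 + rC x * e) * e)) * h = cRe (q * y).
  rewrite -Re_mul_rC -!ReB; congr cRe; rewrite /y rCD mulrDl addrA; ring.
apply: le_trans (normRe_le _) _; rewrite cabsM.
apply: (@le_trans _ _ (cabs q * (eps / k * cabs (rC h * e)))).
  by apply: ler_wpM2l; rewrite ?cabs_ge0.
rewrite cabsM cabs_rC.
have -> : cabs q * (eps / k * (`|h| * cabs e)) = (cabs q * cabs e / k) * (eps * `|h|) by ring.
rewrite -[leRHS]mul1r; apply: ler_wpM2r; first by rewrite mulr_ge0 // ltW.
by rewrite ler_pdivrMr // mul1r /k lerDl.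
Qed.

Lemma cder1_const (f : C -> C) : (forall z, cder1 f z 0) -> forall z, f z = f 0.
Proof.
move=> hf z.
have h q : cRe (q * f z) = cRe (q * f 0).
  have [c _] := @Re_MVT f (fun=> 0) q 0 z 0 1 hf ltr01.
  rewrite rC1 rC0 mul1r mul0r add0r addr0 mulr0 /= mul0r.
  by move/eqP; rewrite subr_eq0 => /eqP.
by apply: complex_Re_eq; rewrite // -[f z]mul1r -[f 0]mul1r.
Qed.

(** An increment along the conjugate of [d] makes [d h] real and as large as possible. *)
Lemma Re_const_der (f : C -> C) (z d : C) : cder1 f z d ->
  (forall h, cRe (f (z + h)) = cRe (f z)) -> d = 0.
Proof.
move=> hf hc; apply/eqP; rewrite -cabs_eq0 eq_le cabs_ge0 andbT.
apply/ler_addgt0Pr => e e0; rewrite add0r.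
have [/eqP ->|d0] := boolP (cabs d == 0); first exact: ltW.
have dp : 0 < cabs d by rewrite lt_def d0 cabs_ge0.
have [dl dl0 hd] := hf e e0.
pose t : R := dl / 2 / cabs d.
have t0 : 0 < t by rewrite /t; apply: divr_gt0 => //; apply: divr_gt0.
have ch : cabs (rC t * conjc d) = t * cabs d by rewrite cabsM cabs_rC cabs_conj gtr0_norm.
have hh : cabs (rC t * conjc d) < dl.
  by rewrite ch /t mulfVK // ltr_pdivrMr // mulr_natr mulr2n ltrDl.
have := le_trans (normRe_le _) (hd _ hh).
rewrite ReB ReB hc subrr add0r normrN ch.
have -> : d * (rC t * conjc d) = rC (t * cabs d ^+ 2).
  rewrite rCM rCX -cabsE sqr_normc; ring.
rewrite -[cRe (rC _)]/(t * cabs d ^+ 2) gtr0_norm; last by apply: mulr_gt0; rewrite ?exprn_gt0.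
have -> : t * cabs d ^+ 2 = cabs d * (t * cabs d) by ring.
by rewrite ler_pM2r //; apply: mulr_gt0.
Qed.

Lemma dirder_unique (f : C -> C) (q e z z' d d' : C) : cabs q = 1 -> cabs e = 1 ->
  cder1 f z d -> cder1 f z' d' ->
  (forall t, cRe (q * (f (z + rC t * e) - f z)) = cRe (q * (f (z' + rC t * e) - f z'))) ->
  cRe (q * (d * e)) = cRe (q * (d' * e)).
Proof.
move=> q1 e1 hd hd' h; apply/eqP; rewrite -subr_eq0 -normr_eq0 eq_le normr_ge0 andbT.
apply/ler_addgt0Pr => e' e0; rewrite add0r.
have e2 : 0 < e' / 2 by rewrite divr_gt0.
have [a a0 ha] := hd _ e2; have [b b0 hb] := hd' _ e2.
pose t := Num.min a b / 2.
have t0 : 0 < t by rewrite divr_gt0 // lt_min a0.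
have ct : cabs (rC t * e) = t by rewrite cabsM e1 mulr1 cabs_rC gtr0_norm.
have ta : cabs (rC t * e) < a.
  by rewrite ct /t ltr_pdivrMr // mulr_natr mulr2n (le_lt_trans _ (_ : a < _)) ?ge_min ?lexx // ltrDl.
have tb : cabs (rC t * e) < b.
  by rewrite ct /t ltr_pdivrMr // mulr_natr mulr2n (le_lt_trans _ (_ : b < _)) ?ge_min ?lexx ?orbT // ltrDl.
have := ha _ ta; have := hb _ tb; rewrite ct.
set x := f _ - f z' - _; set y := f _ - f z - _ => hx hy.
have qx := normRe_le (q * x); have qy := normRe_le (q * y).
rewrite !cabsM q1 !mul1r in qx qy.
have k : (cRe (q * (d * e)) - cRe (q * (d' * e))) * t = cRe (q * x) - cRe (q * y).
  rewrite mulrBl -!Re_mul_rC.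
  have -> : q * x = q * (f (z' + rC t * e) - f z') - q * (d' * e) * rC t by rewrite /x; ring.
  have -> : q * y = q * (f (z + rC t * e) - f z) - q * (d * e) * rC t by rewrite /y; ring.
  rewrite !ReB h; ring.
rewrite -(ler_pM2r t0) -{1}(gtr0_norm t0) -normrM k.
apply: le_trans (ler_normB _ _) _; lra.
Qed.

(** By the mean value theorem, [Re f] grows by [c t] along the real axis and [Im f] by [c t] along
    the imaginary axis. Translation in either direction thus changes one of these functions by a
    constant, which leaves its derivative in the other direction unchanged; that derivative is
    [Im f'] up to sign. *)
Lemma cder1_Re_const_affine (f f' : C -> C) (c : R) :
  (forall z, cder1 f z (f' z)) -> (forall z, cRe (f' z) = c) -> forall z, f' z = f' 0.
Proof.
move=> hf hc.
have reR z t : cRe (f (z + rC t * 1)) - cRe (f z) = c * t.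
  have key a b u : a < b -> cRe (f (u + rC b * 1)) - cRe (f (u + rC a * 1)) = c * (b - a).
    move=> ab; have [x _] := @Re_MVT f f' 1 u 1 a b hf ab.
    by rewrite !mul1r [f' _ * 1]mulr1 hc.
  have [t0|t0|<-] := ltgtP 0 t.
  - by have := key 0 t z t0; rewrite rC0 mul0r addr0 subr0.
  - have := key t 0 z t0; rewrite rC0 mul0r addr0 sub0r mulrN => /(congr1 -%R).
    by rewrite opprB opprK.
  by rewrite rC0 mul0r addr0 subrr mulr0.
have imI z t : cRe (- ci * f (z + rC t * ci)) - cRe (- ci * f z) = c * t.
  have key a b u : a < b -> cRe (- ci * f (u + rC b * ci)) - cRe (- ci * f (u + rC a * ci)) = c * (b - a).
    move=> ab; have [x _ ->] := @Re_MVT f f' (- ci) u ci a b hf ab.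
    congr (_ * _); rewrite -(hc (u + rC x * ci)); case: (f' _) => p r /=; ring.
  have [t0|t0|<-] := ltgtP 0 t.
  - by have := key 0 t z t0; rewrite rC0 mul0r addr0 subr0.
  - have := key t 0 z t0; rewrite rC0 mul0r addr0 sub0r mulrN => /(congr1 -%R).
    by rewrite opprB opprK.
  by rewrite rC0 mul0r addr0 subrr mulr0.
have ni1 : cabs (- ci) = 1 by rewrite cabsN cabs_i.
have A z y : cRe (- ci * f' (z + rC y * ci)) = cRe (- ci * f' z).
  rewrite -[f' (_ + _)]mulr1 -[f' z]mulr1.
  apply: (dirder_unique ni1 (cabs1 R) (hf _) (hf _)) => t.
  rewrite !mulrBr !ReB.
  have h1 := imI (z + rC t * 1) y; have h2 := imI z y.
  rewrite addrAC; lra.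
have B z x : cRe (- ci * f' (z + rC x * 1)) = cRe (- ci * f' z).
  have aux u : cRe (- ci * f' u) = - cRe (1 * (f' u * ci)) by case: (f' u) => p r /=; ring.
  rewrite !aux; congr (- _).
  apply: (dirder_unique (cabs1 R) cabs_i (hf _) (hf _)) => t.
  rewrite !mul1r !ReB.
  have h1 := reR (z + rC t * ci) x; have h2 := reR z x.
  rewrite addrAC; lra.
move=> z; apply: complex_Re_eq; first by rewrite !hc.
have -> : z = 0 + rC (cRe z) * 1 + rC (cIm z) * ci.
  by case: z => x y; apply/eqP; rewrite eq_complex /=; apply/andP; split; apply/eqP; ring.
by rewrite A B.
Qed.

Lemma cder1D f g z d e : cder1 f z d -> cder1 g z e -> cder1 (fun z => f z + g z) z (d + e).
Proof.
move=> hf hg eps e0; have e2 : 0 < eps / 2 by rewrite divr_gt0.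
have [a a0 ha] := hf _ e2; have [b b0 hb] := hg _ e2.
exists (Num.min a b); first by rewrite lt_min a0.
move=> h; rewrite lt_min => /andP [/ha h1 /hb h2].
have -> : f (z + h) + g (z + h) - (f z + g z) - (d + e) * h =
  (f (z + h) - f z - d * h) + (g (z + h) - g z - e * h) by ring.
apply: le_trans (cabsD _ _) _; lra.
Qed.

Lemma cder1_quadratic b c z : cder1 (fun z => b * z + c * z ^+ 2) z (b + 2 * c * z).
Proof.
move=> eps e0; have k0 : 0 < cabs c + 1 by rewrite ltr_wpDl ?cabs_ge0.
exists (eps / (cabs c + 1)); first by rewrite divr_gt0.
move=> h; rewrite ltr_pdivlMr // => hh.
have -> : b * (z + h) + c * (z + h) ^+ 2 - (b * z + c * z ^+ 2) - (b + 2 * c * z) * h =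
   c * h * h by ring.
rewrite !cabsM; apply: ler_wpM2r; first exact: cabs_ge0.
by move: (cabs_ge0 h); lra.
Qed.

(* Comparing the increments of [f] along the two sides of a small square shows that a complex
   derivative has no first-order antiholomorphic part. *)
Lemma cder1_antiholomorphic_part (f f' : C -> C) (b c k : C) :
  (forall z, cder1 f z (f' z)) ->
  (forall eps : R, 0 < eps -> exists2 delta : R, 0 < delta & forall z, cabs z < delta ->
     cabs (f' z - b - c * z - k * conjc z) <= eps * cabs z) ->
  k = 0.
Proof.
move=> hf hk; apply/eqP; apply/negPn/negP => k0.
have kp : 0 < cabs k by rewrite lt_def cabs_ge0 andbT cabs_eq0.
(* Subtracting a quadratic polynomial leaves a function whose derivative is [k conj(z)] to first
   order. *)
pose g z := f z + (- b * z + (- (c / 2)) * z ^+ 2).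
pose g' z := f' z + (- b + 2 * (- (c / 2)) * z).
have hg z : cder1 g z (g' z) by apply: cder1D (hf z) (cder1_quadratic _ _ _).
(* On the square of side [dl / 4] this tolerance keeps the error on each side, after division by
   [k], below a quarter of the side. *)
have [dl dl0 hd] := hk (cabs k / 8) (divr_gt0 kp (ltr0n _ 8)).
pose r z := k^-1 * g' z - conjc z.
have hr z : cabs z < dl -> cabs (r z) <= cabs z / 8.
  move=> /hd h; have -> : r z = k^-1 * (f' z - b - c * z - k * conjc z).
    by rewrite /r /g'; field.
  rewrite cabsM cabsV ler_pdivrMl //; move: h; lra.
pose t := dl / 4; have t0 : 0 < t by rewrite divr_gt0.
pose q := - ci * k^-1.
have c1 x : cabs (rC x * 1 : C) = `|x| by rewrite mulr1 cabs_rC.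
have c2 x : cabs (rC x * ci) = `|x| by rewrite cabsM cabs_i mulr1 cabs_rC.
have qg z e : q * (g' z * e) = - ci * (conjc z + r z) * e by rewrite /q /r; ring.
have hz x y : 0 <= x <= t -> 0 <= y <= t ->
    `|cRe (r (rC x * 1 + rC y * ci))| <= t / 4 /\ `|cRe (- ci * r (rC x * 1 + rC y * ci))| <= t / 4.
  move=> /andP [x0 xt] /andP [y0 yt].
  have n : cabs (rC x * 1 + rC y * ci) <= 2 * t.
    by apply: le_trans (cabsD _ _) _; rewrite c1 c2 !ger0_norm //; lra.
  have l : cabs (rC x * 1 + rC y * ci) < dl by apply: le_lt_trans n _; rewrite /t; lra.
  have := hr _ l => m; split; apply: le_trans (normRe_le _) _;
    rewrite ?cabsM ?cabsN ?cabs_i ?mul1r; lra.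
have tt : 0 <= t <= t by rewrite (ltW t0) lexx.
have z0 : (0 : R) <= 0 <= t by rewrite lexx ltW.
have [x1 /andP [x1a x1b] e1] := @Re_MVT g g' q 0 1 0 t hg t0.
have [x2 /andP [x2a x2b] e2] := @Re_MVT g g' q (rC t * 1) ci 0 t hg t0.
have [x3 /andP [x3a x3b] e3] := @Re_MVT g g' q 0 ci 0 t hg t0.
have [x4 /andP [x4a x4b] e4] := @Re_MVT g g' q (rC t * ci) 1 0 t hg t0.
have x1i : 0 <= x1 <= t by rewrite !ltW.
have x2i : 0 <= x2 <= t by rewrite !ltW.
have x3i : 0 <= x3 <= t by rewrite !ltW.
have x4i : 0 <= x4 <= t by rewrite !ltW.
move: e1 e2 e3 e4; rewrite !qg.
have rC0' : rC (0 : R) = 0 := rC0 R.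
have p1 : 0 + rC x1 * 1 = rC x1 * 1 + rC 0 * ci by rewrite rC0' mul0r addr0 add0r.
have p3 : 0 + rC x3 * ci = rC 0 * 1 + rC x3 * ci by rewrite rC0' mul0r.
have p4 : rC t * ci + rC x4 * 1 = rC x4 * 1 + rC t * ci by rewrite addrC.
rewrite p1 p3 p4.
have [h1a h1b] := hz x1 0 x1i z0; have [h2a h2b] := hz t x2 tt x2i.
have [h3a h3b] := hz 0 x3 z0 x3i; have [h4a h4b] := hz x4 t x4i tt.
have E1 x y : cRe (- ci * (conjc (rC x * 1 + rC y * ci) + r (rC x * 1 + rC y * ci)) * 1) =
    - y + cRe (- ci * r (rC x * 1 + rC y * ci)).
  by case: (r _) => p s /=; ring.
have E2 x y : cRe (- ci * (conjc (rC x * 1 + rC y * ci) + r (rC x * 1 + rC y * ci)) * ci) =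
    x + cRe (r (rC x * 1 + rC y * ci)).
  by case: (r _) => p s /=; ring.
rewrite !E1 !E2 rC0' !mul0r !addr0 !add0r subr0.
rewrite [rC t * ci + rC t * 1]addrC.
rewrite rC0' mul0r addr0 in h1b; rewrite rC0' mul0r add0r in h3a.
move: h1b h2a h3a h4b; rewrite !ler_norml.
move=> /andP [a1 b1] /andP [a2 b2] /andP [a3 b3] /andP [a4 b4] e1 e2 e3 e4.
(* The two paths between opposite corners differ by [2 t^2] plus four errors of size at most
   [t^2 / 4], yet have the same endpoints. *)
have := t0; rewrite -(pmulr_rgt0 _ t0); nra.
Qed.

End OneVariable.

(** * A common calculus of differentials for real, complex and vector increments *)

Section Differentials.
Import sequences exp.
Variable R : realType.
Local Notation C := (complex R).

(* [f h] is the value at base point + [h], [f0] the value at the base point, [L] the differential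
   and [s] the size of the increment, which may be a real number, a complex number or a vector. *)
Definition adiff (T : Type) (s : T -> R) m k (f : T -> 'M[C]_(m, k)) f0 (L : T -> 'M[C]_(m, k)) :=
  (exists2 c : R, 0 <= c & forall h, nr (L h) <= c * s h) /\
  forall eps : R, 0 < eps -> exists2 delta : R, 0 < delta &
    forall h, s h < delta -> nr (f h - f0 - L h) <= eps * s h.

Section Rules.
Variables (T : Type) (s : T -> R).
Hypothesis s_ge0 : forall h, 0 <= s h.

Lemma adiff_ext m k (f g : T -> 'M[C]_(m, k)) f0 g0 L M :
  f =1 g -> f0 = g0 -> L =1 M -> adiff s f f0 L -> adiff s g g0 M.
Proof.
move=> fg -> LM [[c c0 hc] h]; split; first by exists c => // x; rewrite -LM.
by move=> e /h [d d0 hd]; exists d => // x /hd; rewrite fg LM.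
Qed.

Lemma adiff_const m k (a : 'M[C]_(m, k)) : adiff s (fun=> a) a (fun=> 0).
Proof.
split; first by exists 0 => // h; rewrite nr0 mul0r.
by move=> e e0; exists 1 => // h _; rewrite subrr subr0 nr0 mulr_ge0 // ltW.
Qed.

Lemma adiff_lipschitz m k (f : T -> 'M[C]_(m, k)) f0 L : adiff s f f0 L ->
  exists2 c : R, 0 <= c & exists2 delta : R, 0 < delta & forall h, s h < delta -> nr (f h - f0) <= c * s h.
Proof.
move=> [[c c0 hc] h]; have [d d0 hd] := h 1 ltr01.
exists (c + 1); first by rewrite addr_ge0.
exists d => // x /hd hx; have -> : f x - f0 = (f x - f0 - L x) + L x by rewrite subrK.
by apply: le_trans (nrD _ _) _; rewrite mulrDl addrC lerD.
Qed.

Lemma adiffD m k (f g : T -> 'M[C]_(m, k)) f0 g0 L M :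
  adiff s f f0 L -> adiff s g g0 M -> adiff s (fun h => f h + g h) (f0 + g0) (fun h => L h + M h).
Proof.
move=> [[c c0 hc] hf] [[d d0 hd] hg]; split.
  exists (c + d); first by rewrite addr_ge0.
  by move=> h; apply: le_trans (nrD _ _) _; rewrite mulrDl lerD.
move=> e e0; have e2 : 0 < e / 2 by rewrite divr_gt0.
have [a a0 ha] := hf _ e2; have [b b0 hb] := hg _ e2.
exists (Num.min a b); first by rewrite lt_min a0.
move=> h; rewrite lt_min => /andP [/ha h1 /hb h2].
have -> : f h + g h - (f0 + g0) - (L h + M h) = (f h - f0 - L h) + (g h - g0 - M h) by mxlin.
apply: le_trans (nrD _ _) _; lra.
Qed.

Lemma adiff_map m k m' k' (f : T -> 'M[C]_(m, k)) f0 L (phi : 'M[C]_(m, k) -> 'M[C]_(m', k')) (c : R) :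
  0 <= c -> (forall x, nr (phi x) <= c * nr x) ->
  (forall x y, phi (x - y) = phi x - phi y) ->
  adiff s f f0 L -> adiff s (fun h => phi (f h)) (phi f0) (fun h => phi (L h)).
Proof.
move=> c0 hc hB [[d d0 hd] hf]; split.
  exists (c * d); first by rewrite mulr_ge0.
  move=> h; apply: le_trans (hc _) _; rewrite -mulrA; exact: ler_wpM2l.
have c1 : 0 < c + 1 by rewrite ltr_wpDl.
move=> e e0; have [a a0 ha] := hf (e / (c + 1)) (divr_gt0 e0 c1).
exists a => // h /ha h1; rewrite -!hB; apply: le_trans (hc _) _.
apply: (@le_trans _ _ (c * (e / (c + 1) * s h))); first exact: ler_wpM2l.
have -> : c * (e / (c + 1) * s h) = (c / (c + 1)) * (e * s h) by ring.
rewrite -[leRHS]mul1r; apply: ler_wpM2r; first by rewrite mulr_ge0 // ltW.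
by rewrite ler_pdivrMr // mul1r lerDl.
Qed.

Lemma adiff_tr m k (f : T -> 'M[C]_(m, k)) f0 L : adiff s f f0 L ->
  adiff s (fun h => (f h)^T) (f0^T) (fun h => (L h)^T).
Proof.
by apply: (@adiff_map _ _ _ _ _ _ _ _ 1) => // x; rewrite ?nr_tr ?mul1r // => y; rewrite linearB.
Qed.

Lemma adiff_cmx m k (f : T -> 'M[C]_(m, k)) f0 L : adiff s f f0 L ->
  adiff s (fun h => cmx (f h)) (cmx f0) (fun h => cmx (L h)).
Proof.
apply: (@adiff_map _ _ _ _ _ _ _ _ 1) => // x; rewrite ?nr_cmx ?mul1r // => y.
by rewrite /cmx map_mxB.
Qed.

Lemma adiff_mull m k l (A : 'M[C]_(l, m)) (f : T -> 'M[C]_(m, k)) f0 L : adiff s f f0 L ->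
  adiff s (fun h => A *m f h) (A *m f0) (fun h => A *m L h).
Proof.
apply: (@adiff_map _ _ _ _ _ _ _ _ (nr A)); first exact: nr_ge0.
  by move=> x; apply: nr_mul.
by move=> x y; rewrite mulmxBr.
Qed.

Lemma adiff_mulr m k l (A : 'M[C]_(k, l)) (f : T -> 'M[C]_(m, k)) f0 L : adiff s f f0 L ->
  adiff s (fun h => f h *m A) (f0 *m A) (fun h => L h *m A).
Proof.
apply: (@adiff_map _ _ _ _ _ _ _ (fun x => x *m A) (nr A)); first exact: nr_ge0.
  by move=> x; rewrite mulrC; apply: nr_mul.
by move=> x y; rewrite mulmxBl.
Qed.

Lemma adiffM m k l (f : T -> 'M[C]_(m, k)) (g : T -> 'M[C]_(k, l)) f0 g0 L M :
  adiff s f f0 L -> adiff s g g0 M ->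
  adiff s (fun h => f h *m g h) (f0 *m g0) (fun h => L h *m g0 + f0 *m M h).
Proof.
move=> Df Dg; have [[c c0 hc] hf] := Df; have [[d d0 hd] hg] := Dg; split.
  exists (c * nr g0 + nr f0 * d); first by rewrite addr_ge0 ?mulr_ge0 ?nr_ge0.
  move=> h; apply: le_trans (nrD _ _) _; rewrite mulrDl; apply: lerD.
    apply: le_trans (nr_mul _ _) _; rewrite mulrAC; apply: ler_wpM2r => //; exact: nr_ge0.
  apply: le_trans (nr_mul _ _) _; rewrite -mulrA; apply: ler_wpM2l => //; exact: nr_ge0.
have [u u0 [a a0 ha]] := adiff_lipschitz Df; have [v v0 [b b0 hb]] := adiff_lipschitz Dg.
move=> e e0; pose w := nr f0 + nr g0 + u * v + 1.
have w0 : 0 < w by rewrite ltr_wpDl // !addr_ge0 ?nr_ge0 ?mulr_ge0.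
have ew : 0 < e / w by rewrite divr_gt0.
have [a' a'0 ha'] := hf _ ew; have [b' b'0 hb'] := hg _ ew.
exists (Num.min (Num.min a b) (Num.min (Num.min a' b') (e / w))); first by rewrite !lt_min a0 b0 a'0 b'0.
move=> h; rewrite !lt_min => /andP [/andP [/ha h1 /hb h2] /andP [/andP [/ha' h3 /hb' h4] h5]].
have -> : f h *m g h - f0 *m g0 - (L h *m g0 + f0 *m M h) =
  (f h - f0 - L h) *m g0 + f0 *m (g h - g0 - M h) + (f h - f0) *m (g h - g0).
  by rewrite !mulmxBl !mulmxBr; mxlin.
have sh := s_ge0 h.
have k1 : nr ((f h - f0 - L h) *m g0) <= e / w * s h * nr g0.
  by apply: le_trans (nr_mul _ _) _; apply: ler_wpM2r => //; apply: nr_ge0.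
have k2 : nr (f0 *m (g h - g0 - M h)) <= nr f0 * (e / w * s h).
  by apply: le_trans (nr_mul _ _) _; apply: ler_wpM2l => //; apply: nr_ge0.
have k3 : nr ((f h - f0) *m (g h - g0)) <= (u * s h) * (v * (e / w)).
  apply: le_trans (nr_mul _ _) _; apply: ler_pM; rewrite ?nr_ge0 //.
  by apply: le_trans h2 _; apply: ler_wpM2l => //; apply: ltW.
apply: le_trans (nrD _ _) _; apply: (@le_trans _ _ (e / w * s h * nr g0 + nr f0 * (e / w * s h) + (u * s h) * (v * (e / w)))).
  by apply: lerD => //; apply: le_trans (nrD _ _) _; apply: lerD.
have -> : e / w * s h * nr g0 + nr f0 * (e / w * s h) + (u * s h) * (v * (e / w)) =
   (w - 1) / w * (e * s h) by rewrite /w; field; rewrite gt_eqF.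
rewrite -[leRHS]mul1r; apply: ler_wpM2r; first by rewrite mulr_ge0 // ltW.
by rewrite ler_pdivrMr // mul1r gerDl oppr_le0 ler01.
Qed.

(** [L] and [M] are not assumed linear, so they are compared along a dyadic sequence of increments
    on which [L - M] is a known multiple of [D]. The freedom in [h] covers real and imaginary
    increments alike. *)
Lemma adiff_unique m k (f : T -> 'M[C]_(m, k)) f0 L M (h : nat -> T) (t : R) (D : 'M[C]_(m, k)) :
  adiff s f f0 L -> adiff s f f0 M -> 0 < t ->
  (forall i, s (h i) = t / 2 ^+ i) ->
  (forall i, L (h i) - M (h i) = rC (1 / 2 ^+ i) *: D) -> D = 0.
Proof.
move=> [_ hf] [_ hg] t0 hs hD; apply: nr_eq0_eps => e e0.
have p2 i : 0 < 2 ^+ i :> R by rewrite exprn_gt0.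
have e2 : 0 < e / (2 * t) by rewrite divr_gt0 // mulr_gt0.
have [a a0 ha] := hf _ e2; have [b b0 hb] := hg _ e2.
pose d := Num.min a b; have d0 : 0 < d by rewrite lt_min a0.
have [i hi] : exists i : nat, t / d < 2 ^+ i.
  exists (Num.bound (t / d)).
  apply: lt_le_trans (archi_boundP (ltW (divr_gt0 t0 d0))) _.
  by rewrite -natrX ler_nat ltnW // ltn_expl.
have sd : s (h i) < d.
  by rewrite hs ltr_pdivrMr // mulrC -ltr_pdivrMr.
move: sd; rewrite lt_min => /andP [/ha h1 /hb h2].
have h3 : nr (L (h i) - M (h i)) <= 2 * (e / (2 * t) * s (h i)).
  have -> : L (h i) - M (h i) = (f (h i) - f0 - M (h i)) - (f (h i) - f0 - L (h i)) by mxlin.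
  apply: le_trans (nrB _ _) _; lra.
move: h3; rewrite hD nrZ cabs_rC hs gtr0_norm ?divr_gt0 //.
have -> : 2 * (e / (2 * t) * (t / 2 ^+ i)) = (1 / 2 ^+ i) * e by field; rewrite !gt_eqF.
by rewrite ler_pM2l // divr_gt0.
Qed.

End Rules.

Lemma adiff_comp (T : Type) (s : T -> R) m k p q (f : T -> 'M[C]_(m, k)) f0 L
   (g : 'M[C]_(m, k) -> 'M[C]_(p, q)) M :
  (forall h, 0 <= s h) ->
  adiff s f f0 L -> adiff (@nr R m k) (fun h => g (f0 + h)) (g f0) M ->
  (forall x y, M (x - y) = M x - M y) ->
  adiff s (fun h => g (f h)) (g f0) (fun h => M (L h)).
Proof.
move=> s0 Df [[d d0 hd] hg] MB; have [[c c0 hc] hf] := Df; split.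
  exists (d * c); first by rewrite mulr_ge0.
  by move=> h; apply: le_trans (hd _) _; rewrite -mulrA; apply: ler_wpM2l.
have [u u0 [a a0 ha]] := adiff_lipschitz Df.
move=> e e0; have e2 : 0 < e / 2 by rewrite divr_gt0.
have u1 : 0 < u + 1 by rewrite ltr_wpDl.
have d1 : 0 < d + 1 by rewrite ltr_wpDl.
have [b b0 hb] := hg _ (divr_gt0 e2 u1); have [b' b'0 hb'] := hf _ (divr_gt0 e2 d1).
exists (Num.min (Num.min a b') (b / (u + 1))); first by rewrite !lt_min a0 b'0 divr_gt0.
move=> h; rewrite !lt_min => /andP [/andP [/ha h1 /hb' h2] h3].
have sh := s0 h.
have us : u * s h <= (u + 1) * s h by apply: ler_wpM2r => //; rewrite lerDl.
have h4 : nr (f h - f0) < b.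
  apply: le_lt_trans h1 _; apply: le_lt_trans us _.
  by rewrite mulrC -ltr_pdivlMr.
have h5 := hb _ h4; rewrite [f0 + _]addrC subrK in h5.
have -> : g (f h) - g f0 - M (L h) =
  (g (f h) - g f0 - M (f h - f0)) + M (f h - f0 - L h) by rewrite (MB (f h - f0) (L h)); mxlin.
apply: le_trans (nrD _ _) _.
have h6 : nr (M (f h - f0 - L h)) <= e / 2 * s h.
  apply: le_trans (hd _) _; apply: (@le_trans _ _ ((d + 1) * (e / 2 / (d + 1) * s h))).
    by apply: ler_pM; rewrite ?nr_ge0 // lerDl.
  by rewrite mulrA [_ * (_ / _)]mulrC mulfVK // gt_eqF.
have h7 : nr (g (f h) - g f0 - M (f h - f0)) <= e / 2 * s h.
  apply: le_trans h5 _; apply: (@le_trans _ _ (e / 2 / (u + 1) * ((u + 1) * s h))).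
    apply: ler_wpM2l; first by rewrite ltW // divr_gt0.
    exact: le_trans h1 us.
  by rewrite mulrA mulfVK // gt_eqF.
lra.
Qed.

Definition fder m k (F : 'cV[C]_m -> 'cV[C]_k) (p : 'cV[C]_m) (D : 'M[C]_(k, m)) : Prop :=
  adiff (@nr R m 1) (fun h => F (p + h)) (F p) (fun h => D *m h).

Definition cder m k (f : C -> 'M[C]_(m, k)) (z : C) (D : 'M[C]_(m, k)) : Prop :=
  adiff (@cabs R) (fun h => f (z + h)) (f z) (fun h => h *: D).

Lemma fderP m (F : 'cV[C]_m -> 'cV[C]_m) DF :
  holo_with F DF <-> forall p, fder F p (DF p).
Proof.
split=> [h p|h p e e0].
  split; first by exists (nr (DF p)); [apply: nr_ge0 | move=> x; apply: nr_mul].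
  move=> e e0; have [d [d0 hd]] := h p e e0; exists d => // x xd.
  by have := hd x; rewrite !vnormE lt_rC -rCM le_rC; apply.
have [_ /(_ e e0) [d d0 hd]] := h p; exists d; split=> // x.
by rewrite !vnormE lt_rC -rCM le_rC => /hd.
Qed.

Lemma fder_linear m k (A : 'M[C]_(k, m)) p : fder (fun p => A *m p) p A.
Proof.
split; first by exists (nr A); [apply: nr_ge0 | move=> x; apply: nr_mul].
move=> e e0; exists 1 => // h _; rewrite mulmxDr [A *m p + _]addrC addrK subrr nr0.
by rewrite mulr_ge0 ?nr_ge0 // ltW.
Qed.

Lemma fder_comp m k l (F : 'cV[C]_m -> 'cV[C]_k) (G : 'cV[C]_k -> 'cV[C]_l) p D E :
  fder F p D -> fder G (F p) E -> fder (fun p => G (F p)) p (E *m D).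
Proof.
move=> hF hG; have := adiff_comp (@nr_ge0 R m 1) hF hG (fun x y => mulmxBr E x y).
by apply: adiff_ext => // h; rewrite mulmxA.
Qed.

Lemma fder_line m k (F : 'cV[C]_m -> 'cV[C]_k) p v t D :
  fder F (p + t *: v) D -> cder (fun t => F (p + t *: v)) t (D *m v).
Proof.
move=> hF.
have hl : adiff (@cabs R) (fun h => p + (t + h) *: v) (p + t *: v) (fun h => h *: v).
  split; first by exists (nr v); [apply: nr_ge0 | move=> h; rewrite nrZ mulrC].
  move=> e e0; exists 1 => // h _; rewrite scalerDl addrA [_ + h *: v]addrC addrK subrr nr0.
  by rewrite mulr_ge0 ?cabs_ge0 // ltW.
have := adiff_comp (@cabs_ge0 R) hl hF (fun x y => mulmxBr D x y).
by apply: adiff_ext => // h; rewrite -scalemxAr.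
Qed.

Lemma cder_entry m k (f : C -> 'M[C]_(m, k)) z D i j :
  cder f z D -> cder1 (fun z => f z i j) z (D i j).
Proof.
move=> [_ h] e e0; have [d d0 hd] := h e e0; exists d => // x /hd.
by apply: le_trans; have := nr_entry (f (z + x) - f z - x *: D) i j;
  rewrite !(mxDE, mxNE, mxZE) mulrC.
Qed.

Lemma cder_const m k (f : C -> 'M[C]_(m, k)) : (forall z, cder f z 0) -> forall z, f z = f 0.
Proof.
move=> h z; apply/matrixP => i j; apply: (@cder1_const _ (fun z => f z i j)) => y.
by have := cder_entry i j (h y); rewrite mxE.
Qed.

Lemma cder_unique m k (f : C -> 'M[C]_(m, k)) z D E : cder f z D -> cder f z E -> D = E.
Proof.
move=> h h'; apply/eqP; rewrite -subr_eq0; apply/eqP.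
refine (@adiff_unique _ _ _ _ _ _ _ _ (fun i => rC (1 / 2 ^+ i)) 1 (D - E) h h' ltr01 _ _) => i.
  by rewrite cabs_rC ger0_norm // divr_ge0 // exprn_ge0.
by rewrite scalerBr.
Qed.

Lemma cderD m k (f g : C -> 'M[C]_(m, k)) z D E : cder f z D -> cder g z E ->
  cder (fun z => f z + g z) z (D + E).
Proof.
by move=> h h'; have := adiffD h h'; apply: adiff_ext => // x; rewrite scalerDr.
Qed.

Lemma cder_mull m k l (A : 'M[C]_(l, m)) (f : C -> 'M[C]_(m, k)) z D : cder f z D ->
  cder (fun z => A *m f z) z (A *m D).
Proof.
move=> h; have := adiff_mull (@cabs_ge0 R) A h.
by apply: adiff_ext => // x; rewrite scalemxAr.
Qed.

Lemma cder_mulr m k l (A : 'M[C]_(k, l)) (f : C -> 'M[C]_(m, k)) z D : cder f z D ->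
  cder (fun z => f z *m A) z (D *m A).
Proof.
move=> h; have := adiff_mulr (@cabs_ge0 R) A h.
by apply: adiff_ext => // x; rewrite scalemxAl.
Qed.

Lemma cder_expm n (A : 'M[C]_n) z : cder (fun z => mexp (z *: A)) z (A *m mexp (z *: A)).
Proof.
have h0 : adiff (@cabs R) (fun h => mexp (h *: A)) 1%:M (fun h => h *: A).
  split; first by exists (nr A); [apply: nr_ge0 | move=> h; rewrite nrZ mulrC].
  move=> e e0; pose c := nr (1%:M : 'M[C]_n) * expR (nr A).
  have c0 : 0 <= c by rewrite mulr_ge0 ?nr_ge0 ?expR_ge0.
  have c1 : 0 < c + 1 by rewrite ltr_wpDl.
  exists (Num.min 1 (e / (c + 1))); first by rewrite lt_min ltr01 divr_gt0.
  move=> h; rewrite lt_min => /andP [/ltW h1 h2].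
  apply: le_trans (expm_second_order A h1) _; rewrite -/c expr2 mulrA.
  apply: ler_wpM2r; first exact: cabs_ge0.
  move: h2; rewrite ltr_pdivlMr // mulrDr mulr1 => h2.
  by rewrite mulrC; apply: le_trans (ltW h2); rewrite lerDl cabs_ge0.
have := adiff_mulr (@cabs_ge0 R) (mexp (z *: A)) h0.
apply: adiff_ext => [h||h].
- by rewrite [z + h]addrC expmD.
- by rewrite mul1mx.
by rewrite scalemxAl.
Qed.

End Differentials.

Ltac blks := rewrite ?(mul0mx, mulmx0, mx0E, scaler0, scale0r, addr0, add0r, mulr1, mul1r,
  mulr0, mul0r, scale1r, mulmx1, mul1mx, oppr0, subr0, trmx0, trmx1).

(** * Block matrices adapted to [Z_0] and the abelian ideal *)

Section Blocks.
Variable R : realType.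
Local Notation C := (complex R).

(** The conversion between [n.+1] and [1 + n] is made once, behind a lock. *)
Definition blk n (a : C) (r : 'rV[C]_n) (c : 'cV[C]_n) (B : 'M[C]_n) : 'M[C]_n.+1 :=
  locked (block_mx (a%:M) r c B : 'M_(1 + n)).

Definition vec n (z : C) (w : 'cV[C]_n) : 'cV[C]_n.+1 :=
  locked (col_mx (z%:M) w : 'M_(1 + n, 1)).
Local Ltac unlk := rewrite /blk /vec -?lock.

Definition pz n (p : 'cV[C]_n.+1) : C := p ord0 0.
Definition pw n (p : 'cV[C]_n.+1) : 'cV[C]_n := @dsubmx C 1 n 1 p.

Lemma mx11 (M : 'M[C]_1) : M = (M 0 0)%:M.
Proof. exact: mx11_scalar. Qed.

Lemma pz_vec n z (w : 'cV[C]_n) : pz (vec z w) = z.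
Proof.
unlk.
rewrite /pz; have -> : (ord0 : 'I_n.+1) = lshift n (0 : 'I_1) by apply/val_inj.
by rewrite (@col_mxEu _ 1 n) mxE eqxx mulr1n.
Qed.

Lemma pw_vec n z (w : 'cV[C]_n) : pw (vec z w) = w.
Proof.
unlk. exact: col_mxKd. Qed.

Lemma vecE n (p : 'cV[C]_n.+1) : p = vec (pz p) (pw p).
Proof.
unlk.
apply: etrans (esym (@vsubmxK C 1 n 1 p)) _; congr (@col_mx _ 1 n 1 _ _).
by rewrite [LHS]mx11 mxE; congr (p _ _)%:M; apply/val_inj.
Qed.

Lemma vecD n z z' (w w' : 'cV[C]_n) : vec z w + vec z' w' = vec (z + z') (w + w').
Proof.
unlk.
change (col_mx z%:M w + col_mx z'%:M w' = col_mx (z + z')%:M (w + w')).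
by rewrite add_col_mx raddfD.
Qed.

Lemma vecZ n a z (w : 'cV[C]_n) : a *: vec z w = vec (a * z) (a *: w).
Proof.
unlk.
change (a *: col_mx z%:M w = col_mx (a * z)%:M (a *: w)).
by rewrite scale_col_mx scale_scalar_mx.
Qed.

Lemma vec0 n : vec 0 (0 : 'cV[C]_n) = 0.
Proof.
unlk. by rewrite raddf0; apply: (@col_mx0 C 1 n 1). Qed.

Lemma pzD n (p q : 'cV[C]_n.+1) : pz (p + q) = pz p + pz q.
Proof. by rewrite /pz mxE. Qed.

Lemma pzZ n a (p : 'cV[C]_n.+1) : pz (a *: p) = a * pz p.
Proof. by rewrite /pz mxE. Qed.

Lemma pwZ n a (p : 'cV[C]_n.+1) : pw (a *: p) = a *: pw p.
Proof. by rewrite /pw linearZ. Qed.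

Lemma blkM n a r c B a' r' c' B' :
  @blk n a r c B *m blk a' r' c' B' =
  blk (a * a' + (r *m c') 0 0) (a *: r' + r *m B') (a' *: c + B *m c') (c *m r' + B *m B').
Proof.
unlk.
change (block_mx a%:M r c B *m block_mx a'%:M r' c' B' =
  block_mx (a * a' + (r *m c') 0 0)%:M (a *: r' + r *m B') (a' *: c + B *m c') (c *m r' + B *m B')).
rewrite mulmx_block; congr block_mx; rewrite ?mul_scalar_mx ?mul_mx_scalar //.
by rewrite raddfD /= -mx11 scale_scalar_mx.
Qed.

Lemma blk_mul_vec n a r c B z w :
  @blk n a r c B *m vec z w = vec (a * z + (r *m w) 0 0) (z *: c + B *m w).
Proof.
unlk.
change (block_mx a%:M r c B *m col_mx z%:M w =
  col_mx (a * z + (r *m w) 0 0)%:M (z *: c + B *m w)).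
rewrite mul_block_col; congr col_mx; rewrite ?mul_mx_scalar //.
by rewrite raddfD /= -mx11 scale_scalar_mx mulrC.
Qed.

Lemma blk_inj n a r c B a' r' c' B' : @blk n a r c B = blk a' r' c' B' ->
  [/\ a = a', r = r', c = c' & B = B'].
Proof.
unlk => e; have [h -> -> ->] := @eq_block_mx C 1 n 1 n _ _ _ _ _ _ _ _ e; split=> //.
by have /matrixP /(_ 0 0) := h; rewrite !mxE !mulr1n.
Qed.

Lemma blkD n a r c B a' r' c' B' :
  @blk n a r c B + blk a' r' c' B' = blk (a + a') (r + r') (c + c') (B + B').
Proof.
unlk.
change (block_mx a%:M r c B + block_mx a'%:M r' c' B' =
  block_mx (a + a')%:M (r + r') (c + c') (B + B')).
by rewrite add_block_mx raddfD.
Qed.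

Lemma blkZ n k a r c B : k *: @blk n a r c B = blk (k * a) (k *: r) (k *: c) (k *: B).
Proof.
unlk.
change (k *: block_mx a%:M r c B = block_mx (k * a)%:M (k *: r) (k *: c) (k *: B)).
by rewrite scale_block_mx scale_scalar_mx.
Qed.

Lemma blkN n a r c B : - @blk n a r c B = blk (- a) (- r) (- c) (- B).
Proof. by rewrite -scaleN1r blkZ !scaleN1r mulN1r. Qed.

Lemma blk_tr n a r c B : (@blk n a r c B)^T = blk a c^T r^T B^T.
Proof.
unlk.
change ((block_mx a%:M r c B)^T = block_mx a%:M c^T r^T B^T).
by rewrite tr_block_mx tr_scalar_mx.
Qed.

Lemma blk_cmx n a r c B : cmx (@blk n a r c B) = blk (conjc a) (cmx r) (cmx c) (cmx B).
Proof.
unlk.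
change (map_mx (@conjc R) (block_mx a%:M r c B) = block_mx (conjc a)%:M (cmx r) (cmx c) (cmx B)).
by rewrite map_block_mx map_scalar_mx.
Qed.

Lemma blk1 n : @blk n 1 0 0 1%:M = 1%:M.
Proof.
unlk. by apply: esym; apply: (@scalar_mx_block C 1 n 1). Qed.

Lemma cmxM m k l (A : 'M[C]_(m, k)) (B : 'M[C]_(k, l)) : cmx (A *m B) = cmx A *m cmx B.
Proof. exact: map_mxM. Qed.
Lemma cmxD m k (A B : 'M[C]_(m, k)) : cmx (A + B) = cmx A + cmx B.
Proof. exact: map_mxD. Qed.
Lemma cmxN m k (A : 'M[C]_(m, k)) : cmx (- A) = - cmx A.
Proof. exact: map_mxN. Qed.
Lemma cmxZ m k a (A : 'M[C]_(m, k)) : cmx (a *: A) = conjc a *: cmx A.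
Proof. exact: map_mxZ. Qed.
Lemma cmx1 m : cmx (1%:M : 'M[C]_m) = 1%:M.
Proof. exact: map_mx1. Qed.
Lemma cmx0 m k : cmx (0 : 'M[C]_(m, k)) = 0.
Proof. exact: map_mx0. Qed.
Lemma cmxK m k (A : 'M[C]_(m, k)) : cmx (cmx A) = A.
Proof. by apply/matrixP => i j; rewrite !mxE conjcK. Qed.
Lemma cmx_tr m k (A : 'M[C]_(m, k)) : cmx A^T = (cmx A)^T.
Proof. by rewrite /cmx map_trmx. Qed.

Lemma dLE n (A : 'M[C]_n) p : dL A p = blk 1 0 0 (mexp (pz p *: A)).
Proof.
apply/matrixP => i j; unlk; rewrite mxE.
have l0 : (ord0 : 'I_n.+1) = lshift n (0 : 'I_1) by apply/val_inj.
have lr (k : 'I_n) : lift ord0 k = rshift 1 k by apply/val_inj.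
case: (unliftP ord0 i) => [i' ->|->]; case: (unliftP ord0 j) => [j' ->|->].
- by rewrite !lr (@block_mxEdr _ 1 n 1 n) mexpE.
- by rewrite lr l0 (@block_mxEdl _ 1 n 1 n) mxE.
- by rewrite lr l0 (@block_mxEur _ 1 n 1 n) mxE.
by rewrite l0 (@block_mxEul _ 1 n 1 n) mxE eqxx.
Qed.

(* Locked, as are the inverses below: unification would otherwise unfold [mexp]. *)
Definition Lam n (A : 'M[C]_n) (z : C) : 'M[C]_n.+1 := locked (blk 1 0 0 (mexp (z *: A))).
Definition Abig n (A : 'M[C]_n) : 'M[C]_n.+1 := locked (blk 0 0 0 A).

Lemma LamE n (A : 'M[C]_n) z : Lam A z = blk 1 0 0 (mexp (z *: A)).
Proof. by rewrite /Lam -lock. Qed.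
Lemma AbigE n (A : 'M[C]_n) : Abig A = blk 0 0 0 A.
Proof. by rewrite /Abig -lock. Qed.

Lemma LamD n (A : 'M[C]_n) x y : Lam A (x + y) = Lam A x *m Lam A y.
Proof.
by rewrite !LamE blkM expmD; blks.
Qed.

Lemma Lam0 n (A : 'M[C]_n) : Lam A 0 = 1%:M.
Proof. by rewrite LamE scale0r expm0 blk1. Qed.

Definition expmV n (A : 'M[C]_n) (z : C) : 'M[C]_n := locked (mexp (- z *: A)).
Definition LamV n (A : 'M[C]_n) (z : C) : 'M[C]_n.+1 := locked (Lam A (- z)).

Lemma expmVE n (A : 'M[C]_n) z : expmV A z = mexp (- z *: A).
Proof. by rewrite /expmV -lock. Qed.
Lemma LamVN n (A : 'M[C]_n) z : LamV A z = Lam A (- z).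
Proof. by rewrite /LamV -lock. Qed.

Lemma expmVK n (A : 'M[C]_n) z : expmV A z *m mexp (z *: A) = 1%:M.
Proof. by rewrite expmVE; apply: expmN. Qed.

Lemma expmV_comm n (A : 'M[C]_n) z : A *m expmV A z = expmV A z *m A.
Proof. by rewrite expmVE; apply: expm_comm. Qed.

Lemma LamVE n (A : 'M[C]_n) z : LamV A z = blk 1 0 0 (expmV A z).
Proof. by rewrite LamVN LamE expmVE. Qed.

Lemma LamVK n (A : 'M[C]_n) x : LamV A x *m Lam A x = 1%:M.
Proof. by rewrite LamVN -LamD addNr Lam0. Qed.

Lemma LamKV n (A : 'M[C]_n) x : Lam A x *m LamV A x = 1%:M.
Proof. by rewrite LamVN -LamD subrr Lam0. Qed.

Lemma invmx_dL n (A : 'M[C]_n) p : invmx (dL A p) = LamV A (pz p).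
Proof.
rewrite dLE -LamE.
have [u _] := mulmx1_unit (LamKV A (pz p)).
by rewrite -[LHS]mulmx1 -(LamKV A (pz p)) mulmxA mulVmx // mul1mx.
Qed.

Lemma HfieldE n (A : 'M[C]_n) H p :
  Hfield A H p = (LamV A (pz p))^T *m H *m cmx (LamV A (pz p)).
Proof. by rewrite /Hfield invmx_dL. Qed.

Lemma nr_block m n p q (a : 'M[C]_(m, p)) (b : 'M[C]_(m, q)) (c : 'M[C]_(n, p)) (d : 'M[C]_(n, q)) :
  nr (block_mx a b c d) = nr a + nr b + (nr c + nr d).
Proof.
rewrite /nr big_split_ord /=; congr (_ + _).
  rewrite -big_split; apply: eq_bigr => i _; rewrite big_split_ord /=; congr (_ + _);
  by apply: eq_bigr => j _; rewrite ?block_mxEul ?block_mxEur.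
rewrite -big_split; apply: eq_bigr => i _; rewrite big_split_ord /=; congr (_ + _);
by apply: eq_bigr => j _; rewrite ?block_mxEdl ?block_mxEdr.
Qed.

Lemma nr_blk_dr n (B : 'M[C]_n) : nr (blk 0 0 0 B) = nr B.
Proof.
unlk.
change (nr (block_mx (0 : C)%:M (0 : 'rV_n) (0 : 'cV_n) B) = nr B).
by rewrite nr_block raddf0 !nr0 !add0r.
Qed.

Lemma nr_vec n z (w : 'cV[C]_n) : nr (vec z w) = cabs z + nr w.
Proof.
unlk.
change (\sum_(i < 1 + n) \sum_j cabs (col_mx z%:M w i j) = cabs z + nr w).
rewrite big_split_ord /= big_ord1; congr (_ + _).
  by rewrite big_ord1 col_mxEu mxE eqxx mulr1n.
by apply: eq_bigr => i _; apply: eq_bigr => j _; rewrite col_mxEd.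
Qed.

Lemma cder_Lam n (A : 'M[C]_n) z : cder (Lam A) z (Abig A *m Lam A z).
Proof.
have h1 (x : 'M[C]_n) : nr (blk 0 0 0 x) <= 1 * nr x by rewrite nr_blk_dr mul1r.
have h2 (x y : 'M[C]_n) : blk 0 0 0 (x - y) = blk 0 0 0 x - blk 0 0 0 y.
  by rewrite blkN blkD !oppr0 !addr0.
have h := adiff_map (@cabs_ge0 R) ler01 h1 h2 (cder_expm A z).
have := adiffD h (adiff_const (@cabs_ge0 R) (blk 1 0 0 0)).
apply: adiff_ext => [x||x].
- by rewrite blkD LamE !add0r addr0.
- by rewrite blkD LamE !add0r addr0.
by rewrite addr0 AbigE LamE blkM blkZ; blks.
Qed.

Lemma nr_blk_dl n (x : 'cV[C]_n) : nr (blk 0 0 x 0) = nr x.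
Proof.
unlk.
change (nr (block_mx (0 : C)%:M (0 : 'rV_n) x (0 : 'M_n)) = nr x).
by rewrite nr_block raddf0 !nr0 !add0r addr0.
Qed.

Definition e0r n : 'rV[C]_n.+1 := (vec 1 0)^T.

Lemma e0rE n : e0r n = row_mx (1%:M : 'M_1) (0 : 'rV_n).
Proof.
rewrite /e0r; unlk.
change ((col_mx (1%:M : 'M[C]_1) (0 : 'cV[C]_n))^T = row_mx (1%:M : 'M_1) (0 : 'rV_n)).
by rewrite tr_col_mx trmx1 trmx0.
Qed.

Lemma e0r_mul n (q : 'cV[C]_n.+1) : e0r n *m q = (pz q)%:M.
Proof.
rewrite [q]vecE e0rE pz_vec; unlk.
apply: etrans (@mul_row_col C 1 1 n 1 1%:M 0 _ _) _.
by rewrite mul1mx mul0mx addr0.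
Qed.

Lemma vec_e0r n z (w : 'cV[C]_n) : vec z w *m e0r n = blk z 0 w 0.
Proof.
rewrite e0rE; unlk; apply: etrans (@mul_col_row C 1 n 1 1 n z%:M w 1%:M 0) _.
by rewrite !mulmx1 !mulmx0.
Qed.

Lemma e0r_Lam n (A : 'M[C]_n) z : e0r n *m Lam A z = e0r n.
Proof.
rewrite LamE e0rE; unlk; apply: etrans (@mul_row_block C 1 1 n 1 n 1%:M 0 _ _ _ _) _.
by rewrite mul1mx !mul0mx !addr0 mulmx0.
Qed.

Lemma e0r_blk_low n c (B : 'M[C]_n) : e0r n *m blk 0 0 c B = 0.
Proof.
rewrite e0rE; unlk; apply: etrans (@mul_row_block C 1 1 n 1 n 1%:M 0 _ _ _ _) _.
by rewrite !mul1mx !mul0mx !addr0 raddf0; apply: (@row_mx0 C 1 1 n).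
Qed.

Definition iota n : 'M[C]_(n.+1, n) := col_mx (0 : 'rV_n) 1%:M : 'M_(1 + n, n).

Lemma iota_mul n k (x : 'M[C]_(n, k)) : iota n *m x = (col_mx (0 : 'rV_k) x : 'M_(1 + n, k)).
Proof.
rewrite /iota; apply: etrans (@mul_col_mx C 1 n n k (0 : 'rV_n) 1%:M x) _.
by rewrite mul0mx mul1mx.
Qed.

Lemma iota_vec n (x : 'cV[C]_n) : iota n *m x = vec 0 x.
Proof. by rewrite iota_mul; unlk; rewrite raddf0. Qed.

Lemma blk_iota n c (B : 'M[C]_n) : blk 0 0 c B *m iota n = iota n *m B.
Proof.
rewrite iota_mul /iota; unlk; apply: etrans (@mul_block_col C 1 n 1 n n _ _ _ _ _ _) _.
by rewrite !mulmx0 mul0mx mulmx1 !add0r.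
Qed.

(** Frame change replacing [Z_0] by [Z_0 + v]; it is the differential at the identity of the
    automorphism [psiv]. *)
Definition gv n (v : 'cV[C]_n) : 'M[C]_n.+1 := locked (blk 1 0 v 1%:M).

Lemma gvE n (v : 'cV[C]_n) : gv v = blk 1 0 v 1%:M.
Proof. by rewrite /gv -lock. Qed.

Lemma gvM n (v w : 'cV[C]_n) : gv v *m gv w = gv (v + w).
Proof. by rewrite !gvE blkM; blks. Qed.

Lemma gv0 n : gv (0 : 'cV[C]_n) = 1%:M.
Proof. by rewrite gvE blk1. Qed.

End Blocks.
Arguments e0r {R n}.
Arguments iota {R n}.

(** * The soliton equation in the left-invariant frame, and shear automorphisms *)

Section Geometry.
Variable R : realType.
Local Notation C := (complex R).

Lemma adiff_sub (T T' : Type) (s : T -> R) (s' : T' -> R) (phi : T' -> T) m k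
    (f : T -> 'M[C]_(m, k)) f0 L (c : R) :
  0 <= c -> (forall h, 0 <= s' h) -> (forall h, s (phi h) <= c * s' h) ->
  adiff s f f0 L -> adiff s' (fun h => f (phi h)) f0 (fun h => L (phi h)).
Proof.
move=> c0 s0 hc [[d d0 hd] hf]; split.
  exists (d * c); first by rewrite mulr_ge0.
  by move=> h; apply: le_trans (hd _) _; rewrite -mulrA; apply: ler_wpM2l.
have c1 : 0 < c + 1 by rewrite ltr_wpDl.
have hc' h : s (phi h) <= (c + 1) * s' h.
  by apply: le_trans (hc h) _; apply: ler_wpM2r => //; rewrite lerDl.
move=> e e0; have [a a0 ha] := hf _ (divr_gt0 e0 c1).
exists (a / (c + 1)); first by rewrite divr_gt0.
move=> h; rewrite ltr_pdivlMr // mulrC => hh.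
apply: le_trans (ha _ (le_lt_trans (hc' h) hh)) _.
rewrite mulrAC ler_pdivrMr // -mulrA [leRHS]mulrA mulrAC -mulrA.
by rewrite ler_wpM2l ?(ltW e0) // mulrC.
Qed.

Lemma dirderivP m k l (f : 'cV[C]_m -> 'M[C]_(k, l)) p v D :
  dirderiv f p v D <->
  adiff (fun t : R => `|t|) (fun t => f (p + rC t *: v)) (f p) (fun t => rC t *: D).
Proof.
have key (t : R) X : t != 0 -> nr ((rC t)^-1 *: X - D) * `|t| = nr (X - rC t *: D).
  move=> t0; rewrite -cabs_rC mulrC -nrZ scalerBr scalerA divff ?rC_eq0 // scale1r //.
split=> [h|[_ h]].
  split; first by exists (nr D); [apply: nr_ge0 | move=> t; rewrite nrZ cabs_rC mulrC].
  move=> e e0; have [d [d0 hd]] := h e e0; exists d => // t td.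
  have [->|t0] := eqVneq t 0; first by rewrite rC0 !scale0r addr0 subrr subr0 nr0 normr0 mulr0.
  rewrite -key //; apply: ler_wpM2r => //.
  by have := hd t; rewrite normr_gt0 t0 td mnormE le_rC; apply.
move=> e e0; have [d d0 hd] := h e e0; exists d; split=> // t /andP [t0 td].
rewrite mnormE le_rC -(ler_pM2r t0) key; first exact: hd.
by rewrite -normr_gt0.
Qed.

(** The tensor field depends on the point only through its first coordinate, so only [pz v]
    enters. *)
Definition HD n (A : 'M[C]_n) (H : 'M[C]_n.+1) (p v : 'cV[C]_n.+1) : 'M[C]_n.+1 :=
  let X := LamV A (pz p) in let L := - pz v *: (Abig A *m X) in
  L^T *m H *m cmx X + X^T *m H *m cmx L.

Lemma dirderiv_Hfield n (A : 'M[C]_n) H p v : dirderiv (Hfield A H) p v (HD A H p v).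
Proof.
apply/dirderivP.
have hc (t : R) : cabs (- pz v * rC t) <= cabs (pz v) * `|t| by rewrite cabsM cabsN cabs_rC.
have hX := adiff_sub (cabs_ge0 (pz v)) (fun t : R => normr_ge0 t) hc (cder_Lam A (- pz p)).
have hXT := adiff_mulr (fun t : R => normr_ge0 t) H (adiff_tr (fun t : R => normr_ge0 t) hX).
have hXc := adiff_cmx (fun t : R => normr_ge0 t) hX.
have := adiffM (fun t : R => normr_ge0 t) hXT hXc; apply: adiff_ext => [t||t].
- by rewrite HfieldE pzD pzZ LamVN opprD [rC t * _]mulrC mulNr.
- by rewrite HfieldE LamVN.
rewrite /HD LamVN scalerDr; congr (_ + _).
  by rewrite !linearZ /= -!scalemxAl scalerA [rC t * _]mulrC.
have e : conjc (- pz v * rC t) = rC t * conjc (- pz v).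
  by rewrite [RHS]mulrC -{2}(conj_rC t); apply: rmorphM.
by rewrite !cmxZ -!scalemxAr scalerA e.
Qed.

Lemma dirderiv_unique m k l (f : 'cV[C]_m -> 'M[C]_(k, l)) p v D E :
  dirderiv f p v D -> dirderiv f p v E -> D = E.
Proof.
move=> /dirderivP h /dirderivP h'; apply/eqP; rewrite -subr_eq0; apply/eqP.
refine (@adiff_unique _ _ _ _ _ _ _ _ _ (fun i => 1 / 2 ^+ i) 1 (D - E) h h' ltr01 _ _) => i.
  by rewrite ger0_norm // divr_ge0 // exprn_ge0.
by rewrite scalerBr.
Qed.

(* [Kmx] is [- ad Z] in the left-invariant frame, where [Z] is the field and [DZ] its differential. *)
Definition Kmx n (A : 'M[C]_n) (z zeta : C) (DZ : 'M[C]_n.+1) : 'M[C]_n.+1 :=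
  LamV A z *m DZ *m Lam A z - zeta *: Abig A.

(** Soliton equation transported to the identity, with [S] in place of [Theta - lam H]: a constant
    right side makes the behaviour under automorphisms transparent. *)
Definition ksol n (A : 'M[C]_n) (H S : 'M[C]_n.+1) : Prop :=
  exists (Z : 'cV[C]_n.+1 -> 'cV[C]_n.+1) (DZ : 'cV[C]_n.+1 -> 'M[C]_n.+1),
    (forall p, fder Z p (DZ p)) /\
    forall p, let K := Kmx A (pz p) (pz (Z p)) (DZ p) in K^T *m H + H *m cmx K = S.

Lemma Kmx_Lam n (A : 'M[C]_n) z zeta DZ :
  Kmx A z zeta DZ *m LamV A z = LamV A z *m DZ + (- zeta) *: (Abig A *m LamV A z).
Proof.
rewrite /Kmx mulmxBl -(mulmxA (LamV A z *m DZ) (Lam A z) (LamV A z)) LamKV mulmx1.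
by rewrite -scalemxAl scaleNr.
Qed.

Lemma soliton_pointwise n (B H T X Y DZ K : 'M[C]_n) lam zeta :
  X *m Y = 1%:M -> K *m X = X *m DZ + (- zeta) *: (B *m X) ->
  X^T *m T *m cmx X = rC lam *: (X^T *m H *m cmx X) +
     (((- zeta *: (B *m X))^T *m H *m cmx X + X^T *m H *m cmx (- zeta *: (B *m X))) +
      DZ^T *m (X^T *m H *m cmx X) + X^T *m H *m cmx X *m cmx DZ) <->
  K^T *m H + H *m cmx K = T - rC lam *: H.
Proof.
move=> XY KX.
have e : rC lam *: (X^T *m H *m cmx X) +
   (((- zeta *: (B *m X))^T *m H *m cmx X + X^T *m H *m cmx (- zeta *: (B *m X))) +
    DZ^T *m (X^T *m H *m cmx X) + X^T *m H *m cmx X *m cmx DZ) =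
   X^T *m (rC lam *: H + (K^T *m H + H *m cmx K)) *m cmx X.
  have -> : X^T *m (rC lam *: H + (K^T *m H + H *m cmx K)) *m cmx X =
     rC lam *: (X^T *m H *m cmx X) + ((K *m X)^T *m H *m cmx X + X^T *m H *m cmx (K *m X)).
    by rewrite trmx_mul cmxM !mulmxDr !mulmxDl -scalemxAr -scalemxAl !mulmxA.
  rewrite KX linearD /= cmxD trmx_mul cmxM !mulmxDl !mulmxDr !mulmxA.
  move: (_^T *m H *m cmx X) => a; mxlin.
rewrite e; split=> [h|h].
  have := congr1 (fun Q => Y^T *m Q *m cmx Y) h.
  rewrite !mulmxA -!trmx_mul XY trmx1 !mul1mx -!mulmxA -!cmxM XY cmx1 !mulmx1 => ->.
  mxlin.
by congr (_ *m _ *m _); rewrite h; mxlin.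
Qed.

Lemma soliton_ksol n (A : 'M[C]_n) H :
  hcf_soliton A H <->
  herm_pd H /\ exists lam : R, ksol A H (Theta (mu_A A) H - rC lam *: H).
Proof.
have key (T : 'M[C]_n.+1) lam p zeta DZ v : pz v = zeta ->
    let K := Kmx A (pz p) zeta DZ in
    (Hfield A T p = rC lam *: Hfield A H p
      + (HD A H p v + DZ^T *m Hfield A H p + Hfield A H p *m cmx DZ)) <->
    K^T *m H + H *m cmx K = T - rC lam *: H.
  move=> hv; rewrite !HfieldE /HD hv; cbv zeta.
  exact: soliton_pointwise (LamVK A (pz p)) (Kmx_Lam A (pz p) zeta DZ).
split=> [[pd [lam [Z [DZ [Hd [hZ [hd hS]]]]]]]|[pd [lam [Z [DZ [hZ hK]]]]]].
  split=> //; exists lam, Z, DZ; split; first exact/fderP.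
  move=> p; apply/(key _ _ _ _ _ (Z p)) => //.
  by rewrite hS (dirderiv_unique (hd p) (dirderiv_Hfield A H p (Z p))).
split=> //; exists lam, Z, DZ, (fun p => HD A H p (Z p)); split; first exact/fderP.
split=> p; first exact: dirderiv_Hfield.
by apply/(key _ _ _ _ _ (Z p)).
Qed.

Definition EN n (A : 'M[C]_n) (v : 'cV[C]_n) (z : C) : 'M[C]_n.+1 :=
  locked (mexp (z *: blk 0 0 v A)).

Lemma ENE n (A : 'M[C]_n) v z : EN A v z = mexp (z *: blk 0 0 v A).
Proof. by rewrite /EN -lock. Qed.

Lemma END n (A : 'M[C]_n) v x y : EN A v (x + y) = EN A v x *m EN A v y.
Proof. by rewrite !ENE expmD. Qed.

(** This is the integral of [exp(t A) v] from [0] to [z], obtained as a block of an exponential so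
    that singular [A] needs no separate treatment. *)
Definition Phi n (A : 'M[C]_n) (v : 'cV[C]_n) (z : C) : 'cV[C]_n :=
  pw (EN A v z *m vec 1 0).

Lemma expm_blk_top n (A : 'M[C]_n) v z p : pz (EN A v z *m p) = pz p.
Proof.
rewrite ENE.
have h : e0r *m (z *: blk 0 0 v A) = (0 : 'M[C]_1) *m e0r.
  by rewrite -scalemxAr e0r_blk_low scaler0 mul0mx.
have := congr1 (fun X => X *m p) (expm_intertwine h); rewrite expm0 mul1mx -mulmxA !e0r_mul.
by move=> /matrixP /(_ 0 0); rewrite !mxE !mulr1n.
Qed.

Lemma expm_blk_bot n (A : 'M[C]_n) v z w :
  EN A v z *m vec 0 w = vec 0 (mexp (z *: A) *m w).
Proof.
rewrite ENE.
have h : iota *m (z *: A) = (z *: blk 0 0 v A) *m iota.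
  by rewrite -scalemxAl -scalemxAr blk_iota.
by rewrite -!iota_vec mulmxA -(expm_intertwine h) mulmxA.
Qed.

Lemma expm_blk_one n (A : 'M[C]_n) v z : EN A v z *m vec 1 0 = vec 1 (Phi A v z).
Proof. by rewrite [LHS]vecE expm_blk_top pz_vec. Qed.

Lemma Phi0 n (A : 'M[C]_n) v : Phi A v 0 = 0.
Proof. by rewrite /Phi ENE scale0r expm0 mul1mx pw_vec. Qed.

(** The cocycle identity that makes [psiv] multiplicative. *)
Lemma PhiD n (A : 'M[C]_n) v x y : Phi A v (x + y) = Phi A v x + mexp (x *: A) *m Phi A v y.
Proof.
rewrite {1}/Phi END -mulmxA expm_blk_one.
have -> : vec 1 (Phi A v y) = vec 1 0 + vec 0 (Phi A v y) by rewrite vecD addr0 add0r.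
by rewrite mulmxDr expm_blk_one expm_blk_bot vecD pw_vec.
Qed.

Lemma PhiN n (A : 'M[C]_n) v z : Phi A (- v) z = - Phi A v z.
Proof.
pose B : 'M[C]_n.+1 := blk (-1) 0 0 1%:M.
have h : B *m (z *: blk 0 0 v A) = (z *: blk 0 0 (- v) A) *m B.
  by rewrite -scalemxAl -scalemxAr !blkM; blks; rewrite scaleN1r opprK.
have := congr1 (fun X => X *m vec 1 0) (expm_intertwine h).
rewrite -!ENE -!mulmxA expm_blk_one /B !blk_mul_vec; blks.
have -> : vec (-1) (0 : 'cV[C]_n) = (-1) *: vec 1 0 by rewrite vecZ scaler0 mulr1.
rewrite -scalemxAr expm_blk_one vecZ => /(congr1 (@pw R n)).
by rewrite !pw_vec => ->; rewrite scaleN1r opprK.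
Qed.

Lemma nr_pw n (p : 'cV[C]_n.+1) : nr (pw p) <= 1 * nr p.
Proof. by rewrite mul1r {2}[p]vecE nr_vec lerDr cabs_ge0. Qed.

Lemma cabs_pz n (p : 'cV[C]_n.+1) : cabs (pz p) <= 1 * nr p.
Proof. by rewrite mul1r {2}[p]vecE nr_vec lerDl nr_ge0. Qed.

Lemma pwB n (p q : 'cV[C]_n.+1) : pw (p - q) = pw p - pw q.
Proof. by rewrite /pw linearB. Qed.

Lemma cder_Phi n (A : 'M[C]_n) v z : cder (Phi A v) z (mexp (z *: A) *m v).
Proof.
have h := cder_mulr (vec 1 0) (cder_expm (blk 0 0 v A) z).
have := adiff_map (@cabs_ge0 R) ler01 (@nr_pw n) (@pwB n) h.
apply: adiff_ext => [x||x]; [by rewrite -ENE | by rewrite -ENE |].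
rewrite pwZ; congr (_ *: _); rewrite expm_comm -ENE -mulmxA blk_mul_vec; blks.
by rewrite expm_blk_bot pw_vec.
Qed.

Definition psiv n (A : 'M[C]_n) (v : 'cV[C]_n) (p : 'cV[C]_n.+1) : 'cV[C]_n.+1 :=
  p + vec 0 (Phi A v (pz p)).
Definition Dpsiv n (A : 'M[C]_n) (v : 'cV[C]_n) (p : 'cV[C]_n.+1) : 'M[C]_n.+1 :=
  gv (mexp (pz p *: A) *m v).

Lemma pz_psiv n (A : 'M[C]_n) v p : pz (psiv A v p) = pz p.
Proof. by rewrite /psiv pzD pz_vec addr0. Qed.

Lemma psivK n (A : 'M[C]_n) v : cancel (psiv A v) (psiv A (- v)).
Proof.
move=> p; rewrite {1}/psiv pz_psiv /psiv PhiN -addrA vecD subrr addr0.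
by rewrite vec0 addr0.
Qed.

Lemma fder_psiv n (A : 'M[C]_n) v p : fder (psiv A v) p (Dpsiv A v p).
Proof.
have h1 (x : 'cV[C]_n) : nr (vec 0 x) <= 1 * nr x by rewrite nr_vec cabs0 add0r mul1r.
have h2 (x y : 'cV[C]_n) : vec 0 (x - y) = vec 0 x - vec 0 y.
  by rewrite -[- vec 0 y]scaleN1r vecZ vecD mulr0 addr0 scaleN1r.
have h := adiff_sub ler01 (@nr_ge0 R n.+1 1) (@cabs_pz n) (cder_Phi A v (pz p)).
have h' := adiff_map (@nr_ge0 R n.+1 1) ler01 h1 h2 h.
have := adiffD (fder_linear 1%:M p) h'; apply: adiff_ext => [x||x].
- by rewrite mul1mx /psiv pzD.
- by rewrite mul1mx.
rewrite mul1mx /Dpsiv gvE {3}[x]vecE blk_mul_vec; blks.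
by rewrite {1}[x]vecE vecD addr0 addrC.
Qed.

Lemma Lam_Dpsiv n (A : 'M[C]_n) v p :
  LamV A (pz p) *m Dpsiv A v p = gv v *m LamV A (pz p).
Proof.
by rewrite /Dpsiv !gvE !LamVE !blkM; blks; rewrite mulmxA expmVK mul1mx.
Qed.

Lemma psiv_gmul n (A : 'M[C]_n) v p q :
  psiv A v (gmul A p q) = gmul A (psiv A v p) (psiv A v q).
Proof.
rewrite /gmul !dLE pz_psiv.
have e : pz (p + blk 1 0 0 (mexp (pz p *: A)) *m q) = pz p + pz q.
  by rewrite pzD {1}[q]vecE blk_mul_vec; blks; rewrite pz_vec.
rewrite /psiv e PhiD mulmxDr blk_mul_vec; blks.
have -> : vec 0 (Phi A v (pz p) + mexp (pz p *: A) *m Phi A v (pz q)) =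
   vec 0 (Phi A v (pz p)) + vec 0 (mexp (pz p *: A) *m Phi A v (pz q)).
  by rewrite vecD addr0.
mxlin.
Qed.

Lemma homothetic_psiv n (A : 'M[C]_n) v H :
  homothetic A H ((gv v)^T *m H *m cmx (gv v)).
Proof.
exists 1, (psiv A v), (psiv A (- v)), (Dpsiv A v), (Dpsiv A (- v)).
split=> //; split; first by apply/fderP => p; apply: fder_psiv.
split; first by apply/fderP => p; apply: fder_psiv.
split; first exact: psivK.
split; first by have := @psivK n A (- v); rewrite opprK.
split; first exact: psiv_gmul.
move=> p; rewrite rC1 scale1r !HfieldE pz_psiv !mulmxA -!trmx_mul Lam_Dpsiv.
by rewrite -!mulmxA -!cmxM Lam_Dpsiv.
Qed.

(** The field is pulled back by [psiv]; in the left-invariant frame [K] is merely conjugated by the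
    constant matrix [gv v]. *)
Lemma ksol_psiv n (A : 'M[C]_n) v H S : ksol A H S ->
  ksol A ((gv v)^T *m H *m cmx (gv v)) ((gv v)^T *m S *m cmx (gv v)).
Proof.
move=> [Z [DZ [hZ hK]]].
(* Inverse of the differential of [psiv]; its own derivative [G'] enters when the pulled-back field
   is differentiated. *)
pose G z : 'M[C]_n.+1 := gv (- (mexp (z *: A) *m v)).
pose G' z : 'M[C]_n.+1 := blk 0 0 (- (A *m mexp (z *: A) *m v)) 0.
have hG z : cder G z (G' z).
  have h1 (x : 'cV[C]_n) : nr (blk 0 0 x 0) <= 1 * nr x.
    by rewrite nr_blk_dl mul1r.
  have h2 (x y : 'cV[C]_n) : blk 0 0 (x - y) 0 = blk 0 0 x 0 - blk 0 0 y 0.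
    by rewrite blkN blkD !oppr0 !addr0.
  have h := cder_mulr (- v) (cder_expm A z).
  have := adiffD (adiff_map (@cabs_ge0 R) ler01 h1 h2 h) (adiff_const (@cabs_ge0 R) (blk 1 0 0 1%:M)).
  apply: adiff_ext => [x||x].
  - by rewrite blkD /G !gvE mulmxN; blks.
  - by rewrite blkD /G !gvE mulmxN; blks.
  by rewrite addr0 /G' blkZ mulmxN; blks.
exists (fun p => G (pz p) *m Z (psiv A v p)).
exists (fun p => G (pz p) *m DZ (psiv A v p) *m Dpsiv A v p + G' (pz p) *m Z (psiv A v p) *m e0r).
split=> p.
  have hGp := adiff_sub ler01 (@nr_ge0 R n.+1 1) (@cabs_pz n) (hG (pz p)).
  have := adiffM (@nr_ge0 R n.+1 1) hGp (fder_comp (fder_psiv A v p) (hZ _)).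
  apply: adiff_ext => [x||x]; [by rewrite pzD | by [] |].
  rewrite mulmxDl addrC !mulmxA; congr (_ + _).
  by rewrite -[in RHS]mulmxA e0r_mul mul_mx_scalar -scalemxAl.
cbv zeta; rewrite -(hK (psiv A v p)) pz_psiv.
have -> : pz (G (pz p) *m Z (psiv A v p)) = pz (Z (psiv A v p)).
  by rewrite {1}[Z _]vecE /G !gvE blk_mul_vec; blks; rewrite pz_vec.
set zeta := pz (Z (psiv A v p)); set z := pz p; set DZp := DZ _.
set K := Kmx A z zeta DZp.
have XG : LamV A z *m G z = gv (- v) *m LamV A z.
  by rewrite /G !gvE !LamVE !blkM; blks; rewrite mulmxN mulmxA expmVK mul1mx.
have DY : Dpsiv A v p *m Lam A z = Lam A z *m gv v.
  by rewrite /Dpsiv !gvE !LamE !blkM; blks.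
(* The contribution of [G'] is precisely what conjugating [zeta *: Abig A] by [gv v] produces. *)
have extra : LamV A z *m (G' z *m Z (psiv A v p) *m e0r) *m Lam A z = blk 0 0 (- zeta *: (A *m v)) 0.
  rewrite -mulmxA -mulmxA e0r_Lam {1}[Z _]vecE -/zeta /G' blk_mul_vec; blks.
  rewrite vec_e0r LamVE blkM; blks; congr (blk 0 0 _ 0).
  rewrite -scalemxAr mulmxN expm_comm !mulmxA expmVK mul1mx.
  by rewrite scalerN scaleNr.
have eK : Kmx A z zeta (G z *m DZp *m Dpsiv A v p + G' z *m Z (psiv A v p) *m e0r) =
    gv (- v) *m K *m gv v.
  rewrite /Kmx mulmxDr mulmxDl extra.
  have -> : LamV A z *m (G z *m DZp *m Dpsiv A v p) *m Lam A z =
     gv (- v) *m (LamV A z *m DZp *m Lam A z) *m gv v.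
    by rewrite !mulmxA XG -!mulmxA DY.
  rewrite /K /Kmx mulmxBr mulmxBl -scalemxAr -scalemxAl.
  have -> : gv (- v) *m Abig A *m gv v = blk 0 0 (A *m v) 0 + Abig A.
    by rewrite !gvE !AbigE !blkM blkD; blks.
  have -> : blk 0 0 (- zeta *: (A *m v)) 0 = - zeta *: blk 0 0 (A *m v) 0.
    by rewrite blkZ; blks.
  by mxlin.
rewrite eK !trmx_mul !cmxM.
have gg : gv v *m gv (- v) = 1%:M by rewrite gvM subrr gv0.
have gg' : cmx (gv v) *m cmx (gv (- v)) = 1%:M by rewrite -cmxM gg cmx1.
have gg2 : (gv (- v))^T *m (gv v)^T = 1%:M by rewrite -trmx_mul gg trmx1.
rewrite mulmxDr mulmxDl; congr (_ + _).
  by rewrite !mulmxA -[_ *m (gv (- v))^T *m _]mulmxA gg2 mulmx1.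
by rewrite !mulmxA -[_ *m cmx (gv v) *m cmx (gv (- v))]mulmxA gg' mulmx1.
Qed.

End Geometry.

(** * Tools for block-diagonal metrics *)

Section BlockDiagonal.
Variable R : realType.
Local Notation C := (complex R).
Local Notation cRe := (@complex.Re R).
Local Notation ci := (Complex 0 1 : C).

Lemma cder1Z (f : C -> C) z d a : cder1 f z d -> cder1 (fun z => a * f z) z (a * d).
Proof.
move=> h e e0; have k0 : 0 < cabs a + 1 by rewrite ltr_wpDl ?cabs_ge0.
have [b b0 hb] := h _ (divr_gt0 e0 k0); exists b => // x /hb hx.
have -> : a * f (z + x) - a * f z - a * d * x = a * (f (z + x) - f z - d * x) by ring.
rewrite cabsM; apply: (@le_trans _ _ ((cabs a + 1) * (e / (cabs a + 1) * cabs x))).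
  by apply: ler_pM; rewrite ?cabs_ge0 // lerDl.
by rewrite mulrA [_ * (e / _)]mulrC mulfVK // gt_eqF.
Qed.

(** Replacing [y] by [i y] separates the two terms of the polarised identity. *)
Lemma polarization n (Psi : 'M[C]_n) :
  (forall e : 'cV[C]_n, (cmx (Psi *m e))^T *m e = 0) -> Psi = 0.
Proof.
move=> h.
have sym (x y : 'cV[C]_n) : (cmx (Psi *m x))^T *m y + (cmx (Psi *m y))^T *m x = 0.
  by have := h (x + y); rewrite [Psi *m (_ + _)]mulmxDr cmxD [(_ + _)^T]linearD mulmxDl !mulmxDr !h add0r addr0.
have z (x y : 'cV[C]_n) : (cmx (Psi *m x))^T *m y = 0.
  have [k kc k0] : exists2 k : C, conjc k = - k & k + k != 0.
    exists ci; first by apply/eqP; rewrite eq_complex /= oppr0 !eqxx.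
    by rewrite eq_complex /= addr0 eqxx -mulr2n pnatr_eq0.
  have h1 := sym x y; have := sym x (k *: y).
  rewrite -!scalemxAr cmxZ kc linearZ /= -scalemxAl.
  move: h1; set a := _ *m y; set b := _ *m x => h1 h2.
  have e : (k + k) *: a = 0.
    transitivity (k *: (a + b) + (k *: a + (- k) *: b)); first by mxlin.
    by rewrite h1 h2 scaler0 addr0.
  by move/eqP: e; rewrite scaler_eq0 (negPf k0) => /eqP.
have zx (x : 'cV[C]_n) : Psi *m x = 0.
  set u := Psi *m x; have e : (cmx u)^T = 0.
    apply: (@mul_adj_eq0 C _ _ (cmx u)^T); rewrite trmxK -[map_mx _ _]/(cmx (cmx u)) cmxK.
    exact: z.
  by have := congr1 (fun Y => cmx Y^T) e; rewrite trmxK cmxK trmx0 cmx0.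
by apply/matrixP => i j; have /matrixP /(_ i 0) := zx (delta_mx j 0); rewrite -colE !mxE.
Qed.

Definition PhiM n (A : 'M[C]_n) (z : C) : 'M[C]_n := \matrix_(i, j) Phi A (delta_mx j 0) z i 0.

(** Linearity of [Phi] in [v]: both sides vanish at [z = 0] and have the same derivative. *)
Lemma PhiME n (A : 'M[C]_n) v z : PhiM A z *m v = Phi A v z.
Proof.
pose f z := PhiM A z *m v - Phi A v z.
suff /(_ z) : forall z, f z = f 0.
  rewrite /f Phi0 subr0; have -> : PhiM A 0 = 0.
    by apply/matrixP => i j; rewrite mxE Phi0 !mxE.
  by rewrite mul0mx => /eqP; rewrite subr_eq0 => /eqP.
apply: cder_const => y.
have hM : cder (PhiM A) y (mexp (y *: A)).
  split; first by exists (nr (mexp (y *: A))); [apply: nr_ge0 | move=> x; rewrite nrZ mulrC].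
  move=> e e0; pose c : R := n%:R + 1.
  have c0 : 0 < c by rewrite ltr_wpDl.
  have /fin_all_exists2 [d d0 hd] : forall j : 'I_n, exists2 d : R, 0 < d & forall h, cabs h < d ->
      nr (Phi A (delta_mx j 0) (y + h) - Phi A (delta_mx j 0) y - h *: (mexp (y *: A) *m delta_mx j 0)) <= e / c * cabs h.
    by move=> j; have [_ hj] := cder_Phi A (delta_mx j 0) y; apply: hj; rewrite divr_gt0.
  exists (\big[Num.min/1]_j d j); first by elim/big_ind: _ => // a b a0 b0; rewrite lt_min a0.
  move=> h hh; rewrite -nr_tr.
  apply: (@le_trans _ _ (\sum_(j < n) e / c * cabs h)).
    apply: ler_sum => j _; have hj : cabs h < d j.
      by apply: lt_le_trans hh _; rewrite (bigD1 j) //= ge_min lexx.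
    have := hd j h hj; apply: le_trans.
    rewrite /nr; apply: ler_sum => i _; rewrite big_ord1 -colE !(mxDE, mxNE, mxZE) !mxE.
    exact: lexx.
  rewrite sumr_const card_ord -mulr_natr mulrAC; apply: ler_wpM2r; first exact: cabs_ge0.
  by rewrite mulrAC ler_pdivrMr // ler_wpM2l ?(ltW e0) // /c lerDl.
have := cderD (cder_mulr v hM) (cder_mull (- 1%:M) (cder_Phi A v y)).
have -> : mexp (y *: A) *m v + - 1%:M *m (mexp (y *: A) *m v) = 0 by rewrite mulNmx mul1mx subrr.
by apply: adiff_ext => [x||x] //; rewrite /f mulNmx mul1mx.
Qed.

(** A left kernel [K] satisfies [t K = - K (X - t)], so its norm is at most half of itself. *)
Lemma near_scalar_unit n (X : 'M[C]_n) (t : C) : t != 0 ->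
  nr (X - t%:M) <= 2^-1 * cabs t -> X \in unitmx.
Proof.
move=> t0 h; rewrite -row_free_unit -kermx_eq0; set K := kermx X.
have KX : K *m X = 0 by apply: mulmx_ker.
have e : t *: K = - (K *m (X - t%:M)) by rewrite mulmxBr KX mul_mx_scalar sub0r opprK.
have tp : 0 < cabs t by rewrite lt_def cabs_ge0 andbT cabs_eq0.
have : cabs t * nr K <= nr K * (2^-1 * cabs t).
  rewrite -nrZ e nrN; apply: le_trans (nr_mul _ _) _.
  by apply: ler_wpM2l => //; apply: nr_ge0.
move=> hle; have : cabs t * nr K <= 0 by lra.
rewrite pmulr_rle0 // => hK.
by apply/eqP/nr_eq0/eqP; rewrite eq_le nr_ge0 andbT.
Qed.

(** To first order [PhiM A z] is [z] times the identity. The tolerance per column is divided by [n]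
    so that the columns together stay within one half. *)
Lemma PhiM_unit n (A : 'M[C]_n) : exists z, PhiM A z \in unitmx.
Proof.
have [j0|j0] := posnP n.
  by exists 0; rewrite unitmxE; subst n; rewrite det_mx00 unitr1.
have /fin_all_exists2 [d d0 hd] : forall j : 'I_n, exists2 d : R, 0 < d & forall h, cabs h < d ->
      nr (Phi A (delta_mx j 0) (0 + h) - Phi A (delta_mx j 0) 0 - h *: (mexp ((0 : C) *: A) *m delta_mx j 0)) <= 2^-1 / n%:R * cabs h.
  move=> j; have [_ hj] := cder_Phi A (delta_mx j 0) 0; apply: hj.
  by rewrite divr_gt0 ?invr_gt0 ?ltr0n.
pose m := \big[Num.min/1]_j d j.
have m0 : 0 < m by rewrite /m; elim/big_ind: _ => // a b a0 b0; rewrite lt_min a0.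
pose t : R := m / 2; have t0 : 0 < t by rewrite divr_gt0.
have tm : t < m by rewrite ltr_pdivrMr // mulr_natr mulr2n ltrDl.
exists (rC t); apply: (@near_scalar_unit _ _ (rC t)); first by rewrite rC_eq0 gt_eqF.
rewrite -nr_tr; apply: (@le_trans _ _ (\sum_(j < n) 2^-1 / n%:R * cabs (rC t))).
  apply: ler_sum => j _; have hj : cabs (rC t) < d j.
    rewrite cabs_rC gtr0_norm //; apply: lt_le_trans tm _.
    by rewrite /m (bigD1 j) //= ge_min lexx.
  have := hd j _ hj; apply: le_trans; rewrite add0r Phi0 subr0 scale0r expm0 mul1mx.
  rewrite /nr; apply: ler_sum => i _; rewrite big_ord1 !(mxDE, mxNE, mxZE).
  rewrite [in leLHS]mxE mxDE mxNE [PhiM _ _ _ _]mxE [_%:M _ _]mxE [delta_mx _ _ _ _]mxE.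
  by rewrite andbT mulr_natr.
have n0 : n%:R != 0 :> R by rewrite pnatr_eq0 -lt0n.
rewrite sumr_const card_ord -[leLHS]mulr_natr; move: (n%:R : R) n0 (cabs (rC t)) => x x0 y.
by rewrite mulrAC divfK.
Qed.


Definition ba n (X : 'M[C]_n.+1) : C := X 0 0.
Definition br n (X : 'M[C]_n.+1) : 'rV[C]_n := @ursubmx C 1 n 1 n X.
Definition bc n (X : 'M[C]_n.+1) : 'cV[C]_n := @dlsubmx C 1 n 1 n X.
Definition bB n (X : 'M[C]_n.+1) : 'M[C]_n := @drsubmx C 1 n 1 n X.

Lemma blkP n (X : 'M[C]_n.+1) : X = blk (ba X) (br X) (bc X) (bB X).
Proof.
rewrite /blk -lock; apply: etrans (esym (@submxK C 1 n 1 n X)) _.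
congr (@block_mx _ 1 n 1 n _ _ _ _).
by rewrite [LHS]mx11 !mxE; congr (X _ _)%:M; apply/val_inj.
Qed.

Lemma Kmx_blk n (A : 'M[C]_n) z zeta DZ :
  Kmx A z zeta DZ = blk (ba DZ) (br DZ *m mexp (z *: A)) (expmV A z *m bc DZ)
    (expmV A z *m bB DZ *m mexp (z *: A) - zeta *: A).
Proof.
rewrite /Kmx {1}[DZ]blkP LamVE LamE AbigE !blkM -scaleN1r !blkZ blkD; blks.
by rewrite scaleN1r.
Qed.

Lemma ksol_block_eqs n (A : 'M[C]_n) (s : R) (s0 : C) (h S' : 'M[C]_n) z zeta DZ :
  let K := Kmx A z zeta DZ in
  K^T *m blk (rC s) 0 0 h + blk (rC s) 0 0 h *m cmx K = blk s0 0 0 S' ->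
  let K'' := expmV A z *m bB DZ *m mexp (z *: A) - zeta *: A in
  [/\ (ba DZ + conjc (ba DZ)) * rC s = s0,
      h *m cmx (expmV A z *m bc DZ) = - (rC s *: (br DZ *m mexp (z *: A))^T) &
      K''^T *m h + h *m cmx K'' = S'].
Proof.
cbv zeta; rewrite Kmx_blk blk_tr blk_cmx !blkM blkD; blks.
move=> /blk_inj [e1 _ e3 e4]; split=> //.
  by rewrite -e1 mulrDl [rC s * _]mulrC.
by apply/eqP; rewrite -addr_eq0 addrC e3.
Qed.

Lemma cder_vecz n (Z : 'cV[C]_n.+1 -> 'cV[C]_n.+1) DZ z w :
  fder Z (vec z w) DZ -> cder (fun t => Z (vec t w)) z (vec (ba DZ) (bc DZ)).
Proof.
have e t : vec 0 w + t *: vec 1 0 = vec t w by rewrite vecZ vecD; blks.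
rewrite -e => /fder_line; rewrite {1}[DZ]blkP blk_mul_vec; blks.
by apply: adiff_ext => [x||x]; rewrite ?e.
Qed.

Lemma cder_vecw n (Z : 'cV[C]_n.+1 -> 'cV[C]_n.+1) DZ z w x t :
  fder Z (vec z (w + t *: x)) DZ ->
  cder (fun t => Z (vec z (w + t *: x))) t (vec ((br DZ *m x) 0 0) (bB DZ *m x)).
Proof.
have e t' : vec z w + t' *: vec 0 x = vec z (w + t' *: x) by rewrite vecZ vecD; blks.
rewrite -e => /fder_line; rewrite {1}[DZ]blkP blk_mul_vec; blks.
by apply: adiff_ext => [y||y]; rewrite ?e.
Qed.

Lemma cder_pz n (f : C -> 'cV[C]_n.+1) z d c : cder f z (vec d c) -> cder1 (fun t => pz (f t)) z d.
Proof.
by move=> h; have := cder_entry ord0 0 h; rewrite -[vec d c ord0 0]/(pz (vec d c)) pz_vec.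
Qed.

Lemma cder_pw n (f : C -> 'cV[C]_n.+1) z d c : cder f z (vec d c) -> cder (fun t => pw (f t)) z c.
Proof.
move=> h; have := adiff_map (@cabs_ge0 R) ler01 (@nr_pw R n) (@pwB R n) h.
by apply: adiff_ext => // x; rewrite pwZ pw_vec.
Qed.

Lemma antilinear_adiff n (u : 'rV[C]_n) (A : 'M[C]_n) :
  adiff (@cabs R) (fun h => (cmx (u *m mexp (h *: A)))^T) ((cmx u)^T)
    (fun h => conjc h *: (cmx (u *m A))^T).
Proof.
have h0 := cder_mull u (cder_expm A 0).
have := adiff_tr (@cabs_ge0 R) (adiff_cmx (@cabs_ge0 R) h0).
apply: adiff_ext => [x||x].
- by rewrite add0r.
- by rewrite scale0r expm0 mulmx1.
by rewrite scale0r expm0 mulmx1 cmxZ linearZ.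
Qed.

End BlockDiagonal.

(** * From a holomorphic field to a matrix [D] with [[D, A] = be A] *)

Section BlockSoliton.
Variable R : realType.
Local Notation C := (complex R).
Local Notation cRe := (@complex.Re R).
Local Notation ci := (Complex 0 1 : C).

Lemma Re_conj_sum (x y : C) : x + conjc x = y -> cRe x = cRe y / 2.
Proof. by move=> <-; case: x => a b /=; field. Qed.

Lemma antiholomorphic_part_zero n (f f' : C -> 'cV[C]_n) (c k f0 : 'cV[C]_n) :
  (forall z, cder f z (f' z)) ->
  adiff (@cabs R) f' f0 (fun h => h *: c + conjc h *: k) -> k = 0.
Proof.
move=> hf [_ hd]; apply/matrixP => i j; rewrite mx0E.
apply: (@cder1_antiholomorphic_part _ (fun z => f z i j) (fun z => f' z i j) (f0 i j) (c i j)).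
  by move=> z; apply: cder_entry.
move=> e e0; have [d d0 h] := hd e e0; exists d => // z /h; apply: le_trans.
have := nr_entry (f' z - f0 - (z *: c + conjc z *: k)) i j.
by rewrite !(mxDE, mxNE, mxZE) opprD addrA [c i j * z]mulrC [k i j * _]mulrC.
Qed.

(** Real and imaginary increments give [N^T h + h conj(N) = 0] and [N^T h - h conj(N) = 0]. *)
Lemma constant_sesqui_adiff n (h S' : 'M[C]_n) (f : C -> 'M[C]_n) f0 (N : 'M[C]_n) :
  h \in unitmx -> (forall z, (f z)^T *m h + h *m cmx (f z) = S') -> f 0 = f0 ->
  adiff (@cabs R) f f0 (fun z => z *: N) -> N = 0.
Proof.
move=> uh hc ef hf; have c0 := @cabs_ge0 R.
have D1 := adiffD (adiff_mulr c0 h (adiff_tr c0 hf)) (adiff_mull c0 h (adiff_cmx c0 hf)).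
have D2 : adiff (@cabs R) (fun z => (f z)^T *m h + h *m cmx (f z)) (f0^T *m h + h *m cmx f0) (fun=> 0).
  by apply: adiff_ext (adiff_const c0 S') => [z||z] //; rewrite ?hc // -ef hc.
have cr i : cabs (rC (1 / 2 ^+ i)) = 1 / 2 ^+ i :> R.
  by rewrite cabs_rC ger0_norm // divr_ge0 // exprn_ge0.
have e1 : N^T *m h + h *m cmx N = 0.
  refine (@adiff_unique _ _ _ _ _ _ _ _ _ (fun i => rC (1 / 2 ^+ i)) 1 _ D1 D2 ltr01 cr _) => i.
  by rewrite subr0 linearZ /= cmxZ conj_rC -scalemxAl -scalemxAr scalerDr.
have e2 : ci *: (N^T *m h) + (- ci) *: (h *m cmx N) = 0.
  refine (@adiff_unique _ _ _ _ _ _ _ _ _ (fun i => rC (1 / 2 ^+ i) * ci) 1 _ D1 D2 ltr01 _ _) => i.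
    by rewrite cabsM cabs_i mulr1.
  have ec : conjc (rC (1 / 2 ^+ i) * ci) = rC (1 / 2 ^+ i) * - ci.
    by apply/eqP; rewrite eq_complex /=; apply/andP; split; apply/eqP; ring.
  by rewrite subr0 linearZ /= cmxZ ec -scalemxAl -scalemxAr scalerDr !scalerA.
have ci0 : ci + ci != 0 by rewrite eq_complex /= addr0 eqxx -mulr2n pnatr_eq0.
have e3 : (ci + ci) *: (N^T *m h) = 0.
  transitivity (ci *: (N^T *m h + h *m cmx N) + (ci *: (N^T *m h) + (- ci) *: (h *m cmx N))); first by mxlin.
  by rewrite e1 e2 scaler0 addr0.
move/eqP: e3; rewrite scaler_eq0 (negPf ci0) /= => /eqP e3.
by rewrite -[N]trmxK -[N^T](mulmxK uh) e3 mul0mx trmx0.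
Qed.

Lemma conj_solve n (s : R) (k : 'M[C]_n) (u : 'rV[C]_n) (y : 'cV[C]_n) :
  cmx y = - (rC s *: (k *m u^T)) -> y = - (rC s *: (cmx k *m (cmx u)^T)).
Proof. by move=> ey; rewrite -[y in LHS]cmxK ey cmxN cmxZ conj_rC cmxM cmx_tr. Qed.

Lemma solve_left n (E V : 'M[C]_n) (c X : 'cV[C]_n) (s : C) :
  E *m V = 1%:M -> V *m c = - (s *: X) -> c = - s *: (E *m X).
Proof.
by move=> EV h; rewrite -[LHS]mul1mx -EV -mulmxA h mulmxN -scalemxAr scaleNr.
Qed.

(** The field has components [zt] along [Z_0] and [Y] along the ideal; [a, r, c, B] are the blocks
    of its differential. The block equations fix the real part of [a], tie [c] to the conjugate of
    [r], and constrain [B]. Holomorphy then makes [B] constant along [w = 0], and differentiating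
    the last equation at the identity gives the commutator. *)
Lemma ksol_block n (A : 'M[C]_n) (s : R) (s0 : C) (h S' : 'M[C]_n) :
  0 < s -> h \in unitmx -> ksol A (blk (rC s) 0 0 h) (blk s0 0 0 S') ->
  exists D be, [/\ be + conjc be = s0 / rC s, D^T *m h + h *m cmx D = S' &
                  D *m A - A *m D = be *: A].
Proof.
move=> sp uh [Z [DZ [hZ hK]]].
have s0' : rC s != 0 :> C by rewrite rC_eq0 gt_eqF.
have eqs z w := @ksol_block_eqs R n A s s0 h S' z (pz (Z (vec z w))) (DZ (vec z w)).
have hK' z w : let K := Kmx A z (pz (Z (vec z w))) (DZ (vec z w)) in
   K^T *m blk (rC s) 0 0 h + blk (rC s) 0 0 h *m cmx K = blk s0 0 0 S'.
  by have := hK (vec z w); rewrite pz_vec.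
pose a z w := ba (DZ (vec z w)); pose r z w := br (DZ (vec z w)).
pose c z w := bc (DZ (vec z w)); pose B z w := bB (DZ (vec z w)).
pose zt z w := pz (Z (vec z w)); pose Y z w := pw (Z (vec z w)).
have q1 z w : a z w + conjc (a z w) = s0 / rC s.
  by have [e _ _] := eqs z w (hK' z w); rewrite -e mulfK.
have q2 z w : h *m cmx (expmV A z *m c z w) = - (rC s *: (r z w *m mexp (z *: A))^T).
  by have [_ e _] := eqs z w (hK' z w).
have q3 z w : let K'' := expmV A z *m B z w *m mexp (z *: A) - zt z w *: A in
    K''^T *m h + h *m cmx K'' = S' by have [_ _ e] := eqs z w (hK' z w).
have dz z w : cder1 (fun t => zt t w) z (a z w) := cder_pz (cder_vecz (hZ (vec z w))).
have dY z w : cder (fun t => Y t w) z (c z w) := cder_pw (cder_vecz (hZ (vec z w))).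
have dzw z w x t : cder1 (fun t => zt z (w + t *: x)) t ((r z (w + t *: x) *m x) 0 0).
  exact: cder_pz (cder_vecw (hZ (vec z (w + t *: x)))).
have dYw z w x t : cder (fun t => Y z (w + t *: x)) t (B z (w + t *: x) *m x).
  exact: cder_pw (cder_vecw (hZ (vec z (w + t *: x)))).
clearbody a r c B zt Y; clear eqs hK' hK hZ DZ Z.
(* [a] is a complex derivative in [z] whose real part is prescribed. *)
have ac z w : a z w = a 0 w.
  apply: (@cder1_Re_const_affine _ (fun t => zt t w) (fun t => a t w) (cRe (s0 / rC s) / 2)).
    by move=> y; apply: dz.
  by move=> y; apply: Re_conj_sum.
have zta z w : zt z w = zt 0 w + a 0 w * z.
  pose f t := zt t w + (- a 0 w * t + 0 * t ^+ 2).
  have /(_ z) : forall z, f z = f 0.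
    apply: cder1_const => y; have := cder1D (dz y w) (cder1_quadratic (- a 0 w) 0 y).
    by rewrite ac mulr0 mul0r addr0 subrr.
  rewrite /f !mul0r mulr0 !addr0 => <-; ring.
(* The quotient [(zt z w - zt 0 w) / z] equals [a 0 w], whose real part is constant in [w]; hence
   its derivative in [w] vanishes. *)
have rc z w : r z w = r 0 w.
  have [->//|z0] := eqVneq z 0.
  apply/matrixP => i j; rewrite (ord1 i).
  pose x : 'cV[C]_n := delta_mx j 0.
  have e k : (r k w *m x) 0 0 = r k w 0 j by rewrite -colE mxE.
  rewrite -!e.
  have d1 := dzw z w x 0; have d2 := dzw 0 w x 0.
  have d := cder1Z z^-1 (cder1D d1 (cder1Z (-1) d2)).
  have : z^-1 * ((r z (w + 0 *: x) *m x) 0 0 + -1 * (r 0 (w + 0 *: x) *m x) 0 0) = 0.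
    apply: (Re_const_der d) => t.
    have e' t' : z^-1 * (zt z (w + t' *: x) + -1 * zt 0 (w + t' *: x)) = a 0 (w + t' *: x).
      by rewrite (zta z); field.
    by rewrite !e' !(Re_conj_sum (q1 _ _)).
  move/eqP; rewrite scale0r addr0 mulf_eq0 invr_eq0 (negPf z0) /= mulN1r subr_eq0.
  by move/eqP.
pose P := cmx (invmx h).
have uP : P \in unitmx by rewrite /P /cmx map_unitmx unitmx_inv.
have cE z w : c z w = - rC s *: (mexp (z *: A) *m (P *m (cmx (r 0 w *m mexp (z *: A)))^T)).
  have e : cmx (expmV A z *m c z w) = - (rC s *: (invmx h *m (r 0 w *m mexp (z *: A))^T)).
    by rewrite -[LHS](mulKmx uh) q2 rc mulmxN -scalemxAr.
  have e2 := conj_solve e.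
  have VK : mexp (z *: A) *m expmV A z = 1%:M by apply: mulmx1C; apply: expmVK.
  exact: solve_left VK e2.
(* [c] is the [z]-derivative of [Y], so the antiholomorphic first-order term of the formula [cE] has
   to vanish. *)
have rA w : r 0 w *m A = 0.
  have D := adiffM (@cabs_ge0 R) (cder_expm A 0) (adiff_mull (@cabs_ge0 R) P (antilinear_adiff (r 0 w) A)).
  have k0 : (- rC s) *: (P *m (cmx (r 0 w *m A))^T) = 0.
    apply: (@antiholomorphic_part_zero _ (fun z => Y z w) (fun z => c z w)
       (- rC s *: (A *m (P *m (cmx (r 0 w))^T))) _ (- rC s *: (P *m (cmx (r 0 w))^T))) => // .
    have := adiff_mull (@cabs_ge0 R) ((- rC s)%:M) D.
    apply: adiff_ext => [z||z]; rewrite ?scale0r ?expm0 ?mul1mx ?mulmx1 ?mul_scalar_mx //.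
      by rewrite add0r cE.
    by rewrite -scalemxAl -scalemxAr; mxlin.
  move/eqP: k0; rewrite scaler_eq0 oppr_eq0 (negPf s0') /= => /eqP k0.
  have k1 : (cmx (r 0 w *m A))^T = 0 by rewrite -[LHS](mulKmx uP) k0 mulmx0.
  by have := congr1 (fun X => cmx X^T) k1; rewrite trmxK cmxK trmx0 cmx0.
have rE w z : r 0 w *m mexp (z *: A) = r 0 w.
  have e : r 0 w *m (z *: A) = (0 : 'M[C]_1) *m r 0 w by rewrite -scalemxAr rA scaler0 mul0mx.
  by rewrite (expm_intertwine e) expm0 mul1mx.
pose Xi w : 'cV[C]_n := (cmx (r 0 w))^T.
have YE z w : Y z w = Y 0 w - rC s *: (PhiM A z *m (P *m Xi w)).
  rewrite PhiME.
  have /(_ z) : forall z, Y z w + (rC s)%:M *m Phi A (P *m Xi w) z = Y 0 w + (rC s)%:M *m Phi A (P *m Xi w) 0.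
    apply: cder_const => y.
    have := cderD (dY y w) (cder_mull (rC s)%:M (cder_Phi A (P *m Xi w) y)).
    by rewrite cE rE mul_scalar_mx -/(Xi w) scaleNr addNr.
  by rewrite Phi0 mulmx0 addr0 mul_scalar_mx => <-; rewrite addrK.
(* Inverting [PhiM A z0] expresses [Xi], the conjugate of [r], through values of [Y]: it is
   holomorphic in [w]. *)
have [z0 uz0] := PhiM_unit A.
pose L := - (rC s)^-1 *: (invmx P *m invmx (PhiM A z0)).
have XiE w : Xi w = L *m (Y z0 w - Y 0 w).
  rewrite (YE z0) addrC addrA addNr add0r mulmxN /L scaleNr mulNmx opprK.
  rewrite -scalemxAl -scalemxAr scalerA mulVf // scale1r -mulmxA mulKmx // mulKmx //.
pose Psi := L *m (B z0 0 - B 0 0).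
have dXi x : cder (fun t => Xi (0 + t *: x)) 0 (Psi *m x).
  have e : B z0 (0 + 0 *: x) *m x + - 1%:M *m (B 0 (0 + 0 *: x) *m x) = (B z0 0 - B 0 0) *m x.
    by rewrite scale0r addr0 mulNmx mul1mx mulmxBl.
  have := cder_mull L (cderD (dYw z0 0 x 0) (cder_mull (- 1%:M) (dYw 0 0 x 0))).
  rewrite e mulmxA; apply: adiff_ext => [y||y] //; by rewrite mulNmx mul1mx -XiE.
(* On each line through the origin [r] is the derivative of [zt], while by [dXi] its first-order
   part is antiholomorphic; so that part vanishes. *)
have Psi0 : Psi = 0.
  apply: polarization => x.
  have cd := dzw 0 0 x.
  have D := adiff_mulr (@cabs_ge0 R) x (adiff_tr (@cabs_ge0 R) (adiff_cmx (@cabs_ge0 R) (dXi x))).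
  have rX w : (cmx (Xi w))^T = r 0 w by rewrite /Xi cmx_tr cmxK trmxK.
  rewrite [LHS]mx11; set k := _ 0 0.
  suff -> : k = 0 by rewrite raddf0.
  apply: (@cder1_antiholomorphic_part _ _ _ ((r 0 0 *m x) 0 0) 0 _ cd) => e e0.
  have [_ /(_ e e0) [d d0 hd]] := D; exists d => // z /hd; apply: le_trans.
  set M := (X in _ <= nr X); have := nr_entry M 0 0.
  rewrite /M !(mxDE, mxNE) !rX [0 + z]add0r scale0r addr0.
  by rewrite cmxZ linearZ /= -scalemxAl mxZE mul0r subr0 [k * _]mulrC.
have B0 z : B z 0 = B 0 0.
  apply/matrixP => i j.
  pose x : 'cV[C]_n := delta_mx j 0.
  have e : B z 0 *m x = B 0 0 *m x; last first.
    by have /matrixP /(_ i 0) := e; rewrite -!colE !mxE.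
  have d1 := dYw z 0 x 0; rewrite scale0r addr0 in d1.
  have d2 := dYw 0 0 x 0; rewrite scale0r addr0 in d2.
  apply: cder_unique d1 _.
  have := cderD d2 (cder_mull (- (rC s) *: (PhiM A z *m P)) (dXi x)).
  rewrite Psi0 mul0mx mulmx0 addr0.
  by apply: adiff_ext => [y||y] //; rewrite [Y z _]YE -scalemxAl scaleNr mulmxA.
pose be := a 0 0; pose B00 := B 0 0; pose z00 := zt 0 0.
(* Derivative at [z = 0] of [exp(-zA) B00 exp(zA) - zt z 0 *: A], which is the lower block of [K]
   along [w = 0]. *)
pose N1 := (- A) *m B00 + B00 *m A - be *: A.
have N0 : N1 = 0.
  pose f z := expmV A z *m B00 *m mexp (z *: A) - zt z 0 *: A.
  apply: (@constant_sesqui_adiff n h S' f (f 0)) => //.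
    by move=> z; have := q3 z 0; rewrite B0.
  have hV : adiff (@cabs R) (expmV A) (1%:M) (fun z => z *: (- A)).
    have := cder_expm (- A) 0; apply: adiff_ext => [z||z].
    - by rewrite add0r expmVE scalerN scaleNr.
    - by rewrite scale0r expm0.
    by rewrite scale0r expm0 mulmx1.
  have hE : adiff (@cabs R) (fun z => mexp (z *: A)) (1%:M) (fun z => z *: A).
    have := cder_expm A 0; apply: adiff_ext => [z||z]; rewrite ?add0r ?scale0r ?expm0 ?mulmx1 //.
  have hl : adiff (@cabs R) (fun z => - zt z 0 *: A) (- z00 *: A) (fun z => z *: (- be *: A)).
    split; first by exists (nr (- be *: A)); [apply: nr_ge0 | move=> y; rewrite nrZ mulrC].
    move=> e e0; exists 1 => // y _; rewrite (zta y) -/z00 -/be.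
    rewrite [X in nr X](_ : _ = 0) ?nr0 ?mulr_ge0 ?cabs_ge0 ?(ltW e0) //; mxlin.
  have := adiffD (adiffM (@cabs_ge0 R) (adiff_mulr (@cabs_ge0 R) B00 hV) hE) hl.
  apply: adiff_ext => [z||z].
  - by rewrite /f scaleNr.
  - by rewrite /f scale0r expm0 expmVE oppr0 scale0r expm0 scaleNr.
  by rewrite /N1 mulmx1 mul1mx -scalemxAl -scalemxAr; mxlin.
exists (B00 - z00 *: A), be; split; first exact: q1.
  by have := q3 0 0; rewrite expmVE oppr0 !scale0r expm0 mul1mx mulmx1.
apply/eqP; rewrite -subr_eq0; apply/eqP; rewrite -N0 /N1 mulmxBl mulmxBr -scalemxAl -scalemxAr mulNmx; mxlin.
Qed.

End BlockSoliton.

(** * The tensor [Theta] and adapted frames *)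

Section ThetaFormula.
Variable R : realType.
Local Notation C := (complex R).

Lemma colAE n (A : 'M[C]_n) i : colA A i = iota *m col i A.
Proof.
apply/matrixP => k j; rewrite iota_mul [LHS]mxE.
have l0 : (ord0 : 'I_n.+1) = lshift n (0 : 'I_1) by apply/val_inj.
have lr (m : 'I_n) : lift ord0 m = rshift 1 m by apply/val_inj.
case: (unliftP ord0 k) => [k' ->|->].
  by rewrite lr (@col_mxEd _ 1 n) mxE.
by rewrite l0 (@col_mxEu _ 1 n) mxE.
Qed.

Lemma sum_mu n (A : 'M[C]_n) (g : 'I_n.+1 -> 'I_n.+1 -> C) (phi : 'cV[C]_n.+1 -> C) :
  phi 0 = 0 -> (forall x, phi (- x) = - phi x) ->
  \sum_l \sum_s g l s * phi (mu_A A l s) =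
  \sum_i (g ord0 (lift ord0 i) - g (lift ord0 i) ord0) * phi (colA A i).
Proof.
move=> p0 pN; rewrite big_ord_recl big_ord_recl.
rewrite {1}/mu_A unlift_none p0 mulr0 add0r -big_split /=; apply: eq_bigr => i _.
rewrite {1}/mu_A unlift_none liftK big_ord_recl {1}/mu_A liftK unlift_none pN.
rewrite big1; last by move=> j _; rewrite /mu_A !liftK p0 mulr0.
by rewrite addr0 mulrN mulrBl.
Qed.

Lemma blk_dr n (X : 'M[C]_n) : blk 0 0 0 X = iota *m X *m iota^T.
Proof.
rewrite iota_mul /iota /blk -lock.
rewrite (@tr_col_mx C 1 n n) trmx0 trmx1.
have := @mul_col_row C 1 n n 1 n (0 : 'rV_n) X (0 : 'cV_n) 1%:M.
by rewrite !mul0mx mulmx0 mulmx1 raddf0 => ->.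
Qed.

(** Only brackets with [Z_0] survive, and antisymmetry turns products of entries of the inverse
    metric into the two-by-two minors through its [(0, 0)] entry. The pairs [(0, j)] and [(j, 0)]
    contribute equally and absorb the factor one half. *)
Lemma ThetaE n (A : 'M[C]_n) (H : 'M[C]_n.+1) : let W := invmx H in
  Theta (mu_A A) H =
  H *m blk 0 0 0 (cmx A *m (ba W *: bB W - bc W *m br W) *m A^T) *m H.
Proof.
move=> W; set V := _ - _; rewrite blk_dr.
have -> : H *m (iota *m (cmx A *m V *m A^T) *m iota^T) *m H =
   (H *m iota *m cmx A) *m V *m (A^T *m iota^T *m H) by rewrite !mulmxA.
set U := H *m iota *m cmx A; set T := A^T *m iota^T *m H.
have Uh a (Y : 'cV[C]_n.+1) : hform H (evec a) Y = (H *m cmx Y) a 0.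
  by rewrite /hform /evec trmx_delta -rowE -row_mul mxE.
have Th b (X : 'cV[C]_n.+1) : hform H X (evec b) = (X^T *m H) 0 b.
  by rewrite /hform /evec /cmx map_delta_mx -colE mxE.
have UE a i : (H *m cmx (colA A i)) a 0 = U a i.
  rewrite colAE cmxM mulmxA.
  have -> : cmx (@iota R n) = iota.
    by apply/matrixP => x y; rewrite mxE /iota !mxE; case: split => z; rewrite !mxE ?conjc0 ?conjc_nat //; case: eqP; rewrite ?conjc1 ?conjc0.
  by rewrite /cmx map_col -/(cmx A) [LHS]mxE [RHS]mxE; apply: eq_bigr => k _; rewrite [col _ _ _ _]mxE.
have TE b i : ((colA A i)^T *m H) 0 b = T i b.
  by rewrite colAE trmx_mul tr_col -mulmxA -row_mul mxE /T mulmxA.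
have W00 : ba W = W ord0 ord0 by [].
have l0 : (ord0 : 'I_n.+1) = lshift n (0 : 'I_1) by apply/val_inj.
have lr (m : 'I_n) : lift ord0 m = rshift 1 m by apply/val_inj.
have Wdd i j : bB W i j = W (lift ord0 i) (lift ord0 j) by rewrite !mxE !lr.
have Wdl i : bc W i 0 = W (lift ord0 i) ord0 by rewrite !mxE !lr l0.
have Wur j : br W 0 j = W ord0 (lift ord0 j) by rewrite !mxE !lr l0.
have VE i j : V i j = W ord0 ord0 * W (lift ord0 i) (lift ord0 j) - W (lift ord0 i) ord0 * W ord0 (lift ord0 j).
  by rewrite /V mxDE mxNE mxZE Wdd W00 [(bc W *m br W) i j]mxE big_ord1 Wdl Wur.
apply/matrixP => a b; rewrite [LHS]mxE.
have step1 k r : \sum_l \sum_s (W l k * W s r) * hform H (evec a) (mu_A A l s) =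
   \sum_i (W ord0 k * W (lift ord0 i) r - W (lift ord0 i) k * W ord0 r) * U a i.
  rewrite (@sum_mu n A (fun l s => W l k * W s r) (fun x => hform H (evec a) x)).
  - by apply: eq_bigr => i _; rewrite Uh UE.
  - by rewrite Uh cmx0 mulmx0 mxE.
  by move=> x; rewrite !Uh cmxN mulmxN mxE.
pose G k r := \sum_i (W ord0 k * W (lift ord0 i) r - W (lift ord0 i) k * W ord0 r) * U a i.
have -> : \sum_k \sum_l \sum_r \sum_s (ginv H k l * ginv H r s * hform H (evec a) (mu_A A l s) * hform H (mu_A A k r) (evec b)) =
   \sum_k \sum_r G k r * hform H (mu_A A k r) (evec b).
  apply: eq_bigr => k _; rewrite exchange_big /=; apply: eq_bigr => r _.
  rewrite /G -step1 mulr_suml; apply: eq_bigr => l _; rewrite mulr_suml.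
  by apply: eq_bigr => s _; rewrite /ginv.
rewrite (@sum_mu n A G (fun x => hform H x (evec b))); last 2 first.
- by rewrite Th trmx0 mul0mx mxE.
- by move=> x; rewrite !Th linearN mulNmx mxE.
rewrite mulr_sumr [RHS]mxE; apply: eq_bigr => j _.
rewrite Th TE mulrA; congr (_ * _); rewrite [RHS]mxE /G -sumrB mulr_sumr; apply: eq_bigr => i _.
by rewrite VE; field.
Qed.

Lemma mul_blk_dr_gv n (v : 'cV[C]_n) X : gv v *m blk 0 0 0 X = blk 0 0 0 X.
Proof. by rewrite gvE blkM; blks. Qed.

(** The minors of the inverse metric are insensitive to the shear [v]: they reduce to [s^-1 h^-1],
    and the tensor lives on the ideal alone. *)
Lemma Theta_adapted n (A : 'M[C]_n) (H : 'M[C]_n.+1) v (s : R) h :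
  0 < s -> h \in unitmx -> (gv v)^T *m H *m cmx (gv v) = blk (rC s) 0 0 h ->
  (gv v)^T *m Theta (mu_A A) H *m cmx (gv v) =
  blk 0 0 0 (h *m ((rC s)^-1 *: (cmx A *m invmx h *m A^T)) *m h).
Proof.
move=> sp uh e; set Hb := blk (rC s) 0 0 h in e.
have s0 : rC s != 0 :> C by rewrite rC_eq0 gt_eqF.
have cg w : cmx (@gv R n w) = gv (cmx w) by rewrite !gvE blk_cmx !cmx0 cmx1 conjc1.
have gN w : gv w *m gv (- w) = 1%:M :> 'M[C]_n.+1 by rewrite gvM subrr gv0.
have gN' w : gv (- w) *m gv w = 1%:M :> 'M[C]_n.+1 by rewrite gvM addNr gv0.
have gT : (gv (- v))^T *m (gv v)^T = 1%:M by rewrite -trmx_mul gN trmx1.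
have gT' : (gv v)^T *m (gv (- v))^T = 1%:M by rewrite -trmx_mul gN' trmx1.
have HE : H = (gv (- v))^T *m Hb *m gv (- cmx v).
  by rewrite -e cg !mulmxA gT mul1mx -mulmxA gN mulmx1.
pose Wb := blk (rC s)^-1 0 0 (invmx h).
have HbW : Hb *m Wb = 1%:M by rewrite /Hb /Wb blkM; blks; rewrite divff // mulmxV // blk1.
have HW : H *m (gv (cmx v) *m Wb *m (gv v)^T) = 1%:M.
  rewrite HE !mulmxA -[_ *m gv (- cmx v) *m gv (cmx v)]mulmxA gN' mulmx1.
  by rewrite -[_ *m Hb *m Wb]mulmxA HbW mulmx1 gT.
have WE : invmx H = gv (cmx v) *m Wb *m (gv v)^T.
  have [uH _] := mulmx1_unit HW.
  by rewrite -[RHS](mulKmx uH) HW mulmx1.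
have WE' : invmx H = blk (rC s)^-1 ((rC s)^-1 *: v^T) ((rC s)^-1 *: cmx v)
    ((rC s)^-1 *: (cmx v *m v^T) + invmx h).
  by rewrite WE !gvE blk_tr /Wb !blkM; blks; rewrite scalemxAl.
have [w1 w2 w3 w4] := blk_inj (etrans (esym (blkP (invmx H))) WE').
rewrite ThetaE w1 w2 w3 w4.
have -> : (rC s)^-1 *: ((rC s)^-1 *: (cmx v *m v^T) + invmx h) -
    (rC s)^-1 *: cmx v *m ((rC s)^-1 *: v^T) = (rC s)^-1 *: invmx h.
  by rewrite -scalemxAl -scalemxAr; mxlin.
set X := cmx A *m _ *m _.
have bT : blk 0 0 0 X *m (gv (- v))^T = blk 0 0 0 X.
  by rewrite -[LHS]trmxK trmx_mul trmxK blk_tr !trmx0 mul_blk_dr_gv blk_tr !trmx0 trmxK.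
have -> : (gv v)^T *m (H *m blk 0 0 0 X *m H) *m cmx (gv v) = Hb *m blk 0 0 0 X *m Hb.
  rewrite HE cg !mulmxA gT' mul1mx -!mulmxA gN' mulmx1 !mulmxA.
  rewrite -[_ *m gv (- cmx v) *m blk 0 0 0 X]mulmxA mul_blk_dr_gv.
  by rewrite -[_ *m blk 0 0 0 X *m _]mulmxA bT.
have <- : X = (rC s)^-1 *: (cmx A *m invmx h *m A^T) by rewrite /X -scalemxAr -scalemxAl.
move: X {bT} => X; rewrite /Hb !blkM.
by rewrite !(mul0mx, mulmx0, mx0E, scaler0, mulr0, mul0r, addr0, add0r).
Qed.

Lemma vec_tr_mul n x (y : 'cV[C]_n) z u : (vec x y)^T *m vec z u = (x * z)%:M + y^T *m u.
Proof.
rewrite /vec -!lock (@tr_col_mx C 1 n 1) tr_scalar_mx.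
by apply: etrans (@mul_row_col C 1 1 n 1 _ _ _ _) _; rewrite -scalar_mxM.
Qed.

Lemma cmx_vec n z (w : 'cV[C]_n) : cmx (vec z w) = vec (conjc z) (cmx w).
Proof.
rewrite /vec -!lock; apply: etrans (@map_col_mx C C (@conjc R) 1 n 1 z%:M w) _.
by rewrite map_scalar_mx.
Qed.

Lemma hform_blk n a r c (h : 'M[C]_n) z w :
  hform (blk a r c h) (vec z w) (vec z w) =
  (a * z + (c^T *m w) 0 0) * conjc z + ((z *: r^T + h^T *m w)^T *m cmx w) 0 0.
Proof.
rewrite /hform -[(vec z w)^T *m _]trmxK trmx_mul trmxK blk_tr blk_mul_vec cmx_vec vec_tr_mul.
by rewrite mxDE [_%:M 0 0]mxE eqxx mulr1n.
Qed.

Lemma adapted_frame n (H : 'M[C]_n.+1) : herm_pd H ->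
  exists v (s : R) (Q : 'M[C]_n), [/\ 0 < s, Q \in unitmx &
    (gv v)^T *m H *m cmx (gv v) = blk (rC s) 0 0 (Q^T *m cmx Q)].
Proof.
move=> [Hh Hp]; set h := bB H; set r := br H; set c := bc H; set a := ba H.
have HE : H = blk a r c h by apply: blkP.
have [_ e2 e3 e4] : [/\ a = conjc a, c^T = cmx r, r^T = cmx c & h^T = cmx h].
  by apply: (@blk_inj R n); rewrite -blk_tr -blk_cmx -HE.
have hp (w : 'cV[C]_n) : w != 0 -> 0 < (w^T *m h *m cmx w) 0 0.
  move=> w0; have : vec 0 w != 0.
    by apply: contra w0 => /eqP /(congr1 (@pw R n)); rewrite pw_vec -(vec0 R n) pw_vec => ->.
  move=> /Hp; rewrite HE hform_blk; blks.
  by rewrite conjc0 mulr0 add0r trmx_mul trmxK.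
have pd : posdef h.
  split; first by rewrite -[LHS]/(cmx h^T) e4 cmxK.
  move=> u u0; have cu0 : cmx u != 0.
    by apply: contra u0 => /eqP h0; rewrite -[u]cmxK h0 cmx0.
  by have := hp _ cu0; rewrite cmxK -cmx_tr.
have [T uT hT] := posdef_factor pd.
have uh : h \in unitmx.
  rewrite hT unitmx_mul uT /= -[T^t*%sesqui]/(cmx T^T) /cmx map_unitmx unitmx_tr //.
(* The choice solving [v^T h = - r], so that [Z_0 + v] is orthogonal to the ideal. *)
pose v : 'cV[C]_n := - (r *m invmx h)^T.
have vh : v^T *m h = - r by rewrite /v linearN /= trmxK mulNmx mulmxKV.
have hv : h *m cmx v = - c.
  have := congr1 (fun X => cmx X^T) vh; rewrite trmx_mul trmxK cmxM e4 cmxK => ->.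
  by rewrite linearN /= e3 cmxN cmxK.
(* Schur complement, equal to the squared length of [Z_0 + v]; hence real and positive. *)
pose s_ := a + (v^T *m c) 0 0.
have sp : 0 < s_.
  have v0 : vec 1 v != 0.
    apply/eqP => /(congr1 (@pz R n)); rewrite pz_vec -(vec0 R n) pz_vec => /eqP.
    by rewrite oner_eq0.
  have := Hp _ v0; rewrite HE hform_blk conjc1 scale1r !mulr1.
  have -> : r^T + h^T *m v = 0.
    by rewrite -[v]trmxK -trmx_mul vh linearN addrN.
  rewrite trmx0 mul0mx mx0E addr0 /s_.
  by have -> : (c^T *m v) 0 0 = (v^T *m c) 0 0 by rewrite -[c^T *m v]trmxK trmx_mul trmxK mxE.
have sR : s_ = rC (complex.Re s_) by move: sp; rewrite ltcE /= => /andP [/eqP e _]; case: (s_) e => x y /= ->.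
exists v, (complex.Re s_), T^T; split.
- by rewrite -lt_rC -sR.
- by rewrite unitmx_tr.
rewrite -sR trmxK -[cmx T^T]/(T^t*%sesqui) -hT {1}HE gvE blk_tr blk_cmx trmx1 !blkM.
rewrite !trmx0 cmx0 cmx1 conjc1; blks.
by rewrite vh addrN mul0mx mx0E addr0 hv addrN.
Qed.

End ThetaFormula.

(** * Linear automorphisms and the normal form of a soliton *)

Section Solitons.
Local Open Scope sesquilinear_scope.
Variable R : realType.
Local Notation C := (complex R).

Lemma pullback_comp n (X Y H : 'M[C]_n) a :
  Y^T *m (a *: (X^T *m H *m cmx X)) *m cmx Y =
  a *: ((X *m Y)^T *m H *m cmx (X *m Y)).
Proof. by rewrite -scalemxAr -scalemxAl trmx_mul cmxM !mulmxA. Qed.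

Lemma scale_mulmx3 n (a b c : C) (X Y Z : 'M[C]_n) :
  (a *: X) *m (b *: Y) *m (c *: Z) = (a * b * c) *: (X *m Y *m Z).
Proof.
have -> : (a *: X) *m (b *: Y) = (a * b) *: (X *m Y).
  by rewrite -scalemxAl -scalemxAr scalerA.
by rewrite -scalemxAl -scalemxAr scalerA.
Qed.

Lemma homothetic_trans n (A : 'M[C]_n) H1 H2 H3 :
  homothetic A H1 H2 -> homothetic A H2 H3 -> homothetic A H1 H3.
Proof.
move=> [c [f [f' [Df [Df' [c0 [hf [hf' [ff' [f'f [fM fH]]]]]]]]]]].
move=> [d [g [g' [Dg [Dg' [d0 [hg [hg' [gg' [g'g [gM gH]]]]]]]]]]].
exists (d * c), (fun p => f (g p)), (fun p => g' (f' p)).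
exists (fun p => Df (g p) *m Dg p), (fun p => Dg' (f' p) *m Df' p).
split; first by rewrite mulr_gt0.
split; first by apply/fderP => p; apply: fder_comp; [move/fderP: hg | move/fderP: hf]; apply.
split; first by apply/fderP => p; apply: fder_comp; [move/fderP: hf' | move/fderP: hg']; apply.
split; first by move=> p; rewrite ff' gg'.
split; first by move=> p; rewrite g'g f'f.
split; first by move=> p q; rewrite gM fM.
move=> p; rewrite gH fH rCM -scalerA; congr (_ *: _).
exact: pullback_comp.
Qed.

(** The automorphism is [(z, w) |-> (al z, B w)]; the factor [al] is what absorbs a rescaling of
    [A]. *)
Lemma homothetic_linear n (A B : 'M[C]_n) (al : C) (c : R) H :
  0 < c -> al != 0 -> B \in unitmx -> B *m A = al *: (A *m B) ->
  homothetic A H (rC c *: ((blk al 0 0 B)^T *m H *m cmx (blk al 0 0 B))).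
Proof.
move=> c0 al0 uB hB; pose G := blk al 0 0 B; pose G' := blk al^-1 0 0 (invmx B).
have GG : G *m G' = 1%:M by rewrite /G /G' blkM; blks; rewrite divff // mulmxV // blk1.
have GG' : G' *m G = 1%:M by apply: mulmx1C.
have pzG q : pz (G *m q) = al * pz q by rewrite {1}[q]vecE /G blk_mul_vec pz_vec; blks.
have GL z : G *m Lam A z = Lam A (al * z) *m G.
  rewrite /G !LamE !blkM; blks; congr (blk al 0 0 _); apply: expm_intertwine.
  by rewrite -scalemxAr hB scalerA -scalemxAl mulrC.
have GLV z : LamV A (al * z) *m G = G *m LamV A z by rewrite !LamVN GL mulrN.
exists c, (fun p => G *m p), (fun p => G' *m p), (fun=> G), (fun=> G').
split=> //; split; first by apply/fderP => p; apply: fder_linear.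
split; first by apply/fderP => p; apply: fder_linear.
split; first by move=> p; rewrite mulmxA GG' mul1mx.
split; first by move=> p; rewrite mulmxA GG mul1mx.
split.
  by move=> p q; rewrite /gmul !dLE -!LamE mulmxDr mulmxA GL pzG mulmxA.
move=> p; rewrite !HfieldE pzG -/G -scalemxAr -scalemxAl; congr (_ *: _).
by rewrite !mulmxA -!trmx_mul -GLV -!mulmxA -!cmxM -GLV.
Qed.

Definition normal_mx n (A : 'M[C]_n) : Prop := A *m A^t* = A^t* *m A.
Definition oscillator_at n (g : R) (A : 'M[C]_n) : Prop :=
  [/\ 0 < g, exists k, A ^+ k = 0 & A *m A^t* *m A - A *m A *m A^t* = rC g *: A].

Lemma cmx_scalar n (x : R) : cmx (rC x)%:M = (rC x)%:M :> 'M[C]_n.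
Proof. by rewrite /cmx map_scalar_mx; congr (_%:M); exact: conj_rC. Qed.

Lemma adj_scalar n (x : R) : (rC x)%:M^t* = (rC x)%:M :> 'M[C]_n.
Proof. by rewrite -[LHS]/(cmx (rC x)%:M^T) tr_scalar_mx cmx_scalar. Qed.

Lemma invmx_gram n (Q : 'M[C]_n) : Q \in unitmx ->
  invmx (Q^T *m cmx Q) = cmx (invmx Q) *m (invmx Q)^T.
Proof.
move=> uQ; move: (mulmxV uQ); move: (invmx Q) => P QP.
have hh : (Q^T *m cmx Q) *m (cmx P *m P^T) = 1%:M.
  rewrite mulmxA -[Q^T *m cmx Q *m cmx P]mulmxA -cmxM QP cmx1 mulmx1.
  by rewrite -trmx_mul (mulmx1C QP) trmx1.
by rewrite -[RHS](mulKmx (mulmx1_unit hh).1) hh mulmx1.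
Qed.

Lemma gram_conjugate n (a a' b b' d d' x x' : 'M[C]_n) (c l : C) :
  a' *m a = 1%:M -> b *m b' = 1%:M ->
  d *m (a *m b) + (a *m b) *m d' =
    (a *m b) *m (c *: (x *m (b' *m a') *m x')) *m (a *m b) - l *: (a *m b) ->
  a' *m d *m a + b *m d' *m b' = c *: ((b *m x *m b') *m (a' *m x' *m a)) - l%:M.
Proof.
move=> h1 h2 e; have := congr1 (fun X => a' *m X *m b') e.
have -> : a' *m (d *m (a *m b) + a *m b *m d') *m b' = a' *m d *m a + b *m d' *m b'.
  by rewrite mulmxDr mulmxDl !mulmxA -[_ *m b *m b']mulmxA h2 mulmx1 h1 mul1mx.
have p1 : a' *m (l *: (a *m b)) *m b' = l%:M.
  by rewrite -scalemxAr -scalemxAl mulmxA h1 mul1mx h2 scalemx1.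
have p2 (Y : 'M[C]_n) : a' *m (a *m b *m (c *: Y) *m (a *m b)) *m b' = c *: (b *m Y *m a).
  rewrite -[a *m b *m (c *: Y)]scalemxAr -scalemxAl -scalemxAr -scalemxAl !mulmxA h1 mul1mx.
  by rewrite -[_ *m b *m b']mulmxA h2 mulmx1.
by rewrite mulmxBr mulmxBl p1 p2 !mulmxA.
Qed.

(** Conjugation by [Q] turns the metric on the ideal into the identity matrix. *)
Lemma gram_lyapunov n (A D Q P : 'M[C]_n) (c l : R) : Q *m P = 1%:M ->
  D^T *m (Q^T *m cmx Q) + (Q^T *m cmx Q) *m cmx D =
    (Q^T *m cmx Q) *m (rC c *: (cmx A *m (cmx P *m P^T) *m A^T)) *m (Q^T *m cmx Q)
    - rC l *: (Q^T *m cmx Q) ->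
  Q *m D *m P + (Q *m D *m P)^t* =
    rC c *: ((Q *m A *m P) *m (Q *m A *m P)^t*) - (rC l)%:M.
Proof.
move=> QP e.
have tQP : P^T *m Q^T = 1%:M by rewrite -trmx_mul QP trmx1.
have cQP : cmx Q *m cmx P = 1%:M by rewrite -cmxM QP cmx1.
have xt (Z : 'M[C]_n) : P^T *m Z^T *m Q^T = (Q *m Z *m P)^T by rewrite !trmx_mul mulmxA.
have xc (Z : 'M[C]_n) : cmx Q *m cmx Z *m cmx P = cmx (Q *m Z *m P) by rewrite !cmxM.
move: (gram_conjugate tQP cQP e); rewrite !xt !xc; clear.
move: (Q *m D *m P) (Q *m A *m P) => X Y /(congr1 (@cmx R n n)).
by rewrite !cmxD cmxN cmxZ cmxM !cmxK cmx_scalar conj_rC addrC.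
Qed.

Lemma commutator_conjugate n (A D Q P : 'M[C]_n) (l be : C) : P *m Q = 1%:M ->
  D *m A - A *m D = be *: A ->
  (Q *m D *m P + l%:M) *m (Q *m A *m P) - (Q *m A *m P) *m (Q *m D *m P + l%:M) =
  be *: (Q *m A *m P).
Proof.
move=> PQ e; rewrite mulmxDl mulmxDr mul_scalar_mx mul_mx_scalar opprD addrACA subrr addr0.
have pm (Z W : 'M[C]_n) : (Q *m Z *m P) *m (Q *m W *m P) = Q *m (Z *m W) *m P.
  by rewrite !mulmxA -[_ *m P *m Q]mulmxA PQ mulmx1.
by rewrite !pm -mulmxBl -mulmxBr e -scalemxAr -scalemxAl.
Qed.

Lemma lyapunov_normal_form n (A D : 'M[C]_n) (s lam : R) be : 0 < s ->
  D + D^t* = rC s^-1 *: (A *m A^t*) - (rC lam)%:M ->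
  (D + (rC (lam / 2))%:M) *m A - A *m (D + (rC (lam / 2))%:M) = be *: A ->
  normal_mx A \/ exists g, oscillator_at g A.
Proof.
move=> sp DD MA0.
have s0 : rC s != 0 :> C by rewrite rC_eq0 gt_eqF.
have sV : 0 < rC s^-1 :> C by rewrite -rC0 lt_rC invr_gt0.
pose a : C := sqrtC (rC s^-1).
have a0 : 0 < a by rewrite sqrtC_gt0.
have aa : a * a^* = rC s^-1 by rewrite geC0_conj ?(ltW a0) // -expr2 sqrtCK.
clearbody a.
(* The real shift by [lam / 2] absorbs the [lam] term and commutes with [A]; scaling [A] by [a], a
   square root of [s^-1], absorbs the remaining constant. *)
set M := D + (rC (lam / 2))%:M in MA0.
have half : (rC (lam / 2))%:M + (rC (lam / 2))%:M = (rC lam)%:M :> 'M[C]_n.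
  apply/matrixP => i j; rewrite mxDE !mxE -mulrnDl -rCD; congr (rC _ *+ _).
  by field.
have MM : M + M^t* = (a *: A) *m (a *: A)^t*.
  rewrite adjZ -scalemxAl -scalemxAr scalerA aa /M adjD adj_scalar addrACA DD half.
  by rewrite subrK.
have MA : M *m (a *: A) - (a *: A) *m M = be *: (a *: A).
  by rewrite -scalemxAr -scalemxAl -scalerBr MA0 !scalerA mulrC.
have [nm|[g [g0 [k nil] os]]] := normal_or_oscillator MM MA; [left|right].
  apply: (@scalerI _ _ (rC s^-1)); first by rewrite gt_eqF.
  move: nm; rewrite adjZ -!scalemxAl -!scalemxAr !scalerA aa [a^* * a]mulrC aa.
  exact.
have gR : g = rC (complex.Re g).
  by move: g0; rewrite ltcE /= => /andP [/eqP eg _]; case: (g) eg => x y /= ->.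
exists (complex.Re g * s); split.
- by rewrite mulr_gt0 // -lt_rC -gR.
- exists k; move: nil; rewrite expr_scalemx => /eqP.
  by rewrite scaler_eq0 expf_eq0 gt_eqF // andbF => /eqP.
move: os; rewrite adjZ !scale_mulmx3 [a * a * a^*]mulrAC aa -scalerBr => os.
apply: (@scalerI _ _ (rC s^-1 * a)); first by rewrite mulf_neq0 ?gt_eqF.
by rewrite os !scalerA; congr (_ *: _); rewrite rCM rCV -gR; field.
Qed.

Lemma soliton_normal_form n (A : 'M[C]_n) H : hcf_soliton A H ->
  exists v (s : R) (Q : 'M[C]_n), [/\ 0 < s, Q \in unitmx,
    (gv v)^T *m H *m cmx (gv v) = blk (rC s) 0 0 (Q^T *m cmx Q) &
    normal_mx (Q *m A *m invmx Q) \/ exists g, oscillator_at g (Q *m A *m invmx Q)].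
Proof.
move=> /soliton_ksol [pd [lam ks]].
have [v [s [Q [sp uQ e]]]] := adapted_frame pd.
exists v, s, Q; split=> //.
have uh : Q^T *m cmx Q \in unitmx by rewrite unitmx_mul unitmx_tr uQ /cmx map_unitmx.
have := ksol_psiv v ks; rewrite e mulmxBr mulmxBl (Theta_adapted A sp uh e).
have -> : (gv v)^T *m (rC lam *: H) *m cmx (gv v) = rC lam *: blk (rC s) 0 0 (Q^T *m cmx Q).
  by rewrite -scalemxAr -scalemxAl e.
rewrite blkZ blkN blkD !scaler0 !oppr0 !addr0 add0r.
move=> /(ksol_block sp uh) [D [be [_ e2 e3]]].
rewrite (invmx_gram uQ) -rCV in e2.
move: (mulmxV uQ) (mulVmx uQ) e2; move: (invmx Q) => P QP PQ e2.
exact: (lyapunov_normal_form sp (gram_lyapunov QP e2) (commutator_conjugate _ PQ e3)).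
Qed.

End Solitons.

(** * Uniqueness up to homothety and existence *)

Section Classification.
Local Open Scope sesquilinear_scope.
Variable R : realType.
Local Notation C := (complex R).

(** Halving an exponent [2 ^ m]: a Hermitian matrix with square zero vanishes. *)
Lemma hermitian_nilpotent n (B : 'M[C]_n) k : B^t* = B -> B ^+ k = 0 -> B = 0.
Proof.
move=> hB h; have key m : B ^+ (2 ^ m) = 0 -> B = 0.
  elim: m => [|m IH]; first by rewrite expn0 expr1.
  move=> hm; apply: IH; apply: mul_adj_eq0.
  by rewrite adjX hB mulmxE -exprD addnn -mul2n -expnS.
apply: (key k); have le : (k <= 2 ^ k)%N by apply: ltnW; apply: ltn_expl.
by rewrite -(subnK le) exprD h mulr0.
Qed.

Lemma normal_nilpotent n (A : 'M[C]_n) k : normal_mx A -> A ^+ k = 0 -> A = 0.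
Proof.
move=> nm Ak; apply: mul_adj_eq0; apply: (@hermitian_nilpotent _ _ k).
  by rewrite adjM trmxCK.
rewrite mulmxE exprMn_comm; first by rewrite Ak mul0r.
exact: nm.
Qed.

Lemma similar_power n (A Q : 'M[C]_n) k : Q \in unitmx ->
  (Q *m A *m invmx Q) ^+ k = Q *m A ^+ k *m invmx Q.
Proof.
move=> uQ; elim: k => [|k IH]; first by rewrite !expr0 -idmxE mulmx1 mulmxV.
by rewrite !exprSr IH -!mulmxE !mulmxA mulmxKV.
Qed.

Lemma similar_eq0 n (A Q : 'M[C]_n) : Q \in unitmx -> Q *m A *m invmx Q = 0 -> A = 0.
Proof.
move=> uQ h.
have <- : invmx Q *m (Q *m A *m invmx Q) *m Q = A by rewrite !mulmxA mulVmx // mul1mx mulmxKV.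
by rewrite h mulmx0 mul0mx.
Qed.

Lemma rank_similar n (A Q : 'M[C]_n) : Q \in unitmx -> \rank (Q *m A *m invmx Q) = \rank A.
Proof.
move=> uQ; rewrite mxrankMfree ?row_free_unit ?unitmx_inv //.
by rewrite (eqmxMfull A) // row_full_unit.
Qed.

Lemma rank_scaled_similar n (A Q : 'M[C]_n) (a : C) k : Q \in unitmx -> a != 0 ->
  \rank ((a *: (Q *m A *m invmx Q)) ^+ k) = \rank (A ^+ k).
Proof.
move=> uQ a0; rewrite expr_scalemx mxrank_scale_nz ?expf_neq0 //.
by rewrite similar_power // rank_similar.
Qed.

Lemma soliton_diagonalizable_or_nilpotent n (A : 'M[C]_n) H :
  hcf_soliton A H -> diagonalizable A \/ nilpotent_mx A.
Proof.
move=> /soliton_normal_form [v [s [Q [_ uQ _ [nm|[g [_ [k nil] _]]]]]]]; last first.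
  by right; exists k; apply: (similar_eq0 uQ); rewrite -similar_power.
left; have /orthomx_spectralP : Q *m A *m invmx Q \is normalmx by apply/normalmxP.
cbv zeta; set S := spectralmx _; set d := spectral_diag _ => e.
have uS : S \in unitmx by apply: unitarymx_unit; apply: spectral_unitarymx.
have eQ : Q *m A = invmx S *m diag_mx d *m S *m Q by rewrite -e mulmxKV.
have uSQ : S *m Q \in unitmx by rewrite unitmx_mul uS.
exists (S *m Q) => //; rewrite /similar_to conjumx //; apply/diag_mxP; exists d.
rewrite -[S *m Q *m A]mulmxA eQ !mulmxA mulmxV // mul1mx.
by rewrite -[_ *m S *m Q]mulmxA mulmxK.
Qed.

Lemma blk_congruence n (a s : C) (X h : 'M[C]_n) :
  (blk a 0 0 X)^T *m blk s 0 0 h *m cmx (blk a 0 0 X) =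
  blk (a * s * conjc a) 0 0 (X^T *m h *m cmx X).
Proof. by rewrite blk_tr blk_cmx !trmx0 !cmx0 !blkM; blks. Qed.

Lemma blk_derivation n (a s : C) (X h : 'M[C]_n) :
  (blk a 0 0 X)^T *m blk s 0 0 h + blk s 0 0 h *m cmx (blk a 0 0 X) =
  blk (a * s + s * conjc a) 0 0 (X^T *m h + h *m cmx X).
Proof. by rewrite blk_tr blk_cmx !trmx0 !cmx0 !blkM blkD; blks. Qed.

Lemma conj_lyapunov n (h k M A : 'M[C]_n) : h *m cmx k = 1%:M ->
  M *m k + k *m M^t* = A *m k *m A^t* ->
  M^T *m h + h *m cmx M = h *m (cmx A *m cmx k *m A^T) *m h.
Proof.
move=> hk e; have kh := mulmx1C hk.
have tK (Y : 'M[C]_n) : cmx (Y^t*) = Y^T := cmxK Y^T.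
have := congr1 (@cmx R n n) e; rewrite cmxD !cmxM !tK => <-.
rewrite mulmxDr mulmxDl !mulmxA hk mul1mx -[_ *m cmx k *m h]mulmxA kh mulmx1.
by rewrite addrC.
Qed.

Lemma block_herm_pd n (Q : 'M[C]_n) (s : R) : 0 < s -> Q \in unitmx ->
  herm_pd (blk (rC s) 0 0 (Q^T *m cmx Q)).
Proof.
move=> sp uQ; split.
  by rewrite blk_tr blk_cmx conj_rC !trmx0 !cmx0 trmx_mul trmxK cmxM cmxK cmx_tr.
move=> v v0; pose a := (Q *m pw v)^T.
have ea : ((Q^T *m cmx Q)^T *m pw v)^T *m cmx (pw v) = a *m a^t*.
  by rewrite -[a^t*]/(cmx a^T) /a trmxK !trmx_mul !trmxK cmxM !mulmxA.
have e : hform (blk (rC s) 0 0 (Q^T *m cmx Q)) v v =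
    rC s * (pz v * conjc (pz v)) + (a *m a^t*) 0 0.
  rewrite {1 2}[v]vecE hform_blk !trmx0 mul0mx mx0E addr0 scaler0 add0r ea.
  by rewrite mulrA.
have z0 : 0 <= pz v * conjc (pz v) by exact: mul_conjC_ge0.
have a0 := row_mul_adj_ge0 a.
have s0 : 0 < rC s :> C by rewrite -rC0 lt_rC.
have sz0 : 0 <= rC s * (pz v * conjc (pz v)) by rewrite mulr_ge0 // ltW.
rewrite e lt_def addr_ge0 // andbT paddr_eq0 //.
apply: contra v0 => /andP [h1 /eqP /row_mul_adj_eq0 h2].
have pz0 : pz v = 0.
  move: h1; rewrite mulf_eq0 gt_eqF //= => h1; apply/eqP; rewrite -mul_conjC_eq0; exact: h1.
have pw0 : pw v = 0 by rewrite -[pw v](mulKmx uQ) -[Q *m pw v]trmxK -/a h2 trmx0 mulmx0.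
by rewrite [v]vecE pz0 pw0 vec0.
Qed.

(** [B = P1 V Q2] carries one metric on the ideal to the other and commutes with [A] up to [be^-1],
    which [homothetic_linear] compensates along [Z_0]. *)
Lemma block_homothetic n (A Q1 P1 Q2 P2 U V : 'M[C]_n) (s1 s2 be : R) :
  0 < s1 -> 0 < s2 -> 0 < be -> Q1 *m P1 = 1%:M -> Q2 *m P2 = 1%:M ->
  U *m V = 1%:M -> V^T *m cmx V = 1%:M ->
  U *m (Q1 *m A *m P1) = rC be *: (Q2 *m A *m P2 *m U) ->
  homothetic A (blk (rC s1) 0 0 (Q1^T *m cmx Q1)) (blk (rC s2) 0 0 (Q2^T *m cmx Q2)).
Proof.
move=> s1p s2p bp QP1 QP2 UU cU hU.
have [PQ1 PQ2] := (mulmx1C QP1, mulmx1C QP2).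
have UU' : V *m U = 1%:M by apply: mulmx1C.
have uU : V \in unitmx := (mulmx1_unit UU').1.
pose B := P1 *m V *m Q2.
have uB : B \in unitmx by rewrite !unitmx_mul uU (mulmx1_unit PQ1).1 (mulmx1_unit PQ2).2.
have h1 : U *m Q1 *m A = rC be *: (Q2 *m A *m P2 *m U *m Q1).
  by have := congr1 (fun X => X *m Q1) hU; rewrite !mulmxA -scalemxAl -[_ *m P1 *m Q1]mulmxA PQ1 mulmx1.
have IB : P2 *m U *m Q1 *m B = 1%:M.
  by rewrite /B !mulmxA -[_ *m Q1 *m P1]mulmxA QP1 mulmx1 -[_ *m U *m V]mulmxA UU mulmx1.
have QB : Q1 *m B = V *m Q2 by rewrite /B !mulmxA QP1 mul1mx.
have hB : B *m A = rC be^-1 *: (A *m B).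
  have -> : A *m B = rC be *: (B *m A).
    have h2 : Q1 *m A = rC be *: (V *m (Q2 *m A *m P2 *m U *m Q1)).
      by rewrite scalemxAr -h1 !mulmxA UU' mul1mx.
    have aux (X : 'M[C]_n) : P1 *m (V *m (Q2 *m A *m P2 *m U *m Q1)) *m X =
        P1 *m V *m Q2 *m A *m (P2 *m U *m Q1 *m X) by rewrite !mulmxA.
    have eA : A = P1 *m (Q1 *m A) by rewrite mulmxA PQ1 mul1mx.
    by rewrite {1}eA h2 -scalemxAr -scalemxAl aux IB mulmx1.
  by rewrite scalerA -rCM mulVf ?gt_eqF // rC1 scale1r.
clearbody B.
have BB : B^T *m (Q1^T *m cmx Q1) *m cmx B = Q2^T *m cmx Q2.
  transitivity ((Q1 *m B)^T *m cmx (Q1 *m B)); first by rewrite trmx_mul cmxM !mulmxA.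
  by rewrite QB trmx_mul cmxM !mulmxA -[_ *m V^T *m _]mulmxA cU mulmx1.
(* Two scalings match two lengths: [c be^-2 s1 = s2] along [Z_0], and [c t^2 = 1] on the ideal. *)
pose c := s2 * be ^+ 2 / s1.
have cp : 0 < c by rewrite divr_gt0 ?mulr_gt0 ?exprn_gt0.
pose t := (Num.sqrt c)^-1.
have tp : 0 < t by rewrite invr_gt0 sqrtr_gt0.
have ct : c * t * t = 1.
  by rewrite -mulrA -expr2 /t exprVn sqr_sqrtr ?(ltW cp) // divff ?gt_eqF.
have E : rC c *: ((blk (rC be^-1) 0 0 (rC t *: B))^T *m blk (rC s1) 0 0 (Q1^T *m cmx Q1)
    *m cmx (blk (rC be^-1) 0 0 (rC t *: B))) = blk (rC s2) 0 0 (Q2^T *m cmx Q2).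
  rewrite blk_congruence blkZ !scaler0 conj_rC; congr (blk _ _ _ _).
    rewrite -!rCM; congr rC; rewrite /c; field.
    by rewrite !gt_eqF.
  have -> : (rC t *: B)^T *m (Q1^T *m cmx Q1) *m cmx (rC t *: B) =
      (rC t * rC t) *: (B^T *m (Q1^T *m cmx Q1) *m cmx B).
    by rewrite linearZ /= cmxZ conj_rC -!scalemxAl -scalemxAr scalerA.
  by rewrite BB scalerA mulrA -!rCM ct rC1 scale1r.
have al0 : rC be^-1 != 0 :> C by rewrite rC_eq0 invr_eq0 gt_eqF.
have utB : rC t *: B \in unitmx by rewrite unitmxZ // unitfE rC_eq0 gt_eqF.
have htB : (rC t *: B) *m A = rC be^-1 *: (A *m (rC t *: B)).
  by rewrite -scalemxAl hB -scalemxAr !scalerA mulrC.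
exact: (eq_ind _ (homothetic A _) (homothetic_linear _ cp al0 utB htB) _ E).
Qed.

Lemma adj_unitary_conj n (U : 'M[C]_n) : U *m U^t* = 1%:M ->
  (U^t*)^T *m cmx (U^t*) = 1%:M.
Proof.
move=> UU; have -> : (U^t*)^T = cmx U by rewrite -[U^t*]/(cmx U^T) cmx_tr trmxK.
by rewrite -cmxM UU cmx1.
Qed.

Lemma homothetic_translate n (A : 'M[C]_n) H1 H2 v1 v2 K1 K2 :
  (gv v1)^T *m H1 *m cmx (gv v1) = K1 -> (gv v2)^T *m H2 *m cmx (gv v2) = K2 ->
  homothetic A K1 K2 -> homothetic A H1 H2.
Proof.
move=> e1 e2 h.
have h1 : homothetic A H1 K1 by rewrite -e1; apply: homothetic_psiv.
apply: homothetic_trans h1 _; apply: homothetic_trans h _.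
have -> : H2 = (gv (- v2))^T *m K2 *m cmx (gv (- v2)).
  have g : gv v2 *m gv (- v2) = 1%:M by rewrite gvM addrN gv0.
  by rewrite -e2 !mulmxA -trmx_mul g trmx1 mul1mx -mulmxA -cmxM g cmx1 mulmx1.
exact: homothetic_psiv.
Qed.

Lemma oscillator_at_scale n g (A : 'M[C]_n) :
  oscillator_at g A -> oscillator (rC (Num.sqrt g)^-1 *: A).
Proof.
move=> [gp _ h]; rewrite /oscillator adjZ.
have -> : Num.conj (rC (Num.sqrt g)^-1 : C) = rC (Num.sqrt g)^-1 by exact: conj_rC.
rewrite !scale_mulmx3 -scalerBr h scalerA -!rCM; congr (rC _ *: _).
have q0 : Num.sqrt g != 0 by rewrite gt_eqF // sqrtr_gt0.
rewrite -[X in _ * X](sqr_sqrtr (ltW gp)); by field.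
Qed.

Lemma soliton_unique n (A : 'M[C]_n) H1 H2 :
  hcf_soliton A H1 -> hcf_soliton A H2 -> homothetic A H1 H2.
Proof.
move=> /soliton_normal_form [v1 [s1 [Q1 [sp1 u1 e1 c1]]]].
move=> /soliton_normal_form [v2 [s2 [Q2 [sp2 u2 e2 c2]]]].
apply: (homothetic_translate e1 e2).
set A1 := Q1 *m A *m invmx Q1 in c1 *; set A2 := Q2 *m A *m invmx Q2 in c2 *.
have nrm : normal_mx A1 -> normal_mx A2 ->
    homothetic A (blk (rC s1) 0 0 (Q1^T *m cmx Q1)) (blk (rC s2) 0 0 (Q2^T *m cmx Q2)).
  move=> n1 n2.
  have uB : Q2 *m invmx Q1 \in unitmx by rewrite unitmx_mul unitmx_inv u1 u2.
  have hB : Q2 *m invmx Q1 *m A1 = A2 *m (Q2 *m invmx Q1).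
    by rewrite /A1 /A2 !mulmxA !mulmxKV.
  have [U UU hU] := normal_unitary_equiv n1 n2 uB hB.
  apply: (block_homothetic sp1 sp2 ltr01 (mulmxV u1) (mulmxV u2) UU (adj_unitary_conj UU)).
  by rewrite rC1 scale1r.
(* If one normal form is normal and the other nilpotent, then [A = 0] and both are normal. *)
have mixed Q Q' k : Q \in unitmx -> Q' \in unitmx -> normal_mx (Q *m A *m invmx Q) ->
    (Q' *m A *m invmx Q') ^+ k = 0 -> normal_mx (Q' *m A *m invmx Q').
  move=> uQ uQ' nm nil.
  have A0 : A ^+ k = 0 by apply: (similar_eq0 uQ'); rewrite -similar_power.
  have Ak : (Q *m A *m invmx Q) ^+ k = 0 by rewrite similar_power // A0 mulmx0 mul0mx.
  rewrite (similar_eq0 uQ (normal_nilpotent nm Ak)) mulmx0 mul0mx /normal_mx.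
  by rewrite mul0mx mulmx0.
case: c1 => [n1|[g1 o1]]; case: c2 => [n2|[g2 o2]].
- exact: nrm.
- by have [_ [k nil] _] := o2; exact: (nrm n1 (mixed _ _ _ u1 u2 n1 nil)).
- by have [_ [k nil] _] := o1; exact: (nrm (mixed _ _ _ u2 u1 n2 nil) n2).
have [g1p [k nil1] _] := o1; have [g2p _ _] := o2.
have [o1' o2'] := (oscillator_at_scale o1, oscillator_at_scale o2).
set a1 := (Num.sqrt g1)^-1 in o1'; set a2 := (Num.sqrt g2)^-1 in o2'.
have a1p : 0 < a1 by rewrite invr_gt0 sqrtr_gt0.
have a2p : 0 < a2 by rewrite invr_gt0 sqrtr_gt0.
clearbody a1 a2.
have r1 : rC a1 != 0 :> C by rewrite rC_eq0 gt_eqF.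
have r2 : rC a2 != 0 :> C by rewrite rC_eq0 gt_eqF.
have nil1' : (rC a1 *: A1) ^+ k = 0 by rewrite expr_scalemx nil1 scaler0.
have rk j : \rank ((rC a1 *: A1) ^+ j) = \rank ((rC a2 *: A2) ^+ j).
  exact: etrans (rank_scaled_similar A j u1 r1) (esym (rank_scaled_similar A j u2 r2)).
have [U UU hU] := oscillator_unitary_equiv o1' o2' nil1' rk.
have bp : 0 < a1^-1 * a2 by rewrite mulr_gt0 ?invr_gt0.
apply: (block_homothetic sp1 sp2 bp (mulmxV u1) (mulmxV u2) UU (adj_unitary_conj UU)).
apply: (@scalerI _ _ (rC a1)); first by rewrite rC_eq0 gt_eqF.
by rewrite scalerA -rCM mulrA mulfV ?gt_eqF // mul1r scalemxAr hU -scalemxAl.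
Qed.

(** The soliton field is linear, given by a derivation of the Lie algebra. By [commutator_expm] its
    matrix [K] is the same at all points, so the equation reduces to one at the identity. *)
Lemma soliton_exists n (A p M : 'M[C]_n) (x : R) : posdef p ->
  M *m A - A *m M = rC x *: A -> M *m p + p *m M^t* = A *m p *m A^t* ->
  exists H, hcf_soliton A H.
Proof.
move=> /posdef_factor [P uP ->]; set k := P *m P^t* => hM hp.
pose Q := invmx P; pose h := Q^T *m cmx Q.
have uQ : Q \in unitmx by rewrite unitmx_inv.
have QP : Q *m P = 1%:M by apply: mulVmx.
have ck : cmx k = cmx P *m P^T by rewrite /k cmxM -[P^t*]/(cmx P^T) cmxK.
have hk : h *m cmx k = 1%:M.
  rewrite ck /h mulmxA -[_ *m cmx Q *m cmx P]mulmxA -cmxM QP cmx1 mulmx1.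
  by rewrite -trmx_mul (mulmx1C QP) trmx1.
have uh : h \in unitmx := (mulmx1_unit hk).1.
have hV : invmx h = cmx k by rewrite -[RHS](mulKmx uh) hk mulmx1.
have ly := conj_lyapunov hk hp.
have pd : herm_pd (blk (rC 1) 0 0 h) := block_herm_pd ltr01 uQ.
rewrite rC1 in pd; clearbody h; clear ck hp QP; clearbody k.
(* [Theta] vanishes on [Z_0], where the derivation acts by [x]; this forces [lam = - 2 x]. The shift
   of [M] by [x] in [D] balances [lam] on the ideal. *)
exists (blk 1 0 0 h); apply/soliton_ksol; split=> //; exists (- (x + x)).
have -> : Theta (mu_A A) (blk 1 0 0 h) = blk 0 0 0 (M^T *m h + h *m cmx M).
  have := @Theta_adapted R n A (blk 1 0 0 h) 0 1 h ltr01 uh.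
  by rewrite gv0 trmx1 cmx1 !mul1mx !mulmx1 hV rC1 invr1 scale1r ly => ->.
pose D := M + (rC x)%:M.
have hD : D *m A - A *m D = rC x *: A.
  rewrite /D mulmxDl mulmxDr mul_scalar_mx mul_mx_scalar opprD addrACA subrr addr0.
  exact: hM.
pose G := blk (rC x) 0 0 D.
exists (fun q => G *m q), (fun=> G); split; first by move=> q; apply: fder_linear.
move=> q; cbv zeta.
have -> : Kmx A (pz q) (pz (G *m q)) G = G.
  have [ga gr gc gB] := blk_inj (blkP G : blk (rC x) 0 0 D = _).
  have -> : pz (G *m q) = rC x * pz q.
    by rewrite {1}[q]vecE /G blk_mul_vec pz_vec mul0mx mx0E addr0.
  rewrite Kmx_blk -gB -ga -gr -gc mul0mx mulmx0 /G; congr (blk _ _ _ _).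
  have DE : D *m mexp (pz q *: A) =
      mexp (pz q *: A) *m D + (rC x * pz q) *: (A *m mexp (pz q *: A)).
    by rewrite -(commutator_expm (pz q) hD) addrC subrK.
  rewrite -mulmxA DE mulmxDr mulmxA expmVK mul1mx -scalemxAr mulmxA -expmV_comm.
  by rewrite -mulmxA expmVK mulmx1 addrK.
rewrite /G blk_derivation conj_rC rCN scaleNr opprK blkZ blkD !scaler0 !addr0 add0r.
congr (blk _ _ _ _); first by rewrite rCD; ring.
have cs : cmx (rC x)%:M = (rC x)%:M :> 'M[C]_n by apply: cmx_scalar.
rewrite /D linearD /= cmxD tr_scalar_mx cs mulmxDl mulmxDr mul_scalar_mx mul_mx_scalar.
by rewrite rCD scalerDl addrACA.
Qed.

End Classification.

Theorem theorem1p3 (R : realType) (n : nat) (A : 'M[complex R]_n) :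
  (forall H1 H2 : 'M[complex R]_n.+1,
      hcf_soliton A H1 -> hcf_soliton A H2 -> homothetic A H1 H2) /\
  ((exists H : 'M[complex R]_n.+1, hcf_soliton A H) <->
   (diagonalizable A \/ nilpotent_mx A)).
Proof.
split; first exact: soliton_unique.
split=> [[H] | [dA | [k nil]]]; first exact: soliton_diagonalizable_or_nilpotent.
  have [p [M [pd h1 h2]]] := diagonalizable_soliton_data dA.
  by apply: (soliton_exists (x := 0) pd) h2; rewrite rC0.
have [p [M [pd h1 h2]]] := nilpotent_soliton_data nil.
by apply: (soliton_exists (x := 2^-1) pd) h2; rewrite rCV rC_nat.
Qed.
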